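(* Let $d=2$, let $\Omega\subset\mathbb{R}^2$ be an open and bounded domain with Lipschitz boundary, and let $s\in[3,4]$. Let $\nu,\kappa\in C^{0,1}(\mathbb{R})$, with Lipschitz constants $\mathcal{L}_\nu,\mathcal{L}_\kappa$, satisfy $\nu_-\le\nu(r)\le\nu_+$ and $\kappa_-\le\kappa(r)\le\kappa_+$ for all $r\in\mathbb{R}$, with positive constants $\nu_\pm,\kappa_\pm$. Let $\mathbf{f}\in\mathbf{H}^{-1}(\Omega)$ and $g\in H^{-1}(\Omega)$. Assume that, for some $\varepsilon>0$, the coupled problem has a weak solution $(\mathbf{u}_1,\mathsf{p}_1,T_1)\in(\mathbf{W}^{1,2+\varepsilon}(\Omega)\cap\mathbf{H}_0^1(\Omega))\times L_0^2(\Omega)\times(W^{1,2+\varepsilon}(\Omega)\cap H_0^1(\Omega))$ such that $$\frac{\mathcal{C}_N}{\nu_-^2}\|\mathbf{f}\|_{\mathbf{H}^{-1}(\Omega)}+\frac{\mathcal{L}_\nu\mathcal{C}_\varepsilon\mathcal{C}_{4\hookrightarrow2}^2\|g\|_{H^{-1}(\Omega)}\|\nabla\mathbf{u}_1\|_{\mathbf{L}^{2+\varepsilon}(\Omega)}}{\nu_-\kappa_-\left(\kappa_--\mathcal{L}_\kappa\mathcal{C}_\varepsilon\|\nabla T_1\|_{\mathbf{L}^{2+\varepsilon}(\Omega)}\right)}<1,\qquad\mathcal{L}_\kappa\mathcal{C}_\varepsilon\|\nabla T_1\|_{\mathbf{L}^{2+\varepsilon}(\Omega)}<\kappa_-.$$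 Then the coupled problem has no other weak solution $(\mathbf{u}_2,\mathsf{p}_2,T_2)\in\mathbf{H}_0^1(\Omega)\times L_0^2(\Omega)\times H_0^1(\Omega)$.
   Context: Bold letters denote $\mathbb{R}^d$-valued functions and their spaces; $|\cdot|$ is the Euclidean norm. $L_0^2(\Omega)$ is the space of $L^2(\Omega)$ functions with zero mean. $H^{-1}(\Omega)$ and $\mathbf{H}^{-1}(\Omega)$ are the duals of $H_0^1(\Omega)$ and $\mathbf{H}_0^1(\Omega)$, with dual norms taken with respect to the norm $\|\nabla\cdot\|_{L^2(\Omega)}$. Weak solution of the coupled problem: $(\mathbf{u},\mathsf{p},T)\in\mathbf{H}_0^1(\Omega)\times L_0^2(\Omega)\times H_0^1(\Omega)$ such that for all $(\mathbf{v},\mathsf{q},S)\in\mathbf{H}_0^1(\Omega)\times L_0^2(\Omega)\times H_0^1(\Omega)$ $$\int_\Omega\left(\nu(T)\nabla\mathbf{u}\cdot\nabla\mathbf{v}+(\mathbf{u}\cdot\nabla)\mathbf{u}\cdot\mathbf{v}+\mathbf{u}\cdot\mathbf{v}+|\mathbf{u}|^{s-2}\mathbf{u}\cdot\mathbf{v}-\mathsf{p}\,\mathrm{div}\,\mathbf{v}\right)\mathrm{d}x=\langle\mathbf{f},\mathbf{v}\rangle,$$ $$\int_\Omega\mathsf{q}\,\mathrm{div}\,\mathbf{u}\,\mathrm{d}x=0,\qquad\int_\Omega\left(\kappa(T)\nabla T\cdot\nabla S+(\mathbf{u}\cdot\nabla T)S\right)\mathrm{d}x=\langle g,S\rangle.$$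 Constants. $\mathcal{C}_N>0$ is a constant such that $\left|\int_\Omega(\mathbf{u}\cdot\nabla)\mathbf{v}\cdot\mathbf{w}\,\mathrm{d}x\right|\le\mathcal{C}_N\|\nabla\mathbf{u}\|_{\mathbf{L}^2(\Omega)}\|\nabla\mathbf{v}\|_{\mathbf{L}^2(\Omega)}\|\nabla\mathbf{w}\|_{\mathbf{L}^2(\Omega)}$ for all $\mathbf{u},\mathbf{v},\mathbf{w}\in\mathbf{H}_0^1(\Omega)$. $\mathcal{C}_{4\hookrightarrow2}$ is the best constant in $\|v\|_{L^4(\Omega)}\le\mathcal{C}_{4\hookrightarrow2}\|\nabla v\|_{\mathbf{L}^2(\Omega)}$ for $v\in H_0^1(\Omega)$ (same symbol for vector-valued functions in $\mathbf{H}_0^1(\Omega)$). $\mathcal{C}_\varepsilon$ is the best constant in $\|v\|_{L^{2(2+\varepsilon)/\varepsilon}(\Omega)}\le\mathcal{C}_\varepsilon\|\nabla v\|_{\mathbf{L}^2(\Omega)}$ for $v\in H_0^1(\Omega)$. *)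

(* Defs.v *)
From HB Require Import structures.
From mathcomp Require Import all_boot all_order all_algebra.
From mathcomp Require Import all_classical all_reals all_analysis.
Import Order.TTheory GRing.Theory Num.Theory.
Import numFieldNormedType.Exports.

Set Implicit Arguments.
Unset Strict Implicit.
Unset Printing Implicit Defensive.

Local Open Scope classical_set_scope.
Local Open Scope ring_scope.

(* Points of the plane are pairs, because the Lebesgue measure of the library
   lives on products. A vector field is the family of its two components. All
   functions are total on the plane; only their values on the open set under
   consideration matter, and equality means equality almost everywhere there. *)
Notation sfield R := (R * R -> R).
Notation vfield R := ('I_2 -> R * R -> R).

Notation leb2 R := (@lebesgue_measure R \x @lebesgue_measure R)%E.

Definition basis2 (R : realType) (j : 'I_2) : R * R :=
  if j == 0 then (1, 0) else (0, 1).

(* Near each boundary point, after the rotation of angle theta, the set is the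
   strict epigraph of a Lipschitz function of one variable. Reflections need not
   be considered, since the function may be precomposed with t |-> - t. *)
Definition lipschitz_boundary (R : realType) (Om : set (R * R)) : Prop :=
  forall x0, (closure Om `\` interior Om) x0 ->
    exists (theta L : R) (gamma : R -> R), L.-lipschitz gamma /\
      \forall x \near x0,
        Om x <-> gamma (cos theta * x.1 + sin theta * x.2)
                 < - sin theta * x.1 + cos theta * x.2.

Definition bounded_lipschitz_domain (R : realType) (Om : set (R * R)) : Prop :=
  [/\ open Om, connected Om, Om !=set0, bounded_set Om & lipschitz_boundary Om].

Definition Lp (R : realType) (Om : set (R * R)) (p : R) : set (sfield R) :=
  [set v | v \_ Om \in Lfun (leb2 R) p%:E].

Definition Lp_enorm (R : realType) (Om : set (R * R)) (p : R) (v : sfield R) :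
    \bar R :=
  ('N[leb2 R]_(p%:E)[EFin \o (v \_ Om)])%E.

Definition integ (R : realType) (Om : set (R * R)) (v : sfield R) : R :=
  \int[leb2 R]_(x in Om) v x.

Definition L20 (R : realType) (Om : set (R * R)) : set (sfield R) :=
  [set q | Lp Om 2 q /\ integ Om q = 0].

Definition locally_integrable2 (R : realType) (Om : set (R * R))
    (v : sfield R) : Prop :=
  forall K, K `<=` Om -> compact K ->
    (leb2 R).-integrable K (EFin \o v).

Definition iter_partial (R : realType) (js : seq 'I_2) (phi : sfield R) :
    sfield R :=
  foldr (fun j h => 'D_(basis2 R j) h) phi js.

Definition smooth (R : realType) (phi : sfield R) : Prop :=
  forall js, continuous (iter_partial js phi) /\
    forall j x, derivable (iter_partial js phi) x (basis2 R j).

Definition test_function (R : realType) (Om : set (R * R)) : set (sfield R) :=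
  [set phi | [/\ smooth phi, compact (closure [set x | phi x != 0])
               & closure [set x | phi x != 0] `<=` Om]].

Definition is_weak_partial (R : realType) (Om : set (R * R)) (j : 'I_2)
    (v w : sfield R) : Prop :=
  [/\ locally_integrable2 Om v, locally_integrable2 Om w
    & forall phi, test_function Om phi ->
        integ Om (fun x => v x * 'D_(basis2 R j) phi x)
        = - integ Om (fun x => w x * phi x)].

(* A chosen representative: weak derivatives are unique almost everywhere. *)
Definition weak_partial (R : realType) (Om : set (R * R)) (j : 'I_2)
    (v : sfield R) : sfield R :=
  xget (fun=> 0) [set w | is_weak_partial Om j v w].

Definition W1p (R : realType) (Om : set (R * R)) (p : R) : set (sfield R) :=
  [set v | Lp Om p v /\
    forall j, exists2 w, is_weak_partial Om j v w & Lp Om p w].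

Definition grad_abs (R : realType) (Om : set (R * R)) (v : sfield R) :
    sfield R :=
  fun x => Num.sqrt (\sum_j weak_partial Om j v x ^+ 2).

Definition vgrad_abs (R : realType) (Om : set (R * R)) (v : vfield R) :
    sfield R :=
  fun x => Num.sqrt (\sum_i \sum_j weak_partial Om j (v i) x ^+ 2).

Definition vabs (R : realType) (v : vfield R) : sfield R :=
  fun x => Num.sqrt (\sum_i v i x ^+ 2).

Definition grad_norm (R : realType) (Om : set (R * R)) (p : R) (v : sfield R) :
    R :=
  fine (Lp_enorm Om p (grad_abs Om v)).

Definition vgrad_norm (R : realType) (Om : set (R * R)) (p : R) (v : vfield R) :
    R :=
  fine (Lp_enorm Om p (vgrad_abs Om v)).

Definition H10 (R : realType) (Om : set (R * R)) : set (sfield R) :=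
  [set v | W1p Om 2 v /\
    forall e : R, 0 < e -> exists2 phi, test_function Om phi &
      (Lp_enorm Om 2 (v \- phi)%R < e%:E)%E /\
      (Lp_enorm Om 2 (grad_abs Om (v \- phi)%R) < e%:E)%E].

Definition vW1p (R : realType) (Om : set (R * R)) (p : R) : set (vfield R) :=
  [set v | forall i, W1p Om p (v i)].

Definition vH10 (R : realType) (Om : set (R * R)) : set (vfield R) :=
  [set v | forall i, H10 Om (v i)].

(* A functional is total on functions but only its values on the space
   H matter; boundedness makes it compatible with equality almost everywhere. *)

Definition dual_space (R : realType) (V : lmodType R) (H : set V) (N : V -> R) :
    set (V -> R) :=
  [set F | (forall a v w, H v -> H w -> F (a *: v + w) = a * F v + F w) /\
           exists C, forall v, H v -> `|F v| <= C * N v].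

Definition dual_norm (R : realType) (V : lmodType R) (H : set V) (N : V -> R)
    (F : V -> R) : R :=
  sup [set `|F v| | v in [set v | H v /\ N v <= 1]].

Definition Hm1 (R : realType) (Om : set (R * R)) : set (sfield R -> R) :=
  dual_space (H10 Om) (grad_norm Om 2).

Definition Hm1_norm (R : realType) (Om : set (R * R)) (g : sfield R -> R) : R :=
  dual_norm (H10 Om) (grad_norm Om 2) g.

Definition vHm1 (R : realType) (Om : set (R * R)) : set (vfield R -> R) :=
  dual_space (vH10 Om) (vgrad_norm Om 2).

Definition vHm1_norm (R : realType) (Om : set (R * R)) (f : vfield R -> R) : R :=
  dual_norm (vH10 Om) (vgrad_norm Om 2) f.

Definition grad_dot (R : realType) (Om : set (R * R)) (v w : sfield R) :
    sfield R :=
  fun x => \sum_j weak_partial Om j v x * weak_partial Om j w x.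

Definition vgrad_dot (R : realType) (Om : set (R * R)) (v w : vfield R) :
    sfield R :=
  fun x => \sum_i grad_dot Om (v i) (w i) x.

Definition vdot (R : realType) (v w : vfield R) : sfield R :=
  fun x => \sum_i v i x * w i x.

Definition div (R : realType) (Om : set (R * R)) (v : vfield R) : sfield R :=
  fun x => \sum_i weak_partial Om i (v i) x.

Definition adv (R : realType) (Om : set (R * R)) (u : vfield R) (v : sfield R) :
    sfield R :=
  fun x => \sum_j u j x * weak_partial Om j v x.

Definition vadv (R : realType) (Om : set (R * R)) (u v : vfield R) : vfield R :=
  fun i => adv Om u (v i).

Definition weak_solution (R : realType) (Om : set (R * R)) (s : R)
    (nu kappa : R -> R) (f : vfield R -> R) (g : sfield R -> R)
    (u : vfield R) (p T : sfield R) : Prop :=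
  [/\ vH10 Om u, L20 Om p & H10 Om T] /\
  [/\ forall v, vH10 Om v ->
        integ Om (fun x => nu (T x) * vgrad_dot Om u v x
                           + vdot (vadv Om u u) v x
                           + vdot u v x
                           + vabs u x `^ (s - 2) * vdot u v x
                           - p x * div Om v x) = f v,
      forall q, L20 Om q -> integ Om (fun x => q x * div Om u x) = 0
    & forall S, H10 Om S ->
        integ Om (fun x => kappa (T x) * grad_dot Om T S x
                           + adv Om u T x * S x) = g S].

Definition convection_constant (R : realType) (Om : set (R * R)) (C : R) : Prop :=
  forall u v w, vH10 Om u -> vH10 Om v -> vH10 Om w ->
    `|integ Om (vdot (vadv Om u v) w)|
      <= C * vgrad_norm Om 2 u * vgrad_norm Om 2 v * vgrad_norm Om 2 w.

Definition embedding_constant (R : realType) (Om : set (R * R)) (q C : R) : Prop :=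
  forall v, H10 Om v -> (Lp_enorm Om q v <= (C * grad_norm Om 2 v)%:E)%E.

(* The best constant for vector fields is the same, by the triangle inequality
   in L^(q/2) applied to the squares of the components, for q >= 2. *)
Definition best_embedding_constant (R : realType) (Om : set (R * R)) (q C : R) :
    Prop :=
  embedding_constant Om q C /\ forall C', embedding_constant Om q C' -> C <= C'.

(* Main.v *)
Require Import Defs.
From HB Require Import structures.
From mathcomp Require Import all_boot all_order all_algebra.
From mathcomp Require Import all_classical all_reals all_analysis measurable_realfun.
From mathcomp Require Import ring lra.
Import Order.TTheory GRing.Theory Num.Theory.
Import numFieldNormedType.Exports.

(** Let U be the difference of the two velocities and S that of the two
temperatures. The heat equations are subtracted and tested with S, the momentum
equations with U. Since the divergence of a velocity is orthogonal to all square
integrable functions, transport by a velocity is skew symmetric ([skew_adv]), so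
the convective term that contains the unknown difference twice drops out; the
pressure drops out because U is divergence free; the damping term has the good
sign because the power map is monotone ([power_monotone]). What remains are the
convection of the first solution by U, which costs the norm of the gradient of
the first solution, and the variation of the coefficients, which is at most a
Lipschitz constant times |S| times the gradient of the first solution. The latter
is why the first solution must have a gradient of exponent 2 + eps: Hoelder's
inequality with the exponents 2(2 + eps)/eps, 2 + eps and 2 then leaves only the
embedding of the gradient of S. These are [heat_difference] and
[momentum_difference]. The first solution itself is controlled by the data through
the energy bounds [heat_energy] and [momentum_energy], in which the same terms
drop out.

The heat inequality bounds the gradient of S linearly by the gradient of U, and
inserting this in the momentum inequality gives |grad U| <= theta |grad U|, where
theta is the left-hand side of the smallness assumption. Hence both gradients
vanish ([small_data_zero]), and U and S vanish almost everywhere by the embedding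
([grad_norm_eq0]). The momentum equations now show that the difference of the
pressures is orthogonal to all derivatives of test functions. On a connected open
set such a function is constant ([zero_gradient_connected]), and the constant is
zero because both pressures have zero mean ([pressure_unique]).

Underneath lies the theory of weak derivatives, which are representatives chosen
among functions equal almost everywhere. Their uniqueness, and with it their
linearity almost everywhere, says that a locally integrable function with zero
integral against every test function vanishes ([ae_eq0_test]). It follows from
products of smooth bumps of one variable: they are test functions, they converge
boundedly to indicators of rectangles ([ae_eq0_bump]), and the integrals over
rectangles determine an integrable function ([ae_eq0_rect]). The same products
serve for the functions with zero gradient, because a smooth function of one
variable with compact support and zero mean is the derivative of another one.
Skew symmetry is integration by parts for the square of a test function, carried
over to the closure of the test functions by density ([H10_approx]). *)

Set Implicit Arguments.
Unset Strict Implicit.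
Unset Printing Implicit Defensive.

Local Open Scope classical_set_scope.
Local Open Scope ring_scope.

(** * Rectangles in the plane *)

Notation plane R := (measurableTypeR R * measurableTypeR R)%type.

Definition rect (R : realType) (a b c d : R) : set (R * R) :=
  `]a, b[%classic `*` `]c, d[%classic.

Definition crect (R : realType) (a b c d : R) : set (R * R) :=
  `[a, b]%classic `*` `[c, d]%classic.

(** Empty for the numbers that code no rectangle inside U, so that the union over
   all natural numbers is U and countable additivity applies to it. *)
Definition rat_rect (R : realType) (U : set (R * R)) (n : nat) : set (R * R) :=
  if unpickle n is Some q then
    let: ((a, b), (c, d)) := (q : (rat * rat) * (rat * rat)) in
    if `[< crect (ratr a) (ratr b) (ratr c) (ratr d) `<=` U >]
    then rect (ratr a) (ratr b) (ratr c) (ratr d) else set0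
  else set0.

#[local] Instance ae_leb2_filter (R : realType) :
  Filter (nbhs (almost_everywhere (leb2 R))).
Proof. exact: (ae_filter_ringOfSetsType (leb2 R)). Qed.

Section Plane.
Variable R : realType.
Implicit Types (U K : set (R * R)) (x : R * R) (a b c d : R).

Lemma measurable_rect a b c d : measurable (rect a b c d : set (plane R)).
Proof. by apply: measurableX; exact: measurable_itv. Qed.

Lemma measurable_crect a b c d : measurable (crect a b c d : set (plane R)).
Proof. by apply: measurableX; exact: measurable_itv. Qed.

Lemma rect_sub_crect a b c d : rect a b c d `<=` crect a b c d.
Proof. by move=> x [] /= x1 x2; split; exact: subset_itv_oo_cc. Qed.

Lemma compact_crect a b c d : compact (crect a b c d).
Proof. by apply: compact_setX; exact: segment_compact. Qed.

Lemma open_rect a b c d : open (rect a b c d).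
Proof.
rewrite /rect -[X in open X]/((fst @^-1` `]a, b[%classic) `&` (snd @^-1` `]c, d[%classic)).
apply: openI; apply: open_comp => //; try exact: itv_open.
  by move=> x _; exact: cvg_fst.
by move=> x _; exact: cvg_snd.
Qed.

Lemma rat_rectP U n : rat_rect U n = set0 \/
  exists a b c d, crect a b c d `<=` U /\ rat_rect U n = rect a b c d.
Proof.
rewrite /rat_rect; case: unpickle => [[[a b] [c d]]|]; last by left.
by case: asboolP => H; [right; exists (ratr a), (ratr b), (ratr c), (ratr d)|left].
Qed.

Lemma open_bigcup_rat_rect U : open U -> U = \bigcup_n rat_rect U n.
Proof.
move=> oU; apply/seteqP; split => x; last first.
  move=> [n _]; have [->//|[a [b [c [d [sU ->]]]]]] := rat_rectP U n.
  by move/rect_sub_crect/sU.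
move=> Ux; have /nbhs_ballP[e /= e0 eU] : nbhs x U by exact: open_nbhs_nbhs.
have [a] := @rat_in_itvoo R (x.1 - e) x.1 ltac:(lra).
have [b] := @rat_in_itvoo R x.1 (x.1 + e) ltac:(lra).
have [c] := @rat_in_itvoo R (x.2 - e) x.2 ltac:(lra).
have [d] := @rat_in_itvoo R x.2 (x.2 + e) ltac:(lra).
rewrite !in_itv/= => /andP[? ?] /andP[? ?] /andP[? ?] /andP[? ?].
pose q : (rat * rat) * (rat * rat) := ((a, b), (c, d)).
exists (pickle q); first exact: I.
rewrite /rat_rect (pickleK q) /q; case: asboolP => [_|[]].
  by split; rewrite /= in_itv/=; apply/andP; split.
move=> y [] /=; rewrite !in_itv/= => /andP[? ?] /andP[? ?].
by apply: eU; split => /=; rewrite /ball/= ltr_norml; lra.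
Qed.

Lemma measurable_rat_rect U n : measurable (rat_rect U n : set (plane R)).
Proof.
by have [->|[a [b [c [d [_ ->]]]]]] := rat_rectP U n => //; exact: measurable_rect.
Qed.

(** Countably many rectangles cover an open set, so the exceptional sets of the
   individual rectangles have a negligible union. *)
Lemma ae_open_rect U (P : R * R -> Prop) : open U ->
  (forall a b c d, crect a b c d `<=` U ->
     {ae leb2 R, forall x, rect a b c d x -> P x}) ->
  {ae leb2 R, forall x, U x -> P x}.
Proof.
move=> oU H.
have : {ae leb2 R, forall x, forall n, rat_rect U n x -> P x}.
  apply: ae_foralln => n.
  have [->|[a [b [c [d [sU ->]]]]]] := rat_rectP U n; first exact: aeW.
  exact: H.
apply: filterS => x Qx; rewrite {1}(open_bigcup_rat_rect oU) => -[n _].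
exact: Qx.
Qed.

Lemma measurable_open_plane U : open U -> measurable (U : set (plane R)).
Proof.
move=> oU; rewrite (open_bigcup_rat_rect oU).
by apply: bigcupT_measurable => n; exact: measurable_rat_rect.
Qed.

Lemma measurable_closed_plane K : closed K -> measurable (K : set (plane R)).
Proof.
move=> cK; rewrite -(setCK K); apply: measurableC; apply: measurable_open_plane.
exact: closed_openC.
Qed.

Lemma measurable_compact_plane K : compact K -> measurable (K : set (plane R)).
Proof.
move=> cK; apply: measurable_closed_plane; exact: compact_closed.
Qed.

Lemma measurable_fun_crect U (f : R * R -> R) : open U ->
  (forall a b c d, crect a b c d `<=` U ->
     measurable_fun (crect a b c d : set (plane R)) f) ->
  measurable_fun (U : set (plane R)) f.
Proof.
move=> oU H; rewrite (open_bigcup_rat_rect oU).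
apply/(measurable_fun_bigcup f (measurable_rat_rect U)) => n.
have [->|[a [b [c [d [sU ->]]]]]] := rat_rectP U n.
  exact: measurable_fun_set0.
apply: measurable_funS (H _ _ _ _ sU); first exact: measurable_crect.
exact: rect_sub_crect.
Qed.

Lemma continuous_measurable_plane (f : R * R -> R) : continuous f ->
  measurable_fun (setT : set (plane R)) f.
Proof.
move=> cf; apply: (measurability _ (RGenOpens.measurableE R)).
move=> _ [_ [a [b ->]] <-]; rewrite setTI.
by apply: measurable_open_plane; apply: open_comp => //; exact: itv_open.
Qed.

(** Rectangles form a pi-system that generates the Borel sets, so that a Dynkin
   argument extends the vanishing of integrals from rectangles to Borel sets. *)
Lemma ae_eq0_rect a b c d (f : R * R -> R) :
  (leb2 R).-integrable (rect a b c d) (EFin \o f) ->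
  (forall a' b' c' d', a <= a' -> b' <= b -> c <= c' -> d' <= d ->
     (\int[leb2 R]_(x in rect a' b' c' d') (f x)%:E = 0)%E) ->
  {ae leb2 R, forall x, rect a b c d x -> f x = 0}.
Proof.
move=> fi f0; set Q := rect a b c d.
have mQ : measurable (Q : set (plane R)) by exact: measurable_rect.
(* The whole line is added to the intervals so that half planes, the preimages
   under the two projections, are products of members of the system. *)
pose C : set (set R) := [set A : set R | A = setT \/ exists x y : R, A = `]x, y[%classic].
have CI : setI_closed C.
  move=> A B [->|[x [y ->]]]; first by rewrite setTI.
  move=> [->|[x' [y' ->]]]; first by rewrite setIT; right; exists x, y.
  right; exists (Num.max x x'), (Num.min y y').
  by apply/seteqP; split => z /=; rewrite !in_itv/= ?gt_max ?lt_min;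
    [move=> [/andP[-> ->] /andP[-> ->]]|move=> /andP[/andP[-> ->] /andP[-> ->]]].
have CE : (@measurable _ (measurableTypeR R)) = <<s C >>.
  rewrite (RGenOpens.measurableE R); apply/seteqP; split.
    apply: sub_sigma_algebra2 => A [x [y ->]]; right; by exists x, y.
  apply: smallest_sub; first exact: smallest_sigma_algebra.
  move=> A [->|[x [y ->]]].
    by rewrite -(RGenOpens.measurableE R); exact: measurableT.
  by apply: sub_sigma_algebra; exists x, y.
pose G : set (set (plane R)) := [set A `*` B | A in C & B in C].
have GE : (@measurable _ (plane R)) = <<s G >>.
  have m1 : measurable_fun (setT : set (g_sigma_algebraType G))
      (fst : plane R -> measurableTypeR R).
    apply: (measurability C CE) => _ [A CA <-]; rewrite setTI.
    apply: sub_sigma_algebra; exists A => //; exists setT; first by left.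
    by apply/seteqP; split => [x []|x] //=.
  have m2 : measurable_fun (setT : set (g_sigma_algebraType G))
      (snd : plane R -> measurableTypeR R).
    apply: (measurability C CE) => _ [A CA <-]; rewrite setTI.
    apply: sub_sigma_algebra; exists setT; first by left.
    by exists A => //; apply/seteqP; split => [x []|x] //=.
  rewrite measurable_prod_measurableType; apply/seteqP; split.
    apply: smallest_sub; first exact: smallest_sigma_algebra.
    move=> _ [A mA [B mB <-]].
    have -> : A `*` B = (setT `&` fst @^-1` A) `&` (setT `&` snd @^-1` B).
      by rewrite !setTI.
    by apply: (@measurableI _ (g_sigma_algebraType G)); [apply: m1|apply: m2].
  apply: sub_sigma_algebra2 => _ [A CA [B CB <-]]; exists A.
    by rewrite CE; exact: sub_sigma_algebra.
  by exists B => //; rewrite CE; exact: sub_sigma_algebra.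
have GI : setI_closed G.
  move=> _ _ [A CA [B CB <-]] [A' CA' [B' CB' <-]]; rewrite -setXI.
  by exists (A `&` A'); [exact: CI|exists (B `&` B') => //; exact: CI].
pose P (A : set (plane R)) := (\int[leb2 R]_(x in A `&` Q) (f x)%:E = 0)%E.
have fiI A : measurable (A : set (plane R)) ->
    (leb2 R).-integrable (A `&` Q) (EFin \o f).
  move=> mA; apply: integrableS fi => //; first exact: measurableI.
have PQ : P setT by rewrite /P setTI; exact: f0.
have PA (S : set (plane R)) : measurable S -> P S.
  rewrite {1}GE; apply: (dynkin_induction GE GI) => //.
  - move=> _ [A CA [B CB <-]]; rewrite /P /Q /rect -setXI.
    have [a' [b' [aa' bb' ->]]] : exists a' b', [/\ a <= a', b' <= b &
        A `&` `]a, b[%classic = `]a', b'[%classic].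
      case: CA => [->|[x [y ->]]]; first by exists a, b; rewrite setTI.
      exists (Num.max x a), (Num.min y b); split.
      + by rewrite le_max lexx orbT.
      + by rewrite ge_min lexx orbT.
      + by apply/seteqP; split => z /=; rewrite !in_itv/= ?gt_max ?lt_min;
          [move=> [/andP[-> ->] /andP[-> ->]]|move=> /andP[/andP[-> ->] /andP[-> ->]]].
    have [c' [d' [cc' dd' ->]]] : exists c' d', [/\ c <= c', d' <= d &
        B `&` `]c, d[%classic = `]c', d'[%classic].
      case: CB => [->|[x [y ->]]]; first by exists c, d; rewrite setTI.
      exists (Num.max x c), (Num.min y d); split.
      + by rewrite le_max lexx orbT.
      + by rewrite ge_min lexx orbT.
      + by apply/seteqP; split => z /=; rewrite !in_itv/= ?gt_max ?lt_min;
          [move=> [/andP[-> ->] /andP[-> ->]]|move=> /andP[/andP[-> ->] /andP[-> ->]]].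
    exact: f0.
  - move=> A mA PA; rewrite /P.
    have mCA : measurable (~` A) by exact: measurableC.
    have := PQ; rewrite /P setTI -{1}(setTI Q) -(setUv A) setIUl.
    rewrite integral_setU //.
    + by rewrite PA add0e.
    + exact: measurableI.
    + exact: measurableI.
    + rewrite -setIUl setUv setTI; exact: measurable_int fi.
    + apply/disj_setPS => x [[Ax _] [nAx _]]; exact: nAx.
  - move=> F mF tF PF; rewrite /P setI_bigcupl integral_bigcup.
    + by apply: eseries0 => n _ _; exact: PF.
    + exact: trivIset_setIr.
    + by move=> n; exact: measurableI.
    + by rewrite -setI_bigcupl; apply: fiI; exact: bigcupT_measurable.
have /= H := @integral_ae_eq _ _ _ (leb2 R) _ mQ (cst 0%E) _ fi (measurable_cst _).
have : ae_eq (leb2 R) Q (EFin \o f) (cst 0%E).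
  by apply: H => E EQ mE; rewrite integral0 -(setIidl EQ); exact: PA.
by apply: filterS => x fx0 /fx0 [].
Qed.

End Plane.

(** * Lebesgue spaces on a measurable set *)

Definition Lnrm (R : realType) (Om : set (R * R)) (p : R) (v : sfield R) : R :=
  fine (Lp_enorm Om p v).

Section Lp.
Variables (R : realType) (Om : set (R * R)).
Hypothesis mO : measurable (Om : set (plane R)).
Implicit Types (v w : sfield R) (p q r : R).
Local Notation mu := (leb2 R).
Local Notation mf v := (measurable_fun (Om : set (plane R)) v).

Lemma Lp_enorm_ge0 p v : (0 <= Lp_enorm Om p v)%E.
Proof. exact: Lnorm_ge0. Qed.

Lemma Lnrm_ge0 p v : 0 <= Lnrm Om p v.
Proof. by apply: fine_ge0; exact: Lp_enorm_ge0. Qed.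

Lemma LpP p v : Lp Om p v <-> mf v /\ (Lp_enorm Om p v < +oo)%E.
Proof.
rewrite /Lp /=; split.
  rewrite inE => /andP[/[!inE]/= m f]; split => //.
  exact: (measurable_restrictT v mO).2 m.
move=> [m f]; rewrite inE; apply/andP; split; rewrite inE//=.
by apply: (measurable_restrictT _ mO).1.
Qed.

Lemma Lp_mf p v : Lp Om p v -> mf v.
Proof. by move/LpP => []. Qed.

Lemma LnrmE p v : Lp Om p v -> Lp_enorm Om p v = (Lnrm Om p v)%:E.
Proof.
move/LpP => [_ f]; rewrite /Lnrm fineK// ge0_fin_numE//; exact: Lp_enorm_ge0.
Qed.

Lemma Lp_enorm_int p v : p != 0 ->
  (Lp_enorm Om p v `^ p = \int[mu]_(x in Om) ((`|v x| `^ p)%:E))%E.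
Proof.
move=> p0; rewrite /Lp_enorm poweR_Lnorm// [RHS]integral_mkcond.
apply: eq_integral => x _ /=.
by rewrite /restrict/patch; case: ifPn => //= _; rewrite normr0 powR0.
Qed.

Lemma Lp_enormE p v : p != 0 ->
  (Lp_enorm Om p v = (\int[mu]_(x in Om) ((`|v x| `^ p)%:E)) `^ p^-1)%E.
Proof.
move=> p0; rewrite -Lp_enorm_int// -poweRrM mulfV// poweRe1//.
exact: Lp_enorm_ge0.
Qed.

Lemma mf_powR v p : mf v -> mf (fun x => `|v x| `^ p).
Proof.
move=> mv; apply: (measurableT_comp (measurable_powR p)) => //.
exact: measurableT_comp.
Qed.

Lemma le_Lp_enorm p v w : 0 < p -> mf v -> mf w ->
  {ae mu, forall x, Om x -> `|v x| <= `|w x|} ->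
  (Lp_enorm Om p v <= Lp_enorm Om p w)%E.
Proof.
move=> p0 mv mw vw; have pn0 : p != 0 by rewrite gt_eqF.
rewrite !Lp_enormE//; apply: gt0_ler_poweR.
- by rewrite invr_ge0 ltW.
- by rewrite in_itv/= leey andbT; apply: integral_ge0 => x _; rewrite lee_fin powR_ge0.
- by rewrite in_itv/= leey andbT; apply: integral_ge0 => x _; rewrite lee_fin powR_ge0.
- apply: ae_ge0_le_integral => //.
  + by apply/measurable_EFinP; exact: mf_powR.
  + by apply/measurable_EFinP; exact: mf_powR.
  + move: vw; apply: filterS => x vw Ox; rewrite lee_fin.
    by apply: ge0_ler_powR; rewrite ?nnegrE//; [exact: ltW|exact: vw].
Qed.

Lemma le_Lp p v w : 0 < p -> mf v -> Lp Om p w ->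
  {ae mu, forall x, Om x -> `|v x| <= `|w x|} ->
  Lp Om p v /\ Lnrm Om p v <= Lnrm Om p w.
Proof.
move=> p0 mv Lw vw; have /LpP[mw wfin] := Lw.
have le := le_Lp_enorm p0 mv mw vw.
have Lv : Lp Om p v by apply/LpP; split => //; exact: le_lt_trans wfin.
by split => //; rewrite -lee_fin -!LnrmE.
Qed.

Lemma ae_eq_Lp p v w : 0 < p -> mf w -> Lp Om p v ->
  {ae mu, forall x, Om x -> v x = w x} -> Lp Om p w /\ Lnrm Om p w = Lnrm Om p v.
Proof.
move=> p0 mw Lv vw.
have [|Lw le1] := le_Lp p0 mw Lv.
  by move: vw; apply: filterS => x vw /vw ->.
split => //; apply/eqP; rewrite eq_le le1/=.
have [|//] := le_Lp p0 (Lp_mf Lv) Lw.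
by move: vw; apply: filterS => x vw /vw ->.
Qed.

Lemma LpD p v w : 1 <= p -> Lp Om p v -> Lp Om p w ->
  Lp Om p (v \+ w) /\ Lnrm Om p (v \+ w) <= Lnrm Om p v + Lnrm Om p w.
Proof.
move=> p1 Lv Lw.
have mv := Lp_mf Lv; have mw := Lp_mf Lw.
have le : (Lp_enorm Om p (v \+ w)%R <= Lp_enorm Om p v + Lp_enorm Om p w)%E.
  rewrite /Lp_enorm (_ : (v \+ w) \_ Om = (v \_ Om \+ w \_ Om)).
    by apply: minkowski => //; apply: (measurable_restrictT _ mO).1.
  by apply/funext => x /=; rewrite /patch; case: ifPn => //; rewrite addr0.
have Lvw : Lp Om p (v \+ w).
  apply/LpP; split; first exact: measurable_funD.
  by apply: le_lt_trans le _; rewrite !LnrmE// ltey.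
by split => //; rewrite -lee_fin -LnrmE// EFinD -!LnrmE.
Qed.

Lemma LpZ p a v : 0 < p -> Lp Om p v ->
  Lp Om p (fun x => a * v x) /\ Lnrm Om p (fun x => a * v x) = `|a| * Lnrm Om p v.
Proof.
move=> p0 Lv; have pn0 : p != 0 by rewrite gt_eqF.
have mv := Lp_mf Lv; have /LpP[_ vfin] := Lv.
have E : Lp_enorm Om p (fun x => a * v x) = (`|a|%:E * Lp_enorm Om p v)%E.
  rewrite !Lp_enormE//.
  under eq_integral do rewrite normrM powRM//= EFinM.
  rewrite ge0_integralZl//; last by apply/measurable_EFinP; exact: mf_powR.
  rewrite poweRM ?lee_fin ?powR_ge0//; last first.
    by apply: integral_ge0 => x _; rewrite lee_fin powR_ge0.
  by rewrite poweR_EFin -powRrM mulfV// powRr1.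
have La : Lp Om p (fun x => a * v x).
  apply/LpP; split; first exact: measurable_funM.
  by rewrite E LnrmE// ltey.
by split => //; apply: EFin_inj; rewrite EFinM -!LnrmE.
Qed.

Lemma LpN p v : 0 < p -> Lp Om p v ->
  Lp Om p (fun x => - v x) /\ Lnrm Om p (fun x => - v x) = Lnrm Om p v.
Proof.
move=> p0 /(LpZ (-1) p0); rewrite normrN1 mul1r.
by under eq_fun do rewrite mulN1r.
Qed.

Lemma LpB p v w : 1 <= p -> Lp Om p v -> Lp Om p w ->
  Lp Om p (v \- w) /\ Lnrm Om p (v \- w) <= Lnrm Om p v + Lnrm Om p w.
Proof.
move=> p1 Lv /(LpN (lt_le_trans ltr01 p1))[Lw nw].
by have := LpD p1 Lv Lw; rewrite nw.
Qed.

Lemma Lp0 p : 0 < p -> Lp Om p (fun=> 0).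
Proof.
move=> p0; apply/LpP; split => //.
by rewrite Lp_enormE ?gt_eqF// (eq_integral (cst 0%E)) ?integral0 ?poweR0r ?invr_neq0 ?gt_eqF// => x _;
  rewrite normr0 powR0// gt_eqF.
Qed.

Lemma Lp_sum p (I : Type) (s : seq I) (F : I -> sfield R) : 1 <= p ->
  (forall i, Lp Om p (F i)) -> Lp Om p (fun x => \sum_(i <- s) F i x).
Proof.
move=> p1 LF; elim: s => [|i s IH].
  by under eq_fun do rewrite big_nil; apply: Lp0; exact: lt_le_trans p1.
by under eq_fun do rewrite big_cons; have [] := LpD p1 (LF i) IH.
Qed.

Lemma Lnrm_eq0 p v : 0 < p -> Lp Om p v -> Lnrm Om p v = 0 ->
  {ae mu, forall x, Om x -> v x = 0}.
Proof.
move=> p0 Lv v0; have mv := Lp_mf Lv; have pn0 : p != 0 by rewrite gt_eqF.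
have := Lp_enorm_int v pn0; rewrite LnrmE// v0 poweR0r//.
move=> /esym v0'.
have mvp : measurable_fun (Om : set (plane R)) (fun x => (`|v x| `^ p)%:E).
  by apply/measurable_EFinP; exact: mf_powR.
have : (\int[mu]_(x in Om) `|(`|v x| `^ p)%:E| = 0)%E.
  by rewrite -[RHS]v0'; apply: eq_integral => x _; rewrite gee0_abs// lee_fin powR_ge0.
move=> /(ae_eq_integral_abs mu mO mvp).1; apply: filterS => x H /H.
by move=> [] /powR_eq0_eq0 /normr0_eq0.
Qed.

Lemma Lp1_integrable v : Lp Om 1 v <-> mu.-integrable Om (EFin \o v).
Proof.
rewrite LpP; split=> [[mv fin]|/integrableP[mv fin]].
  apply/integrableP; split; first exact/measurable_EFinP.
  move: fin; rewrite Lp_enormE// invr1 poweRe1.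
    by under eq_integral do rewrite powRr1//.
  by apply: integral_ge0 => x _; rewrite lee_fin powR_ge0.
split; first exact/measurable_EFinP.
rewrite Lp_enormE// invr1 poweRe1.
  by under eq_integral do rewrite powRr1//.
by apply: integral_ge0 => x _; rewrite lee_fin powR_ge0.
Qed.

Lemma integ_le_Lnrm v : Lp Om 1 v -> `|integ Om v| <= Lnrm Om 1 v.
Proof.
move=> Lv; have iv := (Lp1_integrable v).1 Lv.
apply: (le_trans (le_normr_Rintegral mO iv)).
rewrite /Lnrm Lp_enormE// invr1 poweRe1.
  by rewrite /Rintegral; under [X in _ <= fine X]eq_integral do rewrite powRr1//.
by apply: integral_ge0 => x _; rewrite lee_fin powR_ge0.
Qed.

(** Reduces to the conjugate exponents p/r and q/r, applied to r-th powers. *)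
Lemma hoelder_Lp p q r v w : 0 < p -> 0 < q -> 0 < r -> p^-1 + q^-1 = r^-1 ->
  Lp Om p v -> Lp Om q w ->
  Lp Om r (fun x => v x * w x) /\
  Lnrm Om r (fun x => v x * w x) <= Lnrm Om p v * Lnrm Om q w.
Proof.
move=> p0 q0 r0 pqr Lv Lw.
have mv := Lp_mf Lv; have mw := Lp_mf Lw.
have [pn0 qn0 rn0] : [/\ p != 0, q != 0 & r != 0] by rewrite !gt_eqF.
pose V := (fun x => `|v x| `^ r) \_ Om; pose W := (fun x => `|w x| `^ r) \_ Om.
have mV : measurable_fun (setT : set (plane R)) V.
  by apply: (measurable_restrictT _ mO).1; exact: mf_powR.
have mW : measurable_fun (setT : set (plane R)) W.
  by apply: (measurable_restrictT _ mO).1; exact: mf_powR.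
have E (u : sfield R) (t : R) : 0 < t -> ('N[mu]_((t / r)%:E)[EFin \o ((fun x => (`|u x| `^ r)%R) \_ Om)]
    = Lp_enorm Om t u `^ r)%E.
  move=> t0; have tr0 : t / r != 0 by rewrite mulf_neq0 ?invr_neq0 ?gt_eqF.
  rewrite Lp_enormE ?gt_eqF// -poweRrM unlock/=.
  rewrite invf_div [r / t]mulrC; congr (_ `^ _)%E; rewrite [RHS]integral_mkcond.
  apply: eq_integral => x _ /=; rewrite /restrict /patch; case: ifPn => _.
    by rewrite ger0_norm ?powR_ge0// -powRrM mulrCA mulfV ?mulr1.
  by rewrite normr0 powR0.
have /= := @hoelder _ _ _ mu V W (p / r) (q / r) mV mW (divr_gt0 p0 r0) (divr_gt0 q0 r0).
rewrite !invf_div -mulrDr pqr mulfV// => /(_ erefl).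
rewrite !E// Lnorm1.
have -> : (\int[mu]_x `|(EFin \o (V \* W)%R) x| =
    Lp_enorm Om r (fun x => v x * w x)%R `^ r)%E.
  rewrite Lp_enorm_int// [RHS]integral_mkcond; apply: eq_integral => x _ /=.
  rewrite /V /W /restrict /patch; case: ifPn => _; last by rewrite mulr0 normr0.
  by rewrite ger0_norm ?mulr_ge0 ?powR_ge0// normrM powRM.
rewrite (LnrmE Lv) (LnrmE Lw) !poweR_EFin -EFinM -powRM ?Lnrm_ge0// => H.
have mvw : mf (fun x => v x * w x) by exact: measurable_funM.
have Lvw : Lp Om r (fun x => v x * w x).
  by apply/LpP; split => //; apply: (@lty_poweRy _ _ r) => //; rewrite (le_lt_trans H)// ltey.
split => //; move: H; rewrite LnrmE// poweR_EFin lee_fin.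
move=> /(@ge0_ler_powR _ r^-1); rewrite -!powRrM mulfV// !powRr1 ?mulr_ge0 ?Lnrm_ge0//.
by apply; rewrite ?nnegrE ?powR_ge0// invr_ge0 ltW.
Qed.

Lemma cauchy_schwarz_Lp v w : Lp Om 2 v -> Lp Om 2 w ->
  Lp Om 1 (fun x => v x * w x) /\
  Lnrm Om 1 (fun x => v x * w x) <= Lnrm Om 2 v * Lnrm Om 2 w.
Proof. by apply: hoelder_Lp => //; lra. Qed.

Lemma Lnrm2_sqr v : Lp Om 2 v -> Lnrm Om 2 v ^+ 2 = integ Om (fun x => v x ^+ 2).
Proof.
move=> Lv; apply: EFin_inj; rewrite EFin_expe -LnrmE//.
have -> : (Lp_enorm Om 2 v ^+ 2 = Lp_enorm Om 2 v `^ 2)%E.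
  by rewrite LnrmE// poweR_EFin powR_mulrn ?Lnrm_ge0.
rewrite Lp_enorm_int// /integ /Rintegral.
have -> : (\int[mu]_(x in Om) (`|v x| `^ 2)%:E = \int[mu]_(x in Om) (v x ^+ 2)%:E)%E.
  by apply: eq_integral => x _; rewrite powR_mulrn// real_normK// num_real.
rewrite fineK//.
have [] := cauchy_schwarz_Lp Lv Lv => /Lp1_integrable/(integrable_fin_num mO) + _.
by congr (_ \is a fin_num); apply: eq_integral => x _ /=; rewrite expr2.
Qed.

Lemma Lp_cst p a : (mu Om < +oo)%E -> 0 < p -> Lp Om p (cst a).
Proof.
move=> fO p0; apply/LpP; split => //.
rewrite Lp_enormE ?gt_eqF//; apply: poweR_lty.
have -> : (\int[mu]_(x in Om) (`|cst a x| `^ p)%:E = (`|a| `^ p)%:E * mu Om)%E.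
  rewrite -(integral_cst mu mO (`|a| `^ p)%:E).
  by apply: eq_integral.
by rewrite lte_mul_pinfty ?lee_fin ?powR_ge0.
Qed.

Lemma integD v w : Lp Om 1 v -> Lp Om 1 w ->
  integ Om (fun x => v x + w x) = integ Om v + integ Om w.
Proof. by move=> /Lp1_integrable iv /Lp1_integrable iw; rewrite /integ RintegralD. Qed.

Lemma integB v w : Lp Om 1 v -> Lp Om 1 w ->
  integ Om (fun x => v x - w x) = integ Om v - integ Om w.
Proof. by move=> /Lp1_integrable iv /Lp1_integrable iw; rewrite /integ RintegralB. Qed.

Lemma integZ a v : Lp Om 1 v -> integ Om (fun x => a * v x) = a * integ Om v.
Proof. by move=> /Lp1_integrable iv; rewrite /integ RintegralZl. Qed.

Lemma integ_sum (I : Type) (s : seq I) (F : I -> sfield R) :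
  (forall i, Lp Om 1 (F i)) ->
  integ Om (fun x => \sum_(i <- s) F i x) = \sum_(i <- s) integ Om (F i).
Proof.
move=> LF; elim: s => [|i s IH].
  rewrite big_nil (_ : (fun _ => _) = cst 0) /integ ?Rintegral_cst ?mul0r//.
  by apply/funext => x; rewrite big_nil.
rewrite big_cons -IH -integD//; last exact: Lp_sum.
by congr integ; apply/funext => x; rewrite big_cons.
Qed.

Lemma ae_eq_integ v w : mf v -> mf w ->
  {ae mu, forall x, Om x -> v x = w x} -> integ Om v = integ Om w.
Proof.
move=> mv mw vw; congr fine; apply: ae_eq_integral => //.
- exact/measurable_EFinP.
- exact/measurable_EFinP.
- by move: vw; apply: filterS => x H /H ->.
Qed.

Lemma le_integ v w : Lp Om 1 v -> Lp Om 1 w -> (forall x, Om x -> v x <= w x) ->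
  integ Om v <= integ Om w.
Proof.
by move=> /Lp1_integrable iv /Lp1_integrable iw vw; apply: le_Rintegral.
Qed.

End Lp.

(** * Smooth functions and bumps *)

Section Cn.
Context {R : realType} {V : normedModType R} {I : Type} (e : I -> V).
Implicit Types (f g : V -> R) (n : nat).

(** Derivatives enter as witnesses and not as a function of f: a proof of
   regularity may then use whatever formula it has for the derivative. The family
   of directions e covers the line (one direction) and the plane (two). *)
Fixpoint Cn n f : Prop :=
  match n with
  | 0 => continuous f
  | n'.+1 => continuous f /\
      forall i, exists2 f' : V -> R, (forall x, is_derive x (e i) f (f' x)) & Cn n' f'
  end.

Lemma CnW n f : Cn n.+1 f -> Cn n f.
Proof.
elim: n f => [|n IH] f [cf df] //; split => // i.
by have [f' ? Cf'] := df i; exists f' => //; exact: IH.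
Qed.

Lemma Cn_cst n a : Cn n (cst a).
Proof.
elim: n a => [|n IH] a /=; first by move=> x; exact: cvg_cst.
split; first by move=> x; exact: cvg_cst.
by move=> i; exists (cst 0); [move=> x; exact: is_derive_cst|exact: IH].
Qed.

Lemma CnD n f g : Cn n f -> Cn n g -> Cn n (f \+ g).
Proof.
elim: n f g => [|n IH] f g; first by move=> cf cg x; apply: cvgD; [exact: cf|exact: cg].
move=> [cf df] [cg dg]; split; first by move=> x; apply: cvgD; [exact: cf|exact: cg].
move=> i; have [f' df' Cf'] := df i; have [g' dg' Cg'] := dg i.
by exists (f' \+ g'); [move=> x; exact: is_deriveD|exact: IH].
Qed.

Lemma CnM n f g : Cn n f -> Cn n g -> Cn n (f \* g).
Proof.
elim: n f g => [|n IH] f g; first by move=> cf cg x; apply: cvgM; [exact: cf|exact: cg].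
move=> Cf Cg; have [cf df] := Cf; have [cg dg] := Cg.
split; first by move=> x; apply: cvgM; [exact: cf|exact: cg].
move=> i; have [f' df' Cf'] := df i; have [g' dg' Cg'] := dg i.
exists ((f \* g') \+ (g \* f')); first by move=> x; exact: is_deriveM.
by apply: CnD; apply: IH => //; exact: CnW.
Qed.

Lemma CnZ n a f : Cn n f -> Cn n (fun x => a * f x).
Proof. by move=> Cf; apply: (CnM (Cn_cst n a)). Qed.

End Cn.

Section Cn_plane.
Variable R : realType.
Implicit Types (f g : R * R -> R) (h : R -> R).

(** Smoothness in terms of iterated partial derivatives is awkward to prove for
   products and compositions, where the induction needs the order n as a bound. *)
Lemma smooth_Cn f : smooth f <-> forall n, Cn (@basis2 R) n f.
Proof.
split=> [sf n|Cf js].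
- elim: n f sf => [|n IH] f sf; first exact: (sf [::]).1.
  split => [|j]; first exact: (sf [::]).1.
  exists ('D_(basis2 R j) f); first by move=> x; apply: derivableP; exact: (sf [::]).2.
  apply: IH => js; have := sf (rcons js j).
  by rewrite /iter_partial foldr_rcons.
- have : Cn (@basis2 R) (size js).+1 f by [].
  elim/last_ind: js f {Cf} => [|js j IH] f.
    move=> [cf df]; split => // j x; have [f' df' _] := df j.
    exact: ex_derive.
  rewrite size_rcons => -[cf df]; have [f' df' Cf'] := df j.
  rewrite /iter_partial foldr_rcons -/(iter_partial _ _).
  have -> : 'D_(basis2 R j) f = f'.
    by apply/funext => x; exact: derive_val.
  exact: IH.
Qed.

Lemma smooth_continuous f : smooth f -> continuous f.
Proof. by move=> /(_ [::]) []. Qed.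

Lemma smooth_derivable f j x : smooth f -> derivable f x (basis2 R j).
Proof. by move=> /(_ [::]) []. Qed.

Lemma smooth_partial f j : smooth f -> smooth ('D_(basis2 R j) f).
Proof. by move=> sf js; have := sf (rcons js j); rewrite /iter_partial foldr_rcons. Qed.

Lemma smoothM f g : smooth f -> smooth g -> smooth (f \* g).
Proof.
by move=> /smooth_Cn Cf /smooth_Cn Cg; apply/smooth_Cn => n; exact: CnM.
Qed.

Lemma smoothD f g : smooth f -> smooth g -> smooth (f \+ g).
Proof.
by move=> /smooth_Cn Cf /smooth_Cn Cg; apply/smooth_Cn => n; exact: CnD.
Qed.

Lemma smoothZ a f : smooth f -> smooth (fun x => a * f x).
Proof. by move=> /smooth_Cn Cf; apply/smooth_Cn => n; exact: CnZ. Qed.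

Local Notation Cn1 := (Cn (fun _ : unit => (1 : R))).

Definition smooth1 h := forall n, Cn1 n h.

Lemma is_derive_fst h (d : R) (x : R * R) j : is_derive x.1 1 h d ->
  is_derive x (basis2 R j) (fun y => h y.1) (if j == 0 then d else 0).
Proof.
rewrite /basis2; case: ifPn => _ [dh hd].
  have E : (fun t : R => t^-1 *: (((fun y : R * R => h y.1) \o shift x) (t *: (1, 0)) - h x.1)) =
    (fun t : R => t^-1 *: ((h \o shift x.1) (t *: 1) - h x.1)) by [].
  by split; [rewrite /derivable E|rewrite /derive E].
have E : (fun t : R => t^-1 *: (((fun y : R * R => h y.1) \o shift x) (t *: (0, 1)) - h x.1)) =
    cst (0 : R).
  by apply/funext => t /=; rewrite scaler0 add0r subrr scaler0.
by split; [rewrite /derivable E; exact: is_cvg_cst|rewrite /derive E; exact: lim_cst].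
Qed.

Lemma is_derive_snd h (d : R) (x : R * R) j : is_derive x.2 1 h d ->
  is_derive x (basis2 R j) (fun y => h y.2) (if j == 0 then 0 else d).
Proof.
rewrite /basis2; case: ifPn => _ [dh hd]; last first.
  have E : (fun t : R => t^-1 *: (((fun y : R * R => h y.2) \o shift x) (t *: (0, 1)) - h x.2)) =
    (fun t : R => t^-1 *: ((h \o shift x.2) (t *: 1) - h x.2)) by [].
  by split; [rewrite /derivable E|rewrite /derive E].
have E : (fun t : R => t^-1 *: (((fun y : R * R => h y.2) \o shift x) (t *: (1, 0)) - h x.2)) =
    cst (0 : R).
  by apply/funext => t /=; rewrite scaler0 add0r subrr scaler0.
by split; [rewrite /derivable E; exact: is_cvg_cst|rewrite /derive E; exact: lim_cst].
Qed.

Lemma Cn_fst n h : Cn1 n h -> Cn (@basis2 R) n (fun x => h x.1).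
Proof.
elim: n h => [|n IH] h.
  by move=> ch x; apply: (@continuous_comp _ _ _ fst h); [exact: cvg_fst|exact: ch].
move=> Ch; have [ch dh] := Ch; split.
  by move=> x; apply: (@continuous_comp _ _ _ fst h); [exact: cvg_fst|exact: ch].
move=> j; have [h' dh' Ch'] := dh tt.
exists (fun x => if j == 0 then h' x.1 else 0); first by move=> x; exact: is_derive_fst.
by case: (j == 0); [exact: IH|exact: Cn_cst].
Qed.

Lemma Cn_snd n h : Cn1 n h -> Cn (@basis2 R) n (fun x => h x.2).
Proof.
elim: n h => [|n IH] h.
  by move=> ch x; apply: (@continuous_comp _ _ _ snd h); [exact: cvg_snd|exact: ch].
move=> Ch; have [ch dh] := Ch; split.
  by move=> x; apply: (@continuous_comp _ _ _ snd h); [exact: cvg_snd|exact: ch].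
move=> j; have [h' dh' Ch'] := dh tt.
exists (fun x => if j == 0 then 0 else h' x.2); first by move=> x; exact: is_derive_snd.
by case: (j == 0); [exact: Cn_cst|exact: IH].
Qed.

Lemma smooth_tensor h k : smooth1 h -> smooth1 k -> smooth (fun x => h x.1 * k x.2).
Proof.
move=> Ch Ck; apply/smooth_Cn => n.
by apply: (CnM (f := fun x => h x.1) (g := fun x => k x.2)); [exact: Cn_fst|exact: Cn_snd].
Qed.

Lemma smooth1_affine h c d : smooth1 h -> smooth1 (fun x => h (c * x + d)).
Proof.
move=> Ch n; move: {Ch} (Ch n); elim: n h => [|n IH] h.
  move=> ch x; apply: (@continuous_comp _ _ _ (fun x => c * x + d) h); last exact: ch.
  by apply: cvgD; [apply: cvgM; [exact: cvg_cst|exact: cvg_id]|exact: cvg_cst].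
move=> [ch dh]; have [h' dh' Ch'] := dh tt; split.
  move=> x; apply: (@continuous_comp _ _ _ (fun x => c * x + d) h); last exact: ch.
  by apply: cvgD; [apply: cvgM; [exact: cvg_cst|exact: cvg_id]|exact: cvg_cst].
move=> _; exists (fun x => c * h' (c * x + d)); last by apply: CnZ; exact: IH.
move=> x; rewrite mulrC; apply: (is_derive1_comp (f := h) (g := fun x => c * x + d)) => //.
have := is_deriveD (is_deriveZ c (is_derive_id x 1)) (is_derive_cst d x 1).
by rewrite addr0 /GRing.scale/= mulr1.
Qed.

Lemma smooth1M h k : smooth1 h -> smooth1 k -> smooth1 (h \* k).
Proof. by move=> Ch Ck n; exact: CnM. Qed.

Lemma smooth1B h k : smooth1 h -> smooth1 k -> smooth1 (h \- k).
Proof.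
move=> Ch Ck n; have := CnD (Ch n) (CnZ (-1) (Ck n)).
by congr Cn; apply/funext => x /=; rewrite mulN1r.
Qed.

Lemma smooth1Z a h : smooth1 h -> smooth1 (fun x => a * h x).
Proof. by move=> Ch n; exact: CnZ. Qed.

Lemma smooth1_primitive (h H : R -> R) : smooth1 h -> (forall x : R, is_derive x 1 H (h x)) -> smooth1 H.
Proof.
move=> Ch dH [|n]; last split; last by move=> _; exists h.
  by move=> x; apply/differentiable_continuous/derivable1_diffP; exact: ex_derive.
by move=> x; apply/differentiable_continuous/derivable1_diffP; exact: ex_derive.
Qed.

End Cn_plane.

Section Bump.
Variable R : realType.
Implicit Types (x a b : R) (n k : nat).

(** The functions x^-n exp(-1/x), extended by zero, form a family whose
   derivatives are combinations of its members. Smoothness of exp(-1/x) follows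
   from the continuity of all of them, including at the origin. *)
Definition flat n x : R := if 0 < x then x ^- n * expR (- x^-1) else 0.

(** One term of the exponential series at 1/x, the one of order n + 1, already
   beats the power x^-n by a factor of x. *)
Lemma flat_le n x : `|flat n x| <= (n.+1)`!%:R * `|x|.
Proof.
rewrite /flat; case: ifPn => [x0|_]; last by rewrite normr0 mulr_ge0.
have y0 : 0 < x^-1 by rewrite invr_gt0.
rewrite -exprVn expRN !ger0_norm ?divr_ge0 ?exprn_ge0 ?expR_ge0 ?(ltW x0) ?(ltW y0)//.
have F0 : (0 : R) < (n.+1)`!%:R by rewrite ltr0n fact_gt0.
(* With y = 1/x the claim reads y^n <= (n+1)! exp(y) / y. *)
have := expR_ge1Dxn n (ltW y0).
rewrite ler_pdivrMr ?expR_gt0//.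
set y := x^-1; have -> : x = y^-1 by rewrite invrK.
move=> H; have {}H : y ^+ n.+1 / (n.+1)`!%:R <= expR y by apply: le_trans H; rewrite lerDr.
rewrite ler_pdivrMr// in H.
rewrite -ler_pdivrMl ?mulr_gt0 ?invr_gt0//.
rewrite invfM invrK; apply: le_trans (_ : (n.+1)`!%:R^-1 * (y ^+ n.+1) <= _).
  by rewrite exprS mulrA.
by rewrite ler_pdivrMl// mulrC.
Qed.

(** At the origin the difference quotient of a member of the family is the next
   member, which tends to zero by [flat_le]. *)
Lemma is_derive_flat n x :
  is_derive x 1 (flat n) (- n%:R * flat n.+1 x + flat n.+2 x).
Proof.
have [x0|x0|x0] := ltgtP 0 x.
- pose G (z : R) := z ^+ n * expR (- z).
  have dG (z : R) : is_derive z 1 G (z ^+ n * - expR (- z) + expR (- z) * (n%:R * z ^+ n.-1)).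
    have d1 := is_deriveX n (is_derive_id z (1 : R)).
    have d2 : is_derive z 1 (fun z : R => expR (- z)) (- expR (- z)).
      have := is_derive1_comp (is_derive_expR (- z)) (is_deriveNid z 1).
      by rewrite mulrN1.
    have pE t : ((@id R : R -> R) ^+ n) t = t ^+ n.
      by elim: (n) => [|m IH]; rewrite ?expr0 ?exprS -?IH.
    have EG : G = ((@id R : R -> R) ^+ n) * (fun z => expR (- z)).
      by apply/funext => t; rewrite /G -pE.
    rewrite EG; apply: is_derive_eq (is_deriveM d1 d2) _.
    by rewrite pE /GRing.scale/= mulr1.
  have H : is_derive x 1 (G \o (fun y => y^-1)) (- n%:R * flat n.+1 x + flat n.+2 x).
    have dV : is_derive x 1 (fun y : R => y^-1) (- x ^- 2).
      have := is_deriveV (lt0r_neq0 x0) (is_derive_id x 1).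
      by rewrite /GRing.scale/= mulr1.
    apply: is_derive_eq (is_derive1_comp (dG x^-1) dV) _.
    rewrite /flat x0 -!exprVn; set z := x^-1; case: n {G dG} => [|n]/=; first by ring.
    by rewrite !exprS; ring.
  apply: near_eq_is_derive H.
  have : \forall y \near x, 0 < y by exact: lt_nbhsr.
  by apply: filterS => y y0; rewrite /flat y0 /= /G exprVn.
- have -> : - n%:R * flat n.+1 x + flat n.+2 x = 0.
    by rewrite /flat ltNge (ltW x0)/= mulr0 addr0.
  apply: (@near_eq_is_derive _ _ _ (cst 0)).
    have : \forall y \near x, y < 0 by exact: lt_nbhsl.
    by apply: filterS => y y0; rewrite /flat ltNge (ltW y0).
- subst x.
  have -> : - n%:R * flat n.+1 0 + flat n.+2 0 = 0 :> R.
    by rewrite /flat ltxx mulr0 addr0.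
  have E : (fun t : R => t^-1 *: ((flat n \o shift 0) (t *: 1) - flat n 0)) = flat n.+1.
    apply/funext => t /=; rewrite addr0 /flat ltxx subr0 /GRing.scale/= mulr1.
    by case: ifP => _; rewrite ?mulr0// mulrA -!exprVn -exprS.
  have L : flat n.+1 t @[t --> 0^'] --> (0 : R).
    have B : (n.+2)`!%:R * `|t| @[t --> (0 : R)^'] --> (0 : R).
      have : (n.+2)`!%:R * `|t| @[t --> (0 : R)^'] --> (n.+2)`!%:R * `|0 : R|.
        apply: cvgM; first exact: cvg_cst.
        by apply: cvg_norm; apply: cvg_within.
      by rewrite normr0 mulr0.
    have NB := cvgN B; rewrite oppr0 in NB.
    apply: (@squeeze_cvgr _ _ _ _ (fun t => - ((n.+2)`!%:R * `|t|)) (fun t => (n.+2)`!%:R * `|t|)) => //.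
      by near=> t; rewrite -ler_norml; exact: flat_le.
    exact: NB.
  apply: DeriveDef; first by rewrite /derivable E; apply/cvg_ex; exists (0 : R).
  by rewrite /derive E; apply: cvg_lim.
Unshelve. all: by end_near. Qed.

Lemma smooth1_flat n : smooth1 (flat n).
Proof.
have cf m : continuous (flat m).
  move=> x; apply/differentiable_continuous/derivable1_diffP.
  exact: (@ex_derive _ _ _ _ _ _ _ (is_derive_flat m x)).
move=> k; elim: k n => [|k IH] n; first exact: cf.
split; first exact: cf.
move=> _; exists (fun x => - n%:R * flat n.+1 x + flat n.+2 x).
  by move=> x; exact: is_derive_flat.
by apply: (CnD (f := fun x => - n%:R * flat n.+1 x)); [exact: CnZ|exact: IH].
Qed.

Lemma flat_ge0 x : 0 <= flat 0 x.
Proof. by rewrite /flat; case: ifP => // _; rewrite expr0 invr1 mul1r expR_ge0. Qed.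

Lemma flat_le1 x : flat 0 x <= 1.
Proof.
rewrite /flat; case: ifP => // x0; rewrite expr0 invr1 mul1r.
by rewrite -expR0 ler_expR oppr_le0 invr_ge0 ltW.
Qed.

(** As k grows, this smooth function increases to the indicator of the
   interval between a and b, outside which it vanishes. *)
Definition bump k a b x : R := flat 0 (k.+1%:R * (x - a)) * flat 0 (k.+1%:R * (b - x)).

Lemma smooth1_bump k a b : smooth1 (bump k a b).
Proof.
apply: smooth1M.
  have := smooth1_affine k.+1%:R (- (k.+1%:R * a)) (smooth1_flat 0).
  by under eq_fun do rewrite -mulrBr.
have := smooth1_affine (- k.+1%:R) (k.+1%:R * b) (smooth1_flat 0).
by under eq_fun do rewrite mulNr addrC -mulrBr.
Qed.

Lemma bump_ge0 k a b x : 0 <= bump k a b x.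
Proof. by rewrite mulr_ge0 ?flat_ge0. Qed.

Lemma bump_le1 k a b x : bump k a b x <= 1.
Proof. by rewrite -[leRHS]mulr1 ler_pM ?flat_ge0 ?flat_le1. Qed.

Lemma bump_out k a b x : x \notin `]a, b[ -> bump k a b x = 0.
Proof.
rewrite in_itv/= negb_and -!leNgt /bump /flat => /orP[xa|bx].
  by rewrite ifF ?mul0r//; apply/negbTE; rewrite -leNgt pmulr_rle0// subr_le0.
by rewrite [X in _ * X]ifF ?mulr0//; apply/negbTE; rewrite -leNgt pmulr_rle0// subr_le0.
Qed.

Lemma bump_gt0 k a b x : x \in `]a, b[ -> 0 < bump k a b x.
Proof.
rewrite in_itv/= /bump /flat => /andP[ax xb].
by rewrite !pmulr_rgt0 ?subr_gt0 ?ax ?xb ?mulr_gt0 ?invr_gt0 ?expR_gt0// expr0.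
Qed.

Lemma cvg_flat x : 0 < x -> flat 0 (k.+1%:R * x) @[k --> \oo] --> (1 : R).
Proof.
move=> x0.
have -> : (fun k : nat => flat 0 (k.+1%:R * x)) = (fun k => expR (- (k.+1%:R^-1 * x^-1))).
  apply/funext => k; rewrite /flat ifT ?mulr_gt0//.
  by rewrite expr0 invr1 mul1r invfM.
have E0 : expR t @[t --> (0 : R)] --> (1 : R).
  have -> : (1 : R) = expR 0 by rewrite expR0.
  exact: continuous_expR.
apply: (@cvg_comp _ _ _ (fun k : nat => - (k.+1%:R^-1 * x^-1)) expR _ (nbhs (0 : R))); last exact: E0.
have H := cvgN (cvgM (@cvg_harmonic R) (cvg_cst x^-1)).
by rewrite mul0r oppr0 in H; exact: H.
Qed.

Lemma cvg_bump a b x : bump k a b x @[k --> \oo] --> (\1_`]a, b[ x : R).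
Proof.
rewrite indicE; have [|xab] := boolP (x \in `]a, b[%classic).
  rewrite inE/= in_itv/= => /andP[ax xb].
  have ax0 : 0 < x - a by rewrite subr_gt0.
  have xb0 : 0 < b - x by rewrite subr_gt0.
  have H := cvgM (cvg_flat ax0) (cvg_flat xb0).
  by rewrite mulr1 in H; exact: H.
have -> : (fun k => bump k a b x) = cst 0.
  by apply/funext => k; rewrite bump_out//; apply: contra xab => /mem_set.
exact: cvg_cst.
Qed.

End Bump.

(** * Supports and local integrability *)

Section Support.
Variable R : realType.
Implicit Types (U K Om : set (R * R)) (f phi : sfield R).
Local Notation mu := (leb2 R).

Lemma bounded_sub_crect K : bounded_set K ->
  exists2 M : R, 0 < M & K `<=` crect (- M) M (- M) M.
Proof.
move=> [M [_ HM]]; exists (Num.max M 0 + 1).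
  by rewrite ltr_wpDl// le_max lexx orbT.
have MM : M < Num.max M 0 + 1 by rewrite ltr_pwDr// le_max lexx.
move=> x Kx; have : Num.max `|x.1| `|x.2| <= Num.max M 0 + 1 := HM _ MM x Kx.
rewrite ge_max => /andP[x1 x2].
by split; rewrite /= in_itv/= -ler_norml.
Qed.

Lemma crect_measure_lty (a b c d : R) : (mu (crect a b c d) < +oo)%E.
Proof.
rewrite /crect product_measure1E; [|exact: measurable_itv|exact: measurable_itv].
have fin (x y : R) : (@lebesgue_measure R `[x, y]%classic \is a fin_num)%E.
  by rewrite lebesgue_measure_itv/=; case: ifP.
have : (@lebesgue_measure R `[a, b]%classic * @lebesgue_measure R `[c, d]%classic)%E
  \is a fin_num by rewrite fin_numM.
by rewrite ltey_eq => ->.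
Qed.

Lemma bounded_measure_lty K : measurable (K : set (plane R)) -> bounded_set K ->
  (mu K < +oo)%E.
Proof.
move=> mK /bounded_sub_crect[M M0 KM].
apply: le_lt_trans (crect_measure_lty (- M) M (- M) M).
by apply: le_measure => //; rewrite inE//; exact: measurable_crect.
Qed.

Lemma compact_measure_lty K : compact K -> (mu K < +oo)%E.
Proof.
move=> cK; apply: bounded_measure_lty; first exact: measurable_compact_plane.
exact: compact_bounded.
Qed.

Lemma continuous_bounded_compact K f : compact K -> continuous f ->
  exists2 B : R, 0 < B & forall x, K x -> `|f x| <= B.
Proof.
move=> cK cf; have : compact (f @` K).
  by apply: continuous_compact => //; exact: continuous_subspaceT.
move=> /compact_bounded[M [_ HM]]; exists (Num.max M 0 + 1).
  by rewrite ltr_wpDl// le_max lexx orbT.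
have MM : M < Num.max M 0 + 1 by rewrite ltr_pwDr// le_max lexx.
by move=> x Kx; apply: (HM _ MM); exists x.
Qed.

(** On the compact set K the function f is bounded, so the product is dominated
   there by a multiple of v; outside K it vanishes. *)
Lemma loc_integrableM Om K v f : measurable (Om : set (plane R)) ->
  locally_integrable2 Om v -> compact K -> K `<=` Om ->
  continuous f -> (forall x, ~ K x -> f x = 0) ->
  mu.-integrable Om (EFin \o (fun x => v x * f x)).
Proof.
move=> mO lv cK KO cf f0; have mK := measurable_compact_plane cK.
have iv := lv K KO cK; have [B B0 fB] := continuous_bounded_compact cK cf.
have iK : mu.-integrable K (EFin \o (fun x => v x * f x)).
  apply: (@le_integrable _ _ _ mu _ mK _ (EFin \o (fun x => B * v x))).
  - apply/measurable_EFinP; apply: measurable_funM.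
      by apply/measurable_EFinP; exact: measurable_int iv.
    by apply: measurable_funTS; exact: continuous_measurable_plane.
  - move=> x Kx /=; rewrite lee_fin !normrM mulrC ler_wpM2r//.
    by rewrite (gtr0_norm B0); exact: fB.
  - by apply: (eq_integrable mK (fun x => B%:E * (EFin \o v) x)%E) => //; exact: integrableZl.
rewrite (_ : EFin \o _ = (EFin \o (fun x => v x * f x)) \_ K); last first.
  apply/funext => x /=; rewrite /patch; case: ifPn => // /negP xK.
  by rewrite f0 ?mulr0// => Kx; apply: xK; exact: mem_set.
apply: (@integrableS _ _ _ mu setT) => //.
exact: (integrable_mkcond _ mK).1.
Qed.

Lemma continuous_loc_integrable Om f : continuous f -> locally_integrable2 Om f.
Proof.
move=> cf K KO cK; have mK := measurable_compact_plane cK.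
have [B B0 fB] := continuous_bounded_compact cK cf.
apply: measurable_bounded_integrable => //.
- exact: compact_measure_lty.
- by apply: measurable_funTS; exact: continuous_measurable_plane.
- exists B; split; first exact: num_real.
  by move=> M BM x Kx; apply: le_trans (ltW BM); exact: fB.
Qed.

Lemma loc_integrableD Om v w : locally_integrable2 Om v -> locally_integrable2 Om w ->
  locally_integrable2 Om (v \+ w).
Proof.
move=> lv lw K KO cK; have mK := measurable_compact_plane cK.
by have := integrableD mK (lv K KO cK) (lw K KO cK).
Qed.

Lemma loc_integrableZ Om a v : locally_integrable2 Om v ->
  locally_integrable2 Om (fun x => a * v x).
Proof.
move=> lv K KO cK; have mK := measurable_compact_plane cK.
exact: (integrableZl mK a (lv K KO cK)).
Qed.

Definition supp phi : set (R * R) := closure [set x | phi x != 0].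

Lemma supp_out phi x : ~ supp phi x -> phi x = 0.
Proof.
move=> nx; have [//|px] := eqVneq (phi x) 0.
by exfalso; apply: nx; exact: subset_closure.
Qed.

Lemma supp_partial_out phi j x : ~ supp phi x -> 'D_(basis2 R j) phi x = 0.
Proof.
move=> nx; rewrite (@near_eq_derive _ _ _ _ (cst 0)); first by rewrite derive_cst.
have : nbhs x (~` supp phi).
  by apply: open_nbhs_nbhs; split => //; exact/closed_openC/closed_closure.
by apply: filterS => y; exact: supp_out.
Qed.

Lemma supp_sub phi K : closed K -> (forall x, ~ K x -> phi x = 0) -> supp phi `<=` K.
Proof.
move=> cK K0; rewrite [X in _ `<=` X]((closure_id K).1 cK).
apply: closure_subset => x /= px; apply: contrapT => /K0 p0.
by rewrite p0 eqxx in px.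
Qed.

Lemma test_functionP Om phi K : smooth phi -> compact K -> K `<=` Om ->
  (forall x, ~ K x -> phi x = 0) -> test_function Om phi.
Proof.
move=> sp cK KO K0; have sK : supp phi `<=` K.
  by apply: supp_sub => //; exact: compact_closed.
split => //; last exact: subset_trans KO.
apply: (subclosed_compact _ cK sK); exact: closed_closure.
Qed.

Lemma test_smooth Om phi : test_function Om phi -> smooth phi.
Proof. by case. Qed.

Lemma test_partial Om phi j : test_function Om phi ->
  test_function Om ('D_(basis2 R j) phi).
Proof.
move=> [sp cp pO]; apply: (test_functionP _ cp pO); first exact: smooth_partial.
by move=> x; exact: supp_partial_out.
Qed.

Lemma testM Om psi phi : smooth psi -> test_function Om phi ->
  test_function Om (psi \* phi).
Proof.
move=> spsi [sp cp pO]; apply: (test_functionP _ cp pO); first exact: smoothM.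
by move=> x /supp_out p0 /=; rewrite p0 mulr0.
Qed.

Lemma testZ Om a phi : test_function Om phi -> test_function Om (fun x => a * phi x).
Proof.
move=> [sp cp pO]; apply: (test_functionP _ cp pO); first exact: smoothZ.
by move=> x /supp_out ->; rewrite mulr0.
Qed.

Lemma testD Om phi psi : test_function Om phi -> test_function Om psi ->
  test_function Om (phi \+ psi).
Proof.
move=> [sp cp pO] [sq cq qO].
apply: (@test_functionP _ _ (supp phi `|` supp psi)).
- exact: smoothD.
- exact: compactU.
- by move=> x [/pO|/qO].
- by move=> x /not_orP[/supp_out p0 /supp_out q0] /=; rewrite p0 q0 addr0.
Qed.

Lemma integrable_test Om v phi : measurable (Om : set (plane R)) ->
  locally_integrable2 Om v -> test_function Om phi ->
  mu.-integrable Om (EFin \o (fun x => v x * phi x)).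
Proof.
move=> mO lv [sp cp pO]; apply: (loc_integrableM mO lv cp pO).
- exact: smooth_continuous.
- by move=> x; exact: supp_out.
Qed.

End Support.

(** * Weak partial derivatives *)

Section IntByParts.
Variable R : realType.
Implicit Types (U K Om : set (R * R)) (f v w phi psi : sfield R).
Local Notation mu := (leb2 R).
Local Notation leb := (@lebesgue_measure R).

Lemma integral_derive_compact (F f : R -> R) (M : R) : 0 < M ->
  (forall x : R, is_derive x 1 F (f x)) -> continuous f ->
  (forall x, M <= `|x| -> F x = 0) -> (forall x, M <= `|x| -> f x = 0) ->
  (\int[leb]_x (f x)%:E = 0)%E.
Proof.
move=> M0 dF cf F0 f0.
have cF : continuous F.
  by move=> x; apply/differentiable_continuous/derivable1_diffP; exact: ex_derive.
have -> : (\int[leb]_x (f x)%:E = \int[leb]_(x in `[(- M)%R, M]) (f x)%:E)%E.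
  rewrite [RHS]integral_mkcond; apply: eq_integral => x _; rewrite /patch.
  case: ifPn => // /negP xM; rewrite f0// leNgt; apply/negP => xM'; apply: xM.
  by rewrite inE/= in_itv/= -ler_norml ltW.
rewrite (@continuous_FTC2 _ f F).
- by rewrite !F0 ?subee// ?normrN ger0_norm// ltW.
- by rewrite gtrN.
- exact: continuous_subspaceT.
- split.
  + by move=> x _; exact: ex_derive.
  + by apply: cvg_within_filter; exact: cF.
  + by apply: cvg_within_filter; exact: cF.
- by move=> x _; rewrite derive1E; exact: derive_val.
Qed.

Lemma derivable_line1 phi (x y : R) : derivable phi (x, y) (basis2 R 0) ->
  is_derive x 1 (fun t => phi (t, y)) ('D_(basis2 R 0) phi (x, y)).
Proof.
rewrite /derivable /derive /basis2 eqxx => d.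
have E : (fun h : R => h^-1 *: (((fun t => phi (t, y)) \o shift x) (h *: 1) - phi (x, y))) =
   (fun h : R => h^-1 *: ((phi \o shift (x, y)) (h *: (1, 0)) - phi (x, y))).
  apply/funext => h /=.
  have -> : h *: (1, 0) + (x, y) = (h *: 1 + x, h *: 0 + y) :> R * R by [].
  by rewrite scaler0 add0r.
by split; rewrite ?/derivable ?/derive E.
Qed.

Lemma derivable_line2 phi (x y : R) : derivable phi (x, y) (basis2 R 1) ->
  is_derive y 1 (fun t => phi (x, t)) ('D_(basis2 R 1) phi (x, y)).
Proof.
rewrite /derivable /derive /basis2/= => d.
have E : (fun h : R => h^-1 *: (((fun t => phi (x, t)) \o shift y) (h *: 1) - phi (x, y))) =
   (fun h : R => h^-1 *: ((phi \o shift (x, y)) (h *: (0, 1)) - phi (x, y))).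
  apply/funext => h /=.
  have -> : h *: (0, 1) + (x, y) = (h *: 0 + x, h *: 1 + y) :> R * R by [].
  by rewrite scaler0 add0r.
by split; rewrite ?/derivable ?/derive E.
Qed.

Lemma ord2_cases (j : 'I_2) : j = 0 \/ j = 1.
Proof. by case: j => [[|[|//]] p]; [left|right]; exact: val_inj. Qed.

(** Fubini reduces this to the fundamental theorem of calculus on lines. *)
Lemma integral_partial_test j phi : smooth phi -> compact (supp phi) ->
  (\int[mu]_x ('D_(basis2 R j) phi x)%:E = 0)%E.
Proof.
move=> sp cp; pose g := 'D_(basis2 R j) phi.
have [N N0 pN] := bounded_sub_crect (compact_bounded cp).
(* One more than the bound of the support, so that phi vanishes at distance M
   itself and not only beyond. *)
pose M := N + 1; have M0 : 0 < M by rewrite /M; lra.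
have out (x : R * R) : M <= `|x.1| \/ M <= `|x.2| -> ~ supp phi x.
  move=> xM /pN[]; rewrite /= !in_itv/= -!ler_norml => x1 x2.
  by case: xM; rewrite leNgt => /negP; apply; rewrite /M; lra.
have cg : continuous g by exact: smooth_continuous (smooth_partial j sp).
have ig : mu.-integrable setT (EFin \o g).
  have l1 : locally_integrable2 setT (fun _ : R * R => 1 : R).
    by apply: continuous_loc_integrable => x; exact: cvg_cst.
  have := loc_integrableM measurableT l1 cp (@subsetT _ _) cg
    (fun x => @supp_partial_out _ _ _ _).
  by under eq_fun do rewrite /= mul1r.
have [j0|j1] := ord2_cases j.
- rewrite -(integral21_prod_meas1 ig); apply: integral0_eq => y _.
  rewrite /fubini_G/=; apply: (@integral_derive_compact (fun t => phi (t, y)) _ M) => //.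
  + by move=> x; rewrite /g j0; apply: derivable_line1; exact: smooth_derivable.
  + move=> x; apply: (@continuous_comp _ _ _ (fun t => (t, y)) g); last exact: cg.
    exact: (cvg_pair (@cvg_id _ (nbhs x)) (cvg_cst y)).
  + by move=> x xM; apply: supp_out; apply: out; left.
  + by move=> x xM; apply: supp_partial_out; apply: out; left.
- rewrite -(integral12_prod_meas1 ig); apply: integral0_eq => x _.
  rewrite /fubini_F/=; apply: (@integral_derive_compact (fun t => phi (x, t)) _ M) => //.
  + by move=> y; rewrite /g j1; apply: derivable_line2; exact: smooth_derivable.
  + move=> y; apply: (@continuous_comp _ _ _ (fun t => (x, t)) g); last exact: cg.
    exact: (cvg_pair (cvg_cst x) (@cvg_id _ (nbhs y))).
  + by move=> y yM; apply: supp_out; apply: out; right.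
  + by move=> y yM; apply: supp_partial_out; apply: out; right.
Qed.

Lemma integ_partial_test Om j phi : test_function Om phi ->
  integ Om ('D_(basis2 R j) phi) = 0.
Proof.
move=> [sp cp pO]; rewrite /integ /Rintegral integral_mkcond.
transitivity (fine (\int[mu]_x ('D_(basis2 R j) phi x)%:E)); last first.
  by rewrite integral_partial_test.
congr fine; apply: eq_integral => x _; rewrite /patch; case: ifPn => // /negP xO.
by rewrite /= supp_partial_out// => /pO xO'; apply: xO; exact: mem_set.
Qed.

Lemma partialM j phi psi x : smooth phi -> smooth psi ->
  'D_(basis2 R j) (phi \* psi) x =
  phi x * 'D_(basis2 R j) psi x + psi x * 'D_(basis2 R j) phi x.
Proof.
by move=> sp sq; rewrite (deriveM (smooth_derivable sp) (smooth_derivable sq)).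
Qed.

(** Integration by parts: the product of psi with a test function is a test
   function, and the integral of its derivative vanishes. *)
Lemma smooth_is_weak_partial Om j psi : measurable (Om : set (plane R)) ->
  smooth psi -> is_weak_partial Om j psi ('D_(basis2 R j) psi).
Proof.
move=> mO sq; have cq := smooth_continuous sq.
have cdq := smooth_continuous (smooth_partial j sq).
have lq := @continuous_loc_integrable _ Om _ cq.
have ldq := @continuous_loc_integrable _ Om _ cdq.
split => // phi tp; apply/eqP; rewrite -addr_eq0 -RintegralD//; last 2 first.
- exact: integrable_test mO lq (test_partial j tp).
- exact: integrable_test mO ldq tp.
have := integ_partial_test j (testM sq tp).
move=> <-; apply/eqP; apply: eq_Rintegral => x _.
by rewrite partialM//; [congr (_ + _); rewrite mulrC|exact: test_smooth tp].
Qed.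

Lemma weak_partialP Om j v w : is_weak_partial Om j v w ->
  is_weak_partial Om j v (weak_partial Om j v).
Proof. by move=> vw; apply: (@xgetPex _ _ [set w | is_weak_partial Om j v w]); exists w. Qed.

Lemma is_weak_partial_lin Om j a v v' w w' : measurable (Om : set (plane R)) ->
  is_weak_partial Om j v w -> is_weak_partial Om j v' w' ->
  is_weak_partial Om j (fun x => a * v x + v' x) (fun x => a * w x + w' x).
Proof.
move=> mO [lv lw vw] [lv' lw' vw'].
split; try by apply: loc_integrableD => //; exact: loc_integrableZ.
move=> phi tp; have tdp := test_partial j tp.
have I u u' psi : locally_integrable2 Om u -> locally_integrable2 Om u' ->
    test_function Om psi -> integ Om (fun x => (a * u x + u' x) * psi x) =
    a * integ Om (fun x => u x * psi x) + integ Om (fun x => u' x * psi x).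
  move=> lu lu' tpsi; have iu := integrable_test mO lu tpsi.
  rewrite /integ -RintegralZl// -RintegralD//.
  - by apply: eq_Rintegral => x _; rewrite mulrDl mulrA.
  - exact: (integrableZl mO a iu).
  - exact: integrable_test.
by rewrite !I// vw// vw'// mulrN opprD.
Qed.

Lemma test_bump Om k m (a b c d a' b' c' d' : R) : crect a b c d `<=` Om ->
  a <= a' -> b' <= b -> c <= c' -> d' <= d ->
  test_function Om (fun x => bump k a' b' x.1 * bump m c' d' x.2).
Proof.
move=> sO aa bb cc dd; apply: (test_functionP _ (@compact_crect R a b c d) sO).
  by apply: smooth_tensor; exact: smooth1_bump.
move=> x nx; have [x1|x1] := boolP (x.1 \in `]a', b'[); last first.
  by rewrite bump_out ?mul0r.
have [x2|x2] := boolP (x.2 \in `]c', d'[); last first.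
  by rewrite [X in _ * X]bump_out ?mulr0.
exfalso; apply: nx; move: x1 x2; rewrite !in_itv/= => /andP[? ?] /andP[? ?].
by split; rewrite /= in_itv/=; apply/andP; split; lra.
Qed.

(** Products of bumps converge boundedly to indicators of rectangles, so the
   vanishing of their integrals against a function passes to rectangles. *)
Lemma ae_eq0_bump (a b c d : R) f : mu.-integrable (rect a b c d) (EFin \o f) ->
  (forall k a' b' c' d', a <= a' -> b' <= b -> c <= c' -> d' <= d ->
    (\int[mu]_(x in rect a b c d) (f x * (bump k a' b' x.1 * bump k c' d' x.2))%:E = 0)%E) ->
  {ae mu, forall x, rect a b c d x -> f x = 0}.
Proof.
move=> fi f0; apply: ae_eq0_rect => // a' b' c' d' aa bb cc dd.
set Q := rect a b c d in fi f0 *; set Q' := rect a' b' c' d'.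
have mQ : measurable (Q : set (plane R)) by exact: measurable_rect.
have mQ' : measurable (Q' : set (plane R)) by exact: measurable_rect.
have Q'Q : Q' `<=` Q.
  move=> x [] /=; rewrite !in_itv/= => /andP[? ?] /andP[? ?].
  by split; rewrite /= in_itv/=; apply/andP; split; lra.
pose B k x := bump k a' b' x.1 * bump k c' d' x.2 : R.
have B1 k x : `|B k x| <= 1.
  have B0 : 0 <= B k x by rewrite /B mulr_ge0 ?bump_ge0.
  by rewrite ger0_norm// -[leRHS]mulr1 /B ler_pM ?bump_ge0 ?bump_le1.
have mf : measurable_fun (Q : set (plane R)) f.
  by apply/measurable_EFinP; exact: measurable_int fi.
have h1 : forall n, measurable_fun (Q : set (plane R)) (fun x => (f x * B n x)%:E).
  move=> n; apply/measurable_EFinP; apply: measurable_funM => //.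
  apply: measurable_funTS; apply: continuous_measurable_plane.
  by apply: smooth_continuous; apply: smooth_tensor; exact: smooth1_bump.
have h2 : measurable_fun (Q : set (plane R)) (fun x => (f x * \1_Q' x)%:E).
  by apply/measurable_EFinP; apply: measurable_funM.
have h3 : {ae mu, forall x, Q x -> (f x * B k x)%:E @[k --> \oo] --> (f x * \1_Q' x)%:E}.
  apply: aeW => z Qz; apply: cvg_EFin; first exact: nearW.
  have -> : \1_Q' z = \1_`]a', b'[ z.1 * \1_`]c', d'[ z.2 :> R.
    by rewrite !indicE in_setX -natrM mulnb.
  apply: cvgM; first exact: cvg_cst.
  by apply: cvgM; exact: cvg_bump.
have h4 : {ae mu, forall x, forall k, Q x -> (`|(f x * B k x)%:E| <= `|(f x)%:E|)%E}.
  apply: aeW => z n Qz; rewrite !abse_EFin lee_fin normrM -[leRHS]mulr1.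
  by rewrite ler_wpM2l//; exact: B1.
have [_ _ H] := dominated_convergence mQ h1 h2 h3 (integrable_abse fi) h4.
have -> : (\int[mu]_(x in Q') (f x)%:E = \int[mu]_(x in Q) (f x * \1_Q' x)%:E)%E.
  rewrite -{1}(setIidr Q'Q) integral_mkcondr; apply: eq_integral => x _.
  by rewrite /patch indicE; case: ifPn => _; rewrite ?mulr1 ?mulr0.
have H0 : ((fun k => \int[mu]_(x in Q) (f x * B k x)%:E)%E @ \oo --> (0 : \bar R)).
  rewrite (_ : (fun k => _) = cst 0%E); first exact: cvg_cst.
  by apply/funext => k; exact: f0.
exact: (cvg_unique _ H H0).
Qed.

Lemma ae_eq0_bump_loc Om (a b c d : R) f : open Om -> crect a b c d `<=` Om ->
  locally_integrable2 Om f ->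
  (forall k a' b' c' d', a <= a' -> b' <= b -> c <= c' -> d' <= d ->
    integ Om (fun x => f x * (bump k a' b' x.1 * bump k c' d' x.2)) = 0) ->
  {ae mu, forall x, rect a b c d x -> f x = 0}.
Proof.
move=> oO sO lf f0; have mO := measurable_open_plane oO.
have fi : mu.-integrable (rect a b c d) (EFin \o f).
  apply: integrableS (lf _ sO (@compact_crect R a b c d)) => //.
  - exact: measurable_crect.
  - exact: measurable_rect.
  - exact: rect_sub_crect.
apply: ae_eq0_bump => // k a' b' c' d' aa bb cc dd.
have tB := test_bump k k sO aa bb cc dd.
have E := f0 k _ _ _ _ aa bb cc dd.
have := integrable_fin_num mO (integrable_test mO lf tB).
move=> /fineK; rewrite -[fine _]/(integ Om _) E => /esym F; apply: etrans F.
rewrite [LHS]integral_mkcond [RHS]integral_mkcond.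
congr (integral _ _ _); apply/funext => x /=; rewrite /patch; case: ifPn => [xQ|xQ].
  by rewrite ifT//; apply/mem_set/sO/rect_sub_crect; exact: set_mem.
case: ifPn => // _; suff B0 : bump k a' b' x.1 * bump k c' d' x.2 = 0.
  by rewrite /= B0 mulr0.
have [x1|x1] := boolP (x.1 \in `]a', b'[); last by rewrite bump_out ?mul0r.
have [x2|x2] := boolP (x.2 \in `]c', d'[); last by rewrite [X in _ * X]bump_out ?mulr0.
exfalso; move/negP: xQ; apply; apply: mem_set; move: x1 x2.
rewrite !in_itv/= => /andP[? ?] /andP[? ?].
by split; rewrite /= in_itv/=; apply/andP; split; lra.
Qed.

Lemma ae_eq0_test Om f : open Om -> locally_integrable2 Om f ->
  (forall phi, test_function Om phi -> integ Om (fun x => f x * phi x) = 0) ->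
  {ae mu, forall x, Om x -> f x = 0}.
Proof.
move=> oO lf f0; apply: ae_open_rect => // a b c d sO.
apply: (ae_eq0_bump_loc oO sO lf) => k a' b' c' d' aa bb cc dd.
by apply: f0; exact: (test_bump k k sO).
Qed.

Lemma is_weak_partial_unique Om j v w w' : open Om ->
  is_weak_partial Om j v w -> is_weak_partial Om j v w' ->
  {ae mu, forall x, Om x -> w x = w' x}.
Proof.
move=> oO vw vw'; have mO := measurable_open_plane oO.
have [_ l H] := is_weak_partial_lin (-1) mO vw vw'.
have : {ae mu, forall x, Om x -> -1 * w x + w' x = 0}.
  apply: ae_eq0_test => // phi tp; apply: oppr_inj; rewrite -H//.
  rewrite oppr0 (_ : (fun _ => _) = cst 0) /integ ?Rintegral_cst ?mul0r//.
  by apply/funext => x; rewrite mulN1r addNr mul0r.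
by apply: filterS => x + Ox => /(_ Ox); lra.
Qed.

(** Ties the chosen representative to every weak derivative that has a formula,
   such as a classical derivative or a linear combination. *)
Lemma weak_partial_ae Om j v w : open Om -> is_weak_partial Om j v w ->
  {ae mu, forall x, Om x -> weak_partial Om j v x = w x}.
Proof. by move=> oO vw; apply: is_weak_partial_unique (weak_partialP vw) vw. Qed.

End IntByParts.

(** * Functions with vanishing gradient *)

Section ConstantFromGradient.
Variable R : realType.
Implicit Types (U K Om : set (R * R)) (f v w phi psi : sfield R) (h k : R -> R).
Local Notation mu := (leb2 R).
Local Notation leb := (@lebesgue_measure R).

Lemma open_measure_gt0 U x : open U -> U x -> (0 < mu U)%E.
Proof.
move=> oU Ux; have /nbhs_ballP[e /= e0 eU] : nbhs x U by exact: open_nbhs_nbhs.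
have sU : rect (x.1 - e) (x.1 + e) (x.2 - e) (x.2 + e) `<=` U.
  move=> y [] /=; rewrite !in_itv/= => /andP[? ?] /andP[? ?].
  by apply: eU; split => /=; rewrite /ball/= ltr_norml; lra.
apply: (@lt_le_trans _ _ (mu (rect (x.1 - e) (x.1 + e) (x.2 - e) (x.2 + e)))); last first.
  by apply: le_measure; rewrite ?inE//; [exact: measurable_rect|exact: measurable_open_plane].
rewrite /rect product_measure1E; [|exact: measurable_itv|exact: measurable_itv].
have pos (y : R) : (0 < leb `](y - e)%R, (y + e)%R[%classic)%E.
  by rewrite lebesgue_measure_itv/= lte_fin ifT -?EFinB ?lte_fin; lra.
by apply: mule_gt0; exact: pos.
Qed.

Lemma smooth1_integrable h (a b : R) : smooth1 h ->
  (forall x, x \notin `]a, b[ -> h x = 0) -> leb.-integrable setT (EFin \o h).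
Proof.
move=> sh h0; have ch : continuous h := sh 0%N.
have : leb.-integrable `[a, b] (EFin \o h).
  apply: continuous_compact_integrable; first exact: segment_compact.
  exact: continuous_subspaceT.
have mab : measurable (`[a, b]%classic : set (measurableTypeR R)).
  exact: measurable_itv.
move=> ih; have := (integrable_mkcond _ mab).1 ih.
rewrite (_ : (EFin \o h) \_ _ = EFin \o h)//; apply/funext => x; rewrite /patch.
case: ifPn => // xab; rewrite /= h0//; apply: contra xab => xab.
by apply: mem_set; exact: subset_itv_oo_cc.
Qed.

(** The primitive that vanishes to the left of the support also vanishes to its
   right, where it is equal to the integral of h. *)
Lemma smooth1_primitive_compact h (a b : R) : smooth1 h ->
  (forall x, x \notin `]a, b[ -> h x = 0) -> \int[leb]_x h x = 0 ->
  exists H : R -> R, (forall x : R, is_derive x 1 H (h x)) /\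
    forall x, x \notin `]a, b[ -> H x = 0.
Proof.
move=> sh h0 Ih; have ch : continuous h := sh 0%N.
have hi := smooth1_integrable sh h0.
(* Starting at a - 1 makes a an interior point of the interval of integration,
   where the fundamental theorem applies; h vanishes between a - 1 and a. *)
pose H x := \int[leb]_(t in `[a - 1, x]) h t.
have Hle x : x <= a -> H x = 0.
  move=> xa; rewrite /H (_ : \int[_]_(t in _) _ = \int[leb]_(t in `[a - 1, x]) (cst 0) t).
    by rewrite Rintegral_cst ?mul0r//; exact: measurable_itv.
  apply: eq_Rintegral => t; rewrite inE/= in_itv/= => /andP[_ tx].
  by apply: h0; rewrite in_itv/= negb_and -leNgt (le_trans tx xa).
have Hge x : b <= x -> H x = 0.
  move=> bx; rewrite -Ih /H Rintegral_mkcond; apply: eq_Rintegral => t _.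
  rewrite /patch; case: ifPn => // tx; rewrite h0//; apply: contra tx.
  by rewrite in_itv/= => /andP[? ?]; apply: mem_set; rewrite /= in_itv/=; apply/andP; split; lra.
exists H; split => x; last first.
  by rewrite in_itv/= negb_and -!leNgt => /orP[/Hle|/Hge].
have [xa|ax] := ltP x a.
  have -> : h x = 0 by apply: h0; rewrite in_itv/= negb_and -leNgt ltW.
  apply: (@near_eq_is_derive _ _ _ (cst 0)).
  have : \forall y \near x, y < a by exact: lt_nbhsl.
  by apply: filterS => y ya; rewrite Hle// ltW.
have xu : x < x + 1 by lra.
have ax1 : a - 1 < x by lra.
have ih : leb.-integrable `[a - 1, x + 1] (EFin \o h).
  by apply: integrableS hi => //; exact: measurable_itv.
have [dH HE] := continuous_FTC1_closed xu ih ax1 (ch x).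
by apply: DeriveDef; [exact: dH|rewrite -derive1E; exact: HE].
Qed.

Lemma Rintegral_bump_gt0 (a b : R) : a < b -> 0 < \int[leb]_x bump 0 a b x.
Proof.
move=> ab; rewrite lt_neqAle Rintegral_ge0 ?andbT; last by move=> x _; exact: bump_ge0.
apply/negP => /eqP /esym I0.
have mb : measurable_fun setT (EFin \o bump 0 a b).
  apply/measurable_EFinP; apply: continuous_measurable_fun.
  exact: (smooth1_bump (R:=R) 0 a b 0%N).
have bi := smooth1_integrable (smooth1_bump 0 a b) (@bump_out _ 0 a b).
have : (\int[leb]_x `|(EFin \o bump 0 a b) x| = 0)%E.
  have := fineK (integrable_fin_num measurableT bi).
  rewrite -[fine _]/(\int[leb]_x bump 0 a b x) I0 => F; apply: etrans (esym F).
  by apply: eq_integral => x _; rewrite gee0_abs// lee_fin bump_ge0.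
move=> /(ae_eq_integral_abs leb measurableT mb).1[N [mN N0 sN]].
have : (leb `]a, b[ <= leb N)%E.
  apply: le_measure; [by apply: mem_set; exact: measurable_itv|exact: mem_set|].
  apply: subset_trans sN => x xab /=; apply/not_implyP; split => // -[].
  by apply/eqP; rewrite gt_eqF// bump_gt0.
by rewrite N0 lebesgue_measure_itv/= lte_fin ab -EFinB lee_fin; lra.
Qed.

Section Local.
Variables (Om : set (R * R)) (a b c d : R).
Hypotheses (oO : open Om) (sO : crect a b c d `<=` Om) (ab : a < b) (cd : c < d).
Let mO := measurable_open_plane oO.

Let in1 h := smooth1 h /\ forall x, x \notin `]a, b[ -> h x = 0.
Let in2 k := smooth1 k /\ forall x, x \notin `]c, d[ -> k x = 0.
Let L f h k := integ Om (fun x => f x * (h x.1 * k x.2)).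
Let I h := \int[leb]_x h x.

Let test_tensor h k : in1 h -> in2 k -> test_function Om (fun x => h x.1 * k x.2).
Proof.
move=> [sh h0] [sk k0]; apply: (test_functionP _ (@compact_crect R a b c d) sO).
  exact: smooth_tensor.
move=> x nx; have [x1|x1] := boolP (x.1 \in `]a, b[); last by rewrite h0 ?mul0r.
have [x2|x2] := boolP (x.2 \in `]c, d[); last by rewrite [X in _ * X]k0 ?mulr0.
exfalso; apply: nx; apply: rect_sub_crect; by split.
Qed.

Let in1B h h' r : in1 h -> in1 h' -> in1 (fun x => h x - r * h' x).
Proof.
move=> [sh h0] [sh' h0']; split; first by apply: smooth1B => //; exact: smooth1Z.
by move=> x x0; rewrite h0// h0'// mulr0 subr0.
Qed.

Let in2B h h' r : in2 h -> in2 h' -> in2 (fun x => h x - r * h' x).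
Proof.
move=> [sh h0] [sh' h0']; split; first by apply: smooth1B => //; exact: smooth1Z.
by move=> x x0; rewrite h0// h0'// mulr0 subr0.
Qed.

Let IB h h' r : leb.-integrable setT (EFin \o h) -> leb.-integrable setT (EFin \o h') ->
  I (fun x => h x - r * h' x) = I h - r * I h'.
Proof.
move=> ih ih'; rewrite /I -RintegralZl// -RintegralB//.
exact: (integrableZl measurableT r ih').
Qed.

Variable f : sfield R.
Hypotheses (lf : locally_integrable2 Om f)
  (f0 : forall j phi, test_function Om phi ->
     integ Om (fun x => f x * 'D_(basis2 R j) phi x) = 0).

Let L10 h k : in1 h -> in2 k -> I h = 0 -> L f h k = 0.
Proof.
move=> ih ik Ih; have [sh h0] := ih; have [sk k0] := ik.
have [H [dH H0]] := smooth1_primitive_compact sh h0 Ih.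
have iH : in1 H by split => //; exact: smooth1_primitive dH.
rewrite -(f0 0 (test_tensor iH ik)); apply: eq_Rintegral => x _; congr (_ * _).
have [_ /(_ tt)[k' dk' _]] := sk 1%N.
have D := is_deriveM (is_derive_fst 0 (dH x.1)) (is_derive_snd 0 (dk' x.2)).
rewrite [RHS](@derive_val _ _ _ _ _ _ _ D) /= scaler0 add0r.
by rewrite /GRing.scale/= mulrC.
Qed.

Let L01 h k : in1 h -> in2 k -> I k = 0 -> L f h k = 0.
Proof.
move=> ih ik Ik; have [sh h0] := ih; have [sk k0] := ik.
have [H [dH H0]] := smooth1_primitive_compact sk k0 Ik.
have iH : in2 H by split => //; exact: smooth1_primitive dH.
rewrite -(f0 1 (test_tensor ih iH)); apply: eq_Rintegral => x _; congr (_ * _).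
have [_ /(_ tt)[h' dh' _]] := sh 1%N.
have D := is_deriveM (is_derive_fst 1 (dh' x.1)) (is_derive_snd 1 (dH x.2)).
by rewrite [RHS](@derive_val _ _ _ _ _ _ _ D) /= scaler0 addr0.
Qed.

Let LB1 h h' r k : in1 h -> in1 h' -> in2 k ->
  L f (fun x => h x - r * h' x) k = L f h k - r * L f h' k.
Proof.
move=> ih ih' ik; rewrite /L /integ.
have i1 := integrable_test mO lf (test_tensor ih ik).
have i2 := integrable_test mO lf (test_tensor ih' ik).
rewrite -RintegralZl// -RintegralB//; last exact: (integrableZl mO r i2).
by apply: eq_Rintegral => x _; ring.
Qed.

Let LB2 h k k' r : in1 h -> in2 k -> in2 k' ->
  L f h (fun x => k x - r * k' x) = L f h k - r * L f h k'.
Proof.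
move=> ih ik ik'; rewrite /L /integ.
have i1 := integrable_test mO lf (test_tensor ih ik).
have i2 := integrable_test mO lf (test_tensor ih ik').
rewrite -RintegralZl// -RintegralB//; last exact: (integrableZl mO r i2).
by apply: eq_Rintegral => x _; ring.
Qed.

Let b1 := bump 0 a b.
Let b2 := bump 0 c d.

Let in1b : in1 b1. Proof. by split; [exact: smooth1_bump|exact: bump_out]. Qed.
Let in2b : in2 b2. Proof. by split; [exact: smooth1_bump|exact: bump_out]. Qed.

(** The functional L vanishes when one factor has zero mean, for then the product
   is a derivative of a test function. Subtracting the multiple of a fixed bump
   with the same mean reduces every factor to this case. *)
Let L_tensor h k : in1 h -> in2 k -> L f h k = I h / I b1 * (I k / I b2) * L f b1 b2.
Proof.
move=> ih ik; have [sh h0] := ih; have [sk k0] := ik.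
have I1 : I b1 != 0 by rewrite gt_eqF// Rintegral_bump_gt0.
have I2 : I b2 != 0 by rewrite gt_eqF// Rintegral_bump_gt0.
have E1 : L f h k = I h / I b1 * L f b1 k.
  apply/eqP; rewrite -subr_eq0 -LB1// L10//; first exact: in1B.
  rewrite IB; last 2 first.
  - exact: smooth1_integrable sh h0.
  - by case: in1b => sb b0; exact: smooth1_integrable sb b0.
  by rewrite divfK// subrr.
have E2 : L f b1 k = I k / I b2 * L f b1 b2.
  apply/eqP; rewrite -subr_eq0 -LB2// L01//; first exact: in2B.
  rewrite IB; last 2 first.
  - exact: smooth1_integrable sk k0.
  - by case: in2b => sb b0; exact: smooth1_integrable sb b0.
  by rewrite divfK// subrr.
by rewrite E1 E2 mulrA.
Qed.

(** By [L_tensor] one product of bumps decides for all of them. *)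
Lemma ae_eq0_zero_gradient : L f b1 b2 = 0 ->
  {ae mu, forall x, rect a b c d x -> f x = 0}.
Proof.
move=> L0; apply: (ae_eq0_bump_loc oO sO lf) => k a' b' c' d' aa bb cc dd.
have := @L_tensor (bump k a' b') (bump k c' d'); rewrite L0 mulr0; apply.
  split; first exact: smooth1_bump.
  move=> x x0; apply: bump_out; apply: contra x0; rewrite !in_itv/= => /andP[? ?].
  by apply/andP; split; lra.
split; first exact: smooth1_bump.
move=> x x0; apply: bump_out; apply: contra x0; rewrite !in_itv/= => /andP[? ?].
by apply/andP; split; lra.
Qed.

End Local.

Lemma integ_partial_testM Om j phi C : measurable (Om : set (plane R)) ->
  test_function Om phi -> integ Om (fun x => C * 'D_(basis2 R j) phi x) = 0.
Proof.
move=> mO tp; rewrite /integ RintegralZl//.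
  by have := integ_partial_test j tp; rewrite /integ => ->; rewrite mulr0.
have l1 : locally_integrable2 Om (fun _ : R * R => 1 : R).
  by apply: continuous_loc_integrable => x; exact: cvg_cst.
have := integrable_test mO l1 (test_partial j tp).
by under eq_fun do rewrite /= mul1r.
Qed.

(** Subtracting the constant that makes the integral against one fixed bump vanish
   reduces this to functions annihilated by all products of bumps. *)
Lemma zero_gradient_rect Om (a b c d : R) f : open Om -> crect a b c d `<=` Om ->
  a < b -> c < d -> locally_integrable2 Om f ->
  (forall j phi, test_function Om phi ->
     integ Om (fun x => f x * 'D_(basis2 R j) phi x) = 0) ->
  exists C, {ae mu, forall x, rect a b c d x -> f x = C}.
Proof.
move=> oO sO ab cd lf f0; have mO := measurable_open_plane oO.
pose B (x : R * R) : R := bump 0 a b x.1 * bump 0 c d x.2.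
have tB : test_function Om B by apply: (test_bump 0 0 sO); exact: lexx.
have l1 (C : R) : locally_integrable2 Om (fun _ : R * R => C).
  by apply: continuous_loc_integrable => x; exact: cvg_cst.
have iB := integrable_test mO (l1 1) tB.
have IB : integ Om (fun x => 1 * B x) != 0.
  apply/negP => /eqP IB0.
  have mB : measurable_fun (Om : set (plane R)) (EFin \o (fun x => 1 * B x)).
    exact: measurable_int iB.
  have : (\int[mu]_(x in Om) `|(EFin \o (fun x => 1 * B x)%R) x| = 0)%E.
    have := fineK (integrable_fin_num mO iB).
    rewrite -[fine _]/(integ Om (fun x => 1 * B x)) IB0 => F; apply: etrans (esym F).
    by apply: eq_integral => x _; rewrite gee0_abs// lee_fin mul1r mulr_ge0 ?bump_ge0.
  move=> /(ae_eq_integral_abs mu mO mB).1[N [mN N0 sN]].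
  have : (0 < mu (rect a b c d))%E.
    apply: (@open_measure_gt0 _ ((a + b) / 2, (c + d) / 2)); first exact: open_rect.
    by split; rewrite /= in_itv/=; apply/andP; split; lra.
  rewrite ltNge => /negP; apply; rewrite -N0; apply: le_measure; rewrite ?inE//.
    exact: measurable_rect.
  apply: subset_trans sN => x [x1 x2] /=; apply/not_implyP.
  split; first by apply/sO/rect_sub_crect.
  by move=> [] /eqP; rewrite mul1r gt_eqF// mulr_gt0 ?bump_gt0.
pose C := integ Om (fun x => f x * B x) / integ Om (fun x => 1 * B x).
exists C.
have lfC : locally_integrable2 Om (fun x => f x - C).
  exact: loc_integrableD lf (l1 (- C)).
have : {ae mu, forall x, rect a b c d x -> f x - C = 0}.
  apply: (ae_eq0_zero_gradient oO sO ab cd lfC).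
    move=> j phi tp; have tdp := test_partial j tp.
    have := integ_partial_testM j C mO tp; have := f0 j phi tp; rewrite /integ => F1 F2.
    under eq_Rintegral do rewrite mulrBl.
    rewrite RintegralB ?F1 ?F2 ?subr0//; first exact: integrable_test.
    exact: (integrable_test mO (l1 C) tdp).
  rewrite /integ; under eq_Rintegral do rewrite mulrBl.
  rewrite RintegralB//; last 2 first.
  - exact: (integrable_test mO lf tB).
  - exact: (integrable_test mO (l1 C) tB).
  under [X in _ - X]eq_Rintegral do rewrite -[C]mulr1 -mulrA.
  rewrite RintegralZl//.
  by rewrite -[X in _ - _ * X]/(integ Om (fun x => 1 * B x)) divfK// subrr.
by apply: filterS => x H /H /eqP; rewrite subr_eq0 => /eqP.
Qed.

(** The function is constant on small rectangles, and rectangles that meet share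
   their constant because their intersection has positive measure. The sets where
   the local constant has a given value are open and disjoint, so connectedness
   leaves only one of them. *)
Lemma zero_gradient_connected Om f : open Om -> connected Om -> Om !=set0 ->
  locally_integrable2 Om f ->
  (forall j phi, test_function Om phi ->
     integ Om (fun x => f x * 'D_(basis2 R j) phi x) = 0) ->
  exists C, {ae mu, forall x, Om x -> f x = C}.
Proof.
move=> oO cO [x0 Ox0] lf f0.
pose U (C : R) : set (R * R) := [set x | exists a b c d, [/\ crect a b c d `<=` Om,
  rect a b c d x & {ae mu, forall y, rect a b c d y -> f y = C}]].
have oU C : open (U C).
  rewrite openE => x [a [b [c [d [s r H]]]]]; rewrite /interior.
  apply: (@filterS _ _ _ (rect a b c d)); first by move=> y ry; exists a, b, c, d.
  by apply: open_nbhs_nbhs; split => //; exact: open_rect.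
have UO C : U C `<=` Om.
  by move=> x [a [b [c [d [s r H]]]]]; apply/s/rect_sub_crect.
have loc a b c d : crect a b c d `<=` Om -> a < b -> c < d -> exists C,
    {ae mu, forall x, rect a b c d x -> f x = C}.
  by move=> s ab cd; exact: zero_gradient_rect lf f0.
have Ucov x : Om x -> exists C, U C x.
  move=> Ox; have := Ox; rewrite {1}(open_bigcup_rat_rect oO) => -[n _].
  have [->//|[a [b [c [d [s ->]]]]]] := rat_rectP Om n => rx.
  have [x1 x2] := rx; move: x1 x2; rewrite /= !in_itv/= => /andP[? ?] /andP[? ?].
  have [||C HC] := loc a b c d s; [lra|lra|].
  by exists C, a, b, c, d.
have Uinj x C C' : U C x -> U C' x -> C = C'.
  move=> [a [b [c [d [s r H]]]]] [a' [b' [c' [d' [s' r' H']]]]].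
  apply: contrapT => CC'.
  have oI : open (rect a b c d `&` rect a' b' c' d') by apply: openI; exact: open_rect.
  have := open_measure_gt0 oI (conj r r'); rewrite ltNge => /negP; apply.
  have [N [mN N0 sN]] : {ae mu, forall y, ~ (rect a b c d `&` rect a' b' c' d') y}.
    by move: H H'; apply: filterS2 => y h h' [/h e /h' e']; apply: CC'; rewrite -e e'.
  rewrite -N0; apply: le_measure; rewrite ?inE//; first exact: measurable_open_plane.
  by apply: subset_trans sN => y ry /=; exact.
have [C0 UC0] := Ucov _ Ox0; exists C0.
have UE : U C0 = Om.
  apply: cO; first by exists x0.
    by exists (U C0) => //; rewrite setIidr.
  (* The other level sets form an open union, so U C0 is also relatively closed. *)
  exists (~` \bigcup_(C in [set C | C <> C0]) U C).
    by apply: open_closedC; apply: bigcup_open => C _; exact: oU.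
  apply/seteqP; split => x.
    move=> Ux; split; first exact: UO Ux.
    by move=> [C CC0 UCx]; apply: CC0; exact: Uinj UCx Ux.
  move=> [Ox nx]; have [C UCx] := Ucov _ Ox.
  by have [<-//|CC0] := pselect (C = C0); exfalso; apply: nx; exists C.
apply: ae_open_rect => // a b c d s.
have [[x rx]|ne] := pselect (rect a b c d !=set0); last first.
  by apply: aeW => x rx; exfalso; apply: ne; exists x.
have [x1 x2] := rx; move: x1 x2; rewrite /= !in_itv/= => /andP[? ?] /andP[? ?].
have [||C HC] := loc a b c d s; [lra|lra|].
have -> // : C0 = C; apply: (Uinj x); last by exists a, b, c, d.
by rewrite UE; apply/s/rect_sub_crect.
Qed.

End ConstantFromGradient.

(** * The Euclidean norm of a finite family *)

Section EuclideanNorm.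
Variables (R : realType) (I : finType).
Implicit Types F G : I -> R.

(** Stated for any finite index set because it occurs for vectors and gradients,
   with one index, and for gradients of vector fields, with a pair of indices. *)
Definition enrm F : R := Num.sqrt (\sum_i F i ^+ 2).

Lemma enrm_ge0 F : 0 <= enrm F.
Proof. exact: sqrtr_ge0. Qed.

Lemma sum_sqr_ge0 F : 0 <= \sum_i F i ^+ 2.
Proof. by apply: sumr_ge0 => i _; exact: sqr_ge0. Qed.

Lemma enrm_sqr F : enrm F ^+ 2 = \sum_i F i ^+ 2.
Proof. by rewrite sqr_sqrtr// sum_sqr_ge0. Qed.

Lemma cauchy_schwarz_sum F G : `|\sum_i F i * G i| <= enrm F * enrm G.
Proof.
rewrite -sqrtr_sqr -sqrtrM ?sum_sqr_ge0//; apply: ler_wsqrtr.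
set A := \sum_i F i ^+ 2; set B := \sum_i G i ^+ 2; set C := \sum_i _.
(* The sum of squares of F - t G as a quadratic in t, used at its minimum C/B. *)
have q t : 0 <= A - 2 * t * C + t ^+ 2 * B.
  rewrite /A /B /C !mulr_sumr -sumrB -big_split/=; apply: sumr_ge0 => i _.
  by rewrite (_ : _ + _ = (F i - t * G i) ^+ 2) ?sqr_ge0//; ring.
have B0 : 0 <= B by exact: sum_sqr_ge0.
have [B0'|Bn0] := eqVneq B 0.
  have G0 i : G i = 0.
    have /eqP := B0'; rewrite /B psumr_eq0; last by move=> j _; exact: sqr_ge0.
    by move=> /allP/(_ i (mem_index_enum i))/=; rewrite sqrf_eq0 => /eqP.
  by rewrite /C big1 ?expr0n ?B0' ?mulr0// => i _; rewrite G0 mulr0.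
have Bp : 0 < B by rewrite lt_neqAle eq_sym Bn0.
have := q (C / B); rewrite -(ler_pM2r Bp) mul0r.
by rewrite (_ : (_ - _ + _) * B = A * B - C ^+ 2) ?subr_ge0//; field.
Qed.

Lemma enrmD F G : enrm (fun i => F i + G i) <= enrm F + enrm G.
Proof.
rewrite -(@ler_pXn2r _ 2)// ?nnegrE ?addr_ge0 ?enrm_ge0// sqrrD !enrm_sqr.
have -> : \sum_i (F i + G i) ^+ 2 =
    \sum_i F i ^+ 2 + (\sum_i F i * G i) *+ 2 + \sum_i G i ^+ 2.
  by rewrite -sumrMnl -!big_split/=; apply: eq_bigr => i _; rewrite sqrrD.
rewrite lerD2r lerD2l lerMn2r/=.
exact: le_trans (ler_norm _) (cauchy_schwarz_sum F G).
Qed.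

Lemma enrmZ a F : enrm (fun i => a * F i) = `|a| * enrm F.
Proof.
rewrite /enrm -sqrtr_sqr -sqrtrM ?sqr_ge0// mulr_sumr; congr Num.sqrt.
by apply: eq_bigr => i _; rewrite exprMn.
Qed.

Lemma enrm_le_sum F : enrm F <= \sum_i `|F i|.
Proof.
rewrite -(@ler_pXn2r _ 2)// ?nnegrE ?enrm_ge0 ?sumr_ge0// enrm_sqr.
rewrite expr2 mulr_suml; apply: ler_sum => i _.
rewrite -real_normK ?num_real// expr2 ler_wpM2l// (bigD1 i)//= lerDl.
by apply: sumr_ge0.
Qed.

End EuclideanNorm.

Section EuclideanNormLp.
Variables (R : realType) (Om : set (R * R)) (I : finType).
Hypothesis mO : measurable (Om : set (plane R)).
Implicit Types F G : I -> sfield R.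

Lemma measurable_enrm F :
  (forall i, measurable_fun (Om : set (plane R)) (F i)) ->
  measurable_fun (Om : set (plane R)) (fun x => enrm (F ^~ x)).
Proof.
move=> mF; have ms : measurable_fun setT (@Num.sqrt R).
  by apply: continuous_measurable_fun; exact: sqrt_continuous.
apply: (measurableT_comp ms).
by apply: measurable_sum => i; exact: measurable_funX.
Qed.

Lemma Lp_norm p v : 0 < p -> Lp Om p v -> Lp Om p (fun x => `|v x|).
Proof.
move=> p0 Lv; have [] := le_Lp mO (v := fun x => `|v x|) p0 _ Lv _ => //.
  by apply: measurableT_comp => //; exact: Lp_mf Lv.
by apply: aeW => x _; rewrite normr_id.
Qed.

Lemma Lp_enrm p F : 1 <= p -> (forall i, Lp Om p (F i)) ->
  Lp Om p (fun x => enrm (F ^~ x)).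
Proof.
move=> p1 LF; have p0 : 0 < p by exact: lt_le_trans p1.
have L := @Lp_sum _ _ mO p I (index_enum I) (fun i x => `|F i x|) p1
  (fun i => Lp_norm p0 (LF i)).
have [] := le_Lp mO (v := fun x => enrm (F ^~ x)) p0 _ L _ => //.
  by apply: measurable_enrm => i; exact: Lp_mf (LF i).
apply: aeW => x _; rewrite ger0_norm ?enrm_ge0//.
by apply: le_trans (enrm_le_sum _) (ler_norm _).
Qed.

(** Passes between the gradient norms, which are norms of Euclidean lengths, and
   estimates for single components. *)
Lemma Lnrm_enrm_sqr F : (forall i, Lp Om 2 (F i)) ->
  Lnrm Om 2 (fun x => enrm (F ^~ x)) ^+ 2 = \sum_i Lnrm Om 2 (F i) ^+ 2.
Proof.
move=> LF; rewrite Lnrm2_sqr//; last by apply: Lp_enrm => //; lra.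
under eq_bigr do rewrite Lnrm2_sqr//.
transitivity (integ Om (fun x => \sum_i F i x ^+ 2)).
  by congr integ; apply/funext => x; rewrite enrm_sqr.
apply: integ_sum => // i.
have [+ _] := cauchy_schwarz_Lp mO (LF i) (LF i).
by under eq_fun do rewrite -expr2.
Qed.

End EuclideanNormLp.

(** * Dual norms and Sobolev spaces *)

Lemma sqr_eq_ge0 (R : realDomainType) (x y : R) : 0 <= x -> 0 <= y ->
  x ^+ 2 = y ^+ 2 -> x = y.
Proof. by move=> x0 y0 /eqP; rewrite eqrXn2// => /eqP. Qed.

Section DualNorm.
Variables (R : realType) (V : lmodType R) (H : set V) (N : V -> R).
Hypotheses (H0 : H 0) (HZ : forall a v, H v -> H (a *: v))
  (NZ : forall a v, H v -> N (a *: v) = `|a| * N v) (N0 : forall v, 0 <= N v).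
Variable F : V -> R.
Hypothesis FH : dual_space H N F.

Let F0 : F 0 = 0.
Proof. by have [l _] := FH; have := l 1 0 0 H0 H0; rewrite scaler0 addr0 mul1r; lra. Qed.

Let FZ a v : H v -> F (a *: v) = a * F v.
Proof. by move=> Hv; have [l _] := FH; rewrite -[a *: v]addr0 l// F0 addr0. Qed.

Let bdd : has_sup [set `|F v| | v in [set v | H v /\ N v <= 1]].
Proof.
split; first by exists `|F 0|, 0 => //; split => //; rewrite -(scale0r 0) NZ// normr0 mul0r.
have [_ [C HC]] := FH; exists `|C| => _ [v [Hv Nv] <-].
apply: le_trans (HC v Hv) _; apply: le_trans (ler_norm _) _.
by rewrite normrM (ger0_norm (N0 _)) -[leRHS]mulr1 ler_wpM2l.
Qed.

Lemma dual_norm_ge0 : 0 <= dual_norm H N F.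
Proof.
apply: le_trans (normr_ge0 (F 0)) _; apply: ub_le_sup; first exact: bdd.2.
by exists 0 => //; split => //; rewrite -(scale0r 0) NZ// normr0 mul0r.
Qed.

(** By homogeneity, except when N v = 0: then v cannot be normalized, and the
   boundedness of the functional shows that both sides vanish. *)
Lemma dual_norm_bound v : H v -> `|F v| <= dual_norm H N F * N v.
Proof.
move=> Hv; have [Nv0|Nvn0] := eqVneq (N v) 0.
  by have [_ [C HC]] := FH; have := HC v Hv; rewrite Nv0 !mulr0.
have Nv : 0 < N v by rewrite lt_neqAle eq_sym Nvn0 N0.
rewrite -ler_pdivrMr//; have -> : `|F v| / N v = `|F ((N v)^-1 *: v)|.
  by rewrite FZ// normrM ger0_norm ?invr_ge0// mulrC.
apply: ub_le_sup; first exact: bdd.2.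
exists ((N v)^-1 *: v) => //; split; first exact: HZ.
by rewrite NZ// ger0_norm ?invr_ge0// mulVf.
Qed.

End DualNorm.

Section Sobolev.
Variables (R : realType) (Om : set (R * R)).
Hypotheses (oO : open Om) (fO : (leb2 R Om < +oo)%E).
Let mO := measurable_open_plane oO.
Implicit Types (v w phi : sfield R) (u : vfield R) (p a : R) (j : 'I_2).
Local Notation mu := (leb2 R).
Local Notation wp := (weak_partial Om).
Local Notation G := (grad_norm Om 2).

Lemma is_weak_partial_mf j v w : is_weak_partial Om j v w ->
  measurable_fun (Om : set (plane R)) w.
Proof.
move=> [_ lw _]; apply: measurable_fun_crect => // a b c d s.
apply/measurable_EFinP; exact: measurable_int (lw _ s (@compact_crect R a b c d)).
Qed.

Lemma W1p_partial p v : 0 < p -> W1p Om p v ->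
  forall j, is_weak_partial Om j v (wp j v) /\ Lp Om p (wp j v).
Proof.
move=> p0 [Lv D] j; have [w vw Lw] := D j; have vwp := weak_partialP vw.
split => //; apply: (ae_eq_Lp mO p0 (is_weak_partial_mf vwp) Lw _).1.
by apply: filterS (weak_partial_ae oO vw) => x H /H ->.
Qed.

(** The chosen weak derivatives are linear only almost everywhere, so every
   computation with the gradient of a difference goes through this. *)
Lemma W1p_lin p a v w : 1 <= p -> W1p Om p v -> W1p Om p w ->
  W1p Om p (fun x => a * v x + w x) /\
  forall j, {ae mu, forall x, Om x ->
    wp j (fun x => a * v x + w x) x = a * wp j v x + wp j w x}.
Proof.
move=> p1 Wv Ww; have p0 : 0 < p by exact: lt_le_trans p1.
have lin j := is_weak_partial_lin a mO (W1p_partial p0 Wv j).1 (W1p_partial p0 Ww j).1.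
split; last by move=> j; exact: weak_partial_ae.
split; first exact: (LpD mO p1 (LpZ mO a p0 Wv.1).1 Ww.1).1.
move=> j; exists (fun x => a * wp j v x + wp j w x); first exact: lin.
exact: (LpD mO p1 (LpZ mO a p0 (W1p_partial p0 Wv j).2).1 (W1p_partial p0 Ww j).2).1.
Qed.

Lemma test_Lp p phi : 0 < p -> test_function Om phi -> Lp Om p phi.
Proof.
move=> p0 [sp cp pO]; have cphi := smooth_continuous sp.
have [B B0 HB] := continuous_bounded_compact cp cphi.
apply: (le_Lp mO p0 _ (Lp_cst mO B fO p0) _).1.
  by apply: measurable_funTS; exact: continuous_measurable_plane.
apply: aeW => x _; rewrite /= (gtr0_norm B0).
have [/HB//|/supp_out ->] := pselect (supp phi x).
by rewrite normr0 ltW.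
Qed.

Lemma test_W1p p phi : 0 < p -> test_function Om phi ->
  W1p Om p phi /\
  forall j, {ae mu, forall x, Om x -> wp j phi x = 'D_(basis2 R j) phi x}.
Proof.
move=> p0 tp; have D j := smooth_is_weak_partial j mO (test_smooth tp).
split; last by move=> j; exact: weak_partial_ae.
split; first exact: test_Lp.
by move=> j; exists ('D_(basis2 R j) phi) => //; apply: test_Lp => //; exact: test_partial.
Qed.

Lemma test0 : test_function Om (cst 0).
Proof.
apply: (@test_functionP _ _ _ set0) => //.
- by apply/smooth_Cn => n; exact: Cn_cst.
- exact: compact0.
Qed.

Lemma grad_abs_Lp p v : 1 <= p -> W1p Om p v -> Lp Om p (grad_abs Om v).
Proof.
move=> p1 Wv; apply: (Lp_enrm (F := fun j => wp j v) mO p1) => j.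
by apply: (W1p_partial _ Wv j).2; exact: lt_le_trans p1.
Qed.

Lemma vgrad_absE u : vgrad_abs Om u =
  (fun x => enrm (fun ij : 'I_2 * 'I_2 => wp ij.2 (u ij.1) x)).
Proof.
apply/funext => x; rewrite /vgrad_abs /enrm; congr Num.sqrt.
by rewrite pair_big.
Qed.

Lemma vgrad_abs_Lp p u : 1 <= p -> vW1p Om p u -> Lp Om p (vgrad_abs Om u).
Proof.
move=> p1 Wu; rewrite vgrad_absE.
apply: (Lp_enrm (F := fun ij : 'I_2 * 'I_2 => wp ij.2 (u ij.1)) mO p1) => -[i j].
by apply: (W1p_partial _ (Wu i) j).2; exact: lt_le_trans p1.
Qed.

Let one2 : (1 : R) <= 2. Proof. lra. Qed.
Let zero2 : (0 : R) < 2. Proof. lra. Qed.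

Lemma grad_norm_ge0 p v : 0 <= grad_norm Om p v.
Proof. exact: Lnrm_ge0. Qed.

Lemma vgrad_norm_ge0 p u : 0 <= vgrad_norm Om p u.
Proof. exact: Lnrm_ge0. Qed.

Lemma grad_norm_sqr v : W1p Om 2 v -> G v ^+ 2 = \sum_j Lnrm Om 2 (wp j v) ^+ 2.
Proof.
move=> Wv; apply: (Lnrm_enrm_sqr (F := fun j => wp j v) mO) => j.
exact: (W1p_partial _ Wv j).2.
Qed.

Lemma vgrad_norm_sqr u : vW1p Om 2 u -> vgrad_norm Om 2 u ^+ 2 = \sum_i G (u i) ^+ 2.
Proof.
move=> Wu; rewrite /vgrad_norm vgrad_absE.
rewrite (Lnrm_enrm_sqr (F := fun ij : 'I_2 * 'I_2 => wp ij.2 (u ij.1)) mO).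
  under [RHS]eq_bigr do rewrite grad_norm_sqr//.
  by rewrite pair_big.
by move=> [i j]; exact: (W1p_partial _ (Wu i) j).2.
Qed.

Lemma Lnrm_partial_le j v : W1p Om 2 v -> Lnrm Om 2 (wp j v) <= G v.
Proof.
move=> Wv; rewrite -ler_sqr ?nnegrE ?Lnrm_ge0 ?grad_norm_ge0//.
rewrite grad_norm_sqr// (bigD1 j)//= lerDl.
by apply: sumr_ge0 => i _; exact: sqr_ge0.
Qed.

Lemma grad_norm_lin a v w : W1p Om 2 v -> W1p Om 2 w ->
  G (fun x => a * v x + w x) <= `|a| * G v + G w.
Proof.
move=> Wv Ww; have [Wl lin] := W1p_lin a one2 Wv Ww.
have Lv := grad_abs_Lp one2 Wv; have Lw := grad_abs_Lp one2 Ww.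
have [La Na] := LpZ mO `|a| zero2 Lv.
have [Ls Ns] := LpD mO one2 La Lw.
apply: le_trans (_ : Lnrm Om 2 ((fun x => `|a| * grad_abs Om v x) \+ grad_abs Om w) <= _).
  apply: (le_Lp mO zero2 (Lp_mf mO (grad_abs_Lp one2 Wl)) Ls _).2.
  move: (lin 0) (lin 1); apply: filterS2 => x l0 l1 Ox.
  rewrite ger0_norm ?sqrtr_ge0//; apply: le_trans (ler_norm _).
  have -> : grad_abs Om (fun x => a * v x + w x) x =
      enrm (fun j => a * wp j v x + wp j w x).
    rewrite /grad_abs /enrm; congr Num.sqrt; apply: eq_bigr => j _.
    by have [->|->] := ord2_cases j; rewrite ?l0 ?l1.
  apply: le_trans (enrmD _ _) _.
  by rewrite enrmZ.
by rewrite normr_id in Na; rewrite -Na.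
Qed.

(** The inequality holds by [grad_norm_lin]; applied to the inverse factor it
   gives the reverse inequality. *)
Lemma grad_normZ a v : W1p Om 2 v -> G (fun x => a * v x) = `|a| * G v.
Proof.
move=> Wv; have W0 := (test_W1p zero2 test0).1.
have le b w : W1p Om 2 w -> W1p Om 2 (fun x => b * w x) /\
    G (fun x => b * w x) <= `|b| * G w.
  move=> Ww; have G0 : G (cst 0) = 0.
    have := grad_norm_sqr W0.
    rewrite big1 => [/eqP|j _]; first by rewrite sqrf_eq0 => /eqP.
    have [L0 H0] := W1p_partial zero2 W0 j.
    have [_ E] := test_W1p zero2 test0; have := E j.
    move=> D0; have D0' : {ae mu, forall x, Om x -> wp j (cst 0) x = cst 0 x}.
      by apply: filterS D0 => x D /D ->; rewrite derive_cst.
    have [_ <-] := ae_eq_Lp mO zero2 (measurable_cst _) H0 D0'.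
    have [_ Z] := LpZ mO 0 zero2 (Lp0 mO zero2).
    rewrite normr0 !mul0r in Z.
    suff -> : Lnrm Om 2 (cst 0) = 0 by rewrite expr0n.
    exact: Z.
  have [Wb _] := W1p_lin b one2 Ww W0; have := grad_norm_lin b Ww W0.
  rewrite G0 addr0; rewrite (_ : (fun x => _ + _) = (fun x => b * w x)) in Wb *.
    by [].
  by apply/funext => x; rewrite addr0.
have [->|a0] := eqVneq a 0.
  have [_ le0] := le 0 v Wv; apply/eqP; rewrite eq_le le0/= normr0 mul0r.
  exact: grad_norm_ge0.
have [Wa lea] := le a v Wv; apply/eqP; rewrite eq_le lea/=.
have [_] := le a^-1 _ Wa.
rewrite (_ : (fun x => a^-1 * _) = v); last by apply/funext => x; rewrite mulKf.
by rewrite normfV ler_pdivlMl ?normr_gt0.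
Qed.

Lemma H10_W1p v : H10 Om v -> W1p Om 2 v.
Proof. by case. Qed.

Lemma vH10_vW1p u : vH10 Om u -> vW1p Om 2 u.
Proof. by move=> Hu i; exact: H10_W1p. Qed.

Lemma test_H10 phi : test_function Om phi -> H10 Om phi.
Proof.
move=> tp; split; first exact: (test_W1p zero2 tp).1.
move=> e e0; exists phi => //.
have -> : (phi \- phi)%R = (fun x => 0 * phi x).
  by apply/funext => x /=; rewrite subrr mul0r.
have Wp := (test_W1p zero2 tp).1.
have W0 := (W1p_lin 0 one2 Wp (test_W1p zero2 test0).1).1.
rewrite (_ : (fun x => _ + _) = (fun x => 0 * phi x)) in W0; last first.
  by apply/funext => x; rewrite addr0.
split.
  have [L N] := LpZ mO 0 zero2 Wp.1.
  by rewrite LnrmE// N normr0 mul0r lte_fin.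
rewrite (LnrmE mO (grad_abs_Lp one2 W0)) -[Lnrm _ _ _]/(G _).
by rewrite grad_normZ// normr0 mul0r lte_fin.
Qed.

(** Arguments by density need the error to be a Sobolev function with real norms,
   while the closure is expressed by extended norms. *)
Lemma H10_approx v e : H10 Om v -> 0 < e -> exists phi, [/\ test_function Om phi,
  W1p Om 2 (v \- phi), Lnrm Om 2 (v \- phi) < e & G (v \- phi) < e].
Proof.
move=> [Wv Hv] e0; have [phi tp [N1 N2]] := Hv e e0; exists phi.
have Wp := (test_W1p zero2 tp).1.
have W : W1p Om 2 (v \- phi).
  have [+ _] := W1p_lin (-1) one2 Wp Wv; congr (W1p _ _ _).
  by apply/funext => x /=; rewrite mulN1r addrC.
split => //; first by rewrite -lte_fin -LnrmE//; exact: W.1.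
by rewrite -lte_fin -(LnrmE mO (grad_abs_Lp one2 W)).
Qed.

Lemma H10_lin a v w : H10 Om v -> H10 Om w -> H10 Om (fun x => a * v x + w x).
Proof.
move=> Hv Hw; have Wv := H10_W1p Hv; have Ww := H10_W1p Hw.
split; first exact: (W1p_lin a one2 Wv Ww).1.
(* Adding 1 to the absolute value of a covers the case a = 0. *)
move=> e e0; pose e1 := e / (2 * (`|a| + 1)).
have a1 : 0 < `|a| + 1 by rewrite ltr_wpDl.
have e10 : 0 < e1 by rewrite divr_gt0// mulr_gt0.
have ae1 : `|a| * e1 <= e / 2.
  rewrite /e1 mulrA ler_pdivrMr ?mulr_gt0//.
  by rewrite (_ : e / 2 * _ = `|a| * e + e); [rewrite lerDl ltW|field].
have [phi [tp Wp N1 N2]] := H10_approx Hv e10.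
have [psi [tq Wq M1 M2]] := H10_approx Hw (divr_gt0 e0 zero2).
exists (fun x => a * phi x + psi x); first by apply: testD => //; exact: testZ.
have -> : ((fun x => a * v x + w x) \- (fun x => a * phi x + psi x))%R =
    (fun x => a * (v \- phi) x + (w \- psi) x) by apply/funext => x /=; ring.
have [Wl _] := W1p_lin a one2 Wp Wq.
have fin (A B : R) : A < e1 -> B < e / 2 -> `|a| * A + B < e.
  move=> Ae Be; rewrite [ltRHS](splitr e); apply: ler_ltD Be; apply: le_trans ae1.
  exact: ler_wpM2l (normr_ge0 a) _ _ (ltW Ae).
split.
  rewrite LnrmE//; last exact: Wl.1.
  have [La Na] := LpZ mO a zero2 Wp.1; have [_ Ns] := LpD mO one2 La Wq.1.
  by rewrite lte_fin; apply: le_lt_trans Ns _; rewrite Na; exact: fin.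
rewrite (LnrmE mO (grad_abs_Lp one2 Wl)) lte_fin -[Lnrm _ _ _]/(G _).
by apply: le_lt_trans (grad_norm_lin a Wp Wq) _; exact: fin.
Qed.

Lemma H10_0 : H10 Om (cst 0).
Proof. exact: test_H10 test0. Qed.

Lemma H10Z a v : H10 Om v -> H10 Om (fun x => a * v x).
Proof.
move=> Hv; have := H10_lin a Hv H10_0; congr (H10 _ _).
by apply/funext => x; rewrite addr0.
Qed.

Lemma H10B v w : H10 Om v -> H10 Om w -> H10 Om (v \- w).
Proof.
move=> Hv Hw; have := H10_lin (-1) Hw Hv; congr (H10 _ _).
by apply/funext => x /=; rewrite mulN1r addrC.
Qed.

Lemma partialB j v w : H10 Om v -> H10 Om w ->
  {ae mu, forall x, Om x -> wp j (v \- w) x = wp j v x - wp j w x}.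
Proof.
move=> Hv Hw; have [_ H] := W1p_lin (-1) one2 (H10_W1p Hw) (H10_W1p Hv).
have E : (fun x => -1 * w x + v x) = v \- w.
  by apply/funext => x /=; rewrite mulN1r addrC.
by apply: filterS (H j) => x {}H /H; rewrite E => ->; rewrite mulN1r addrC.
Qed.

Lemma vgrad_normZ a u : vH10 Om u -> vgrad_norm Om 2 (fun i x => a * u i x) =
  `|a| * vgrad_norm Om 2 u.
Proof.
move=> Hu; have Wau : vW1p Om 2 (fun i x => a * u i x).
  by move=> i; apply: H10_W1p; exact: H10Z.
have E : \sum_i G (fun x => a * u i x) ^+ 2 = `|a| ^+ 2 * \sum_i G (u i) ^+ 2.
  rewrite mulr_sumr; apply: eq_bigr => i _; rewrite -exprMn.
  by congr (_ ^+ 2); exact: grad_normZ (H10_W1p (Hu i)).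
apply: (sqr_eq_ge0 (vgrad_norm_ge0 _ _) (mulr_ge0 (normr_ge0 a) (vgrad_norm_ge0 _ _))).
apply: etrans (vgrad_norm_sqr Wau) (etrans E _).
apply: etrans (esym (exprMn _ _ _)); congr (_ * _).
exact: esym (vgrad_norm_sqr (vH10_vW1p Hu)).
Qed.

Let grad_normZ' a v : H10 Om v -> G (a *: v) = `|a| * G v.
Proof. by move=> Hv; exact: grad_normZ (H10_W1p Hv). Qed.

Let vH10_0 : vH10 Om 0.
Proof. by move=> i; exact: H10_0. Qed.

Let vH10Z a u : vH10 Om u -> vH10 Om (a *: u).
Proof. by move=> Hu i; exact: H10Z (Hu i). Qed.

Lemma Hm1_bound (g : sfield R -> R) v : Hm1 Om g -> H10 Om v ->
  `|g v| <= Hm1_norm Om g * G v.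
Proof.
move=> Hg; exact: (@dual_norm_bound R _ (H10 Om) G H10_0 H10Z grad_normZ'
  (grad_norm_ge0 2) g Hg v).
Qed.

Lemma vHm1_bound (f : vfield R -> R) u : vHm1 Om f -> vH10 Om u ->
  `|f u| <= vHm1_norm Om f * vgrad_norm Om 2 u.
Proof.
move=> Hf; exact: (@dual_norm_bound R _ (vH10 Om) (vgrad_norm Om 2) vH10_0 vH10Z
  vgrad_normZ (vgrad_norm_ge0 2) f Hf u).
Qed.

Lemma Hm1_norm_ge0 (g : sfield R -> R) : Hm1 Om g -> 0 <= Hm1_norm Om g.
Proof.
exact: (@dual_norm_ge0 R _ (H10 Om) G H10_0 grad_normZ' (grad_norm_ge0 2) g).
Qed.

Lemma vHm1_norm_ge0 (f : vfield R -> R) : vHm1 Om f -> 0 <= vHm1_norm Om f.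
Proof.
exact: (@dual_norm_ge0 R _ (vH10 Om) (vgrad_norm Om 2) vH10_0 vgrad_normZ
  (vgrad_norm_ge0 2) f).
Qed.

Lemma embedding_Lp q C v : embedding_constant Om q C -> H10 Om v ->
  Lp Om q v /\ Lnrm Om q v <= C * G v.
Proof.
move=> E Hv; have le := E v Hv; have L : Lp Om q v.
  apply/(LpP mO); split; first exact: (Lp_mf mO (H10_W1p Hv).1).
  by apply: le_lt_trans le _; rewrite ltey.
by split => //; rewrite -lee_fin -LnrmE.
Qed.

(** The embedding takes the place of a Poincare inequality. *)
Lemma grad_norm_eq0 q C v : 0 < q -> embedding_constant Om q C -> H10 Om v ->
  G v = 0 -> {ae mu, forall x, Om x -> v x = 0}.
Proof.
move=> q0 E Hv Gv; have [L le] := embedding_Lp E Hv.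
apply: (Lnrm_eq0 mO q0 L); apply/eqP; rewrite eq_le Lnrm_ge0 andbT.
by rewrite Gv mulr0 in le.
Qed.

End Sobolev.

(** * The convection term *)

Section Arithmetic.
Variable R : realType.
Implicit Types a b c e g h k m n t x : R.

Lemma ler_mul_sqr a b c g h : 0 <= a -> 0 <= b -> a <= c * g -> b <= c * h ->
  a * b <= c ^+ 2 * (g * h).
Proof. by move=> a0 b0 ag bh; rewrite expr2 mulrACA; exact: ler_pM. Qed.

Lemma ler_chain_adv x m n a g c u w : x <= m -> m <= n -> n <= a * g ->
  a <= c * u * w -> 0 <= g -> x <= c * u * g * w.
Proof.
move=> xm mn nag ac g0; apply: le_trans xm (le_trans mn (le_trans nag _)).
by rewrite mulrAC; exact: ler_wpM2r.
Qed.

Lemma ler_chain_eps x n m g e : x <= n * m -> n <= g -> g < e -> 0 <= m -> x <= m * e.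
Proof.
move=> xn ng ge m0; apply: le_trans xn _; rewrite mulrC; apply: ler_wpM2l => //.
exact: le_trans ng (ltW ge).
Qed.

(** Two terms of first order and one of second order in the error d, which is at
   most 1. *)
Lemma ler_norm_trilinear a b c k g d e : `|a| <= k * g * d -> `|b| <= k * d * g ->
  `|c| <= k * d * d -> 0 <= k -> 0 <= g -> 0 <= d -> d < e -> e <= 1 ->
  `|a + b - c| <= k * (2 * g + 1) * e.
Proof.
move=> ha hb hc k0 g0 d0 de e1; apply: le_trans (ler_normB _ _) _.
apply: le_trans (lerD (le_trans (ler_normD _ _) (lerD ha hb)) hc) _.
have -> : k * g * d + k * d * g + k * d * d = k * ((2 * g + d) * d) by ring.
by rewrite -mulrA ler_wpM2l// ler_pM//; lra.
Qed.

Lemma double_eq0 x : 2 * x = 0 -> x = 0.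
Proof. lra. Qed.

End Arithmetic.

Section Convection.
Variables (R : realType) (Om : set (R * R)) (C4 : R).
Hypotheses (oO : open Om) (fO : (leb2 R Om < +oo)%E)
  (E4 : embedding_constant Om 4 C4).
Let mO := measurable_open_plane oO.
Implicit Types (v w phi q : sfield R) (u : vfield R).
Local Notation mu := (leb2 R).
Local Notation wp := (weak_partial Om).
Local Notation G := (grad_norm Om 2).
Local Notation VG := (vgrad_norm Om 2).
Let one2 : (1 : R) <= 2. Proof. lra. Qed.
Let zero2 : (0 : R) < 2. Proof. lra. Qed.
Let zero4 : (0 : R) < 4. Proof. lra. Qed.
Let inv442 : (4 : R)^-1 + 4^-1 = 2^-1. Proof. lra. Qed.

Lemma H10_mulL2 v w : H10 Om v -> H10 Om w ->
  Lp Om 2 (fun x => v x * w x) /\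
  Lnrm Om 2 (fun x => v x * w x) <= C4 ^+ 2 * (G v * G w).
Proof.
move=> Hv Hw; have [Lv Nv] := embedding_Lp oO E4 Hv; have [Lw Nw] := embedding_Lp oO E4 Hw.
have [L N] := hoelder_Lp mO zero4 zero4 zero2 inv442 Lv Lw.
split; first exact: L.
exact: le_trans N (ler_mul_sqr (Lnrm_ge0 _ _ _) (Lnrm_ge0 _ _ _) Nv Nw).
Qed.

(** Cauchy and Schwarz for the gradient of v against the field with the components
   u_i w. The components are estimated separately in L2 and their squares added,
   so the constant of the scalar embedding serves for vector fields. *)
Lemma adv_bound u v w : vH10 Om u -> W1p Om 2 v -> H10 Om w ->
  Lp Om 1 (fun x => adv Om u v x * w x) /\
  `|integ Om (fun x => adv Om u v x * w x)| <= C4 ^+ 2 * VG u * G v * G w.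
Proof.
move=> Hu Wv Hw.
pose A x := enrm (fun i => u i x * w x).
have LA : Lp Om 2 A.
  by apply: (Lp_enrm (F := fun i x => u i x * w x) mO one2) => i; exact: (H10_mulL2 (Hu i) Hw).1.
have NA : Lnrm Om 2 A <= C4 ^+ 2 * VG u * G w.
  have Vge := vgrad_norm_ge0 Om 2 u; have Gge := grad_norm_ge0 Om 2 w.
  have Cge := sqr_ge0 C4.
  have P t : 0 <= t -> 0 <= C4 ^+ 2 * t * G w.
    by move=> t0; apply: mulr_ge0 => //; exact: mulr_ge0.
  rewrite -ler_sqr ?nnegrE ?Lnrm_ge0 ?P//.
  rewrite (Lnrm_enrm_sqr (F := fun i x => u i x * w x) mO) => [|i]; last exact: (H10_mulL2 (Hu i) Hw).1.
  rewrite !exprMn (vgrad_norm_sqr oO (vH10_vW1p Hu)) mulr_sumr mulr_suml.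
  apply: ler_sum => i _; rewrite -!exprMn ler_sqr ?nnegrE ?Lnrm_ge0 ?P ?grad_norm_ge0//.
  by rewrite -mulrA; exact: (H10_mulL2 (Hu i) Hw).2.
have Lg := grad_abs_Lp oO one2 Wv.
have [LAg NAg] := cauchy_schwarz_Lp mO LA Lg.
have madv : measurable_fun (Om : set (plane R)) (fun x => adv Om u v x * w x).
  apply: measurable_funM; last exact: (Lp_mf mO (H10_W1p Hw).1).
  apply: measurable_sum => j; apply: measurable_funM.
    exact: (Lp_mf mO (H10_W1p (Hu j)).1).
  exact: (Lp_mf mO (W1p_partial oO zero2 Wv j).2).
have dom : {ae mu, forall x, Om x ->
    `|adv Om u v x * w x| <= `|A x * grad_abs Om v x|}.
  apply: aeW => x _; rewrite [leRHS]ger0_norm ?mulr_ge0 ?enrm_ge0 ?sqrtr_ge0//.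
  apply: le_trans (cauchy_schwarz_sum _ _).
  by rewrite /adv mulr_suml; under eq_bigr do rewrite mulrAC.
have [L N] := le_Lp mO ltr01 madv LAg dom.
split; first exact: L.
exact: ler_chain_adv (integ_le_Lnrm mO L) N NAg NA (Lnrm_ge0 _ _ _).
Qed.

(** Density arguments produce bounds for small errors only, here at most 1, where
   squares of the error are absorbed by the error. *)
Lemma eq0_le_eps (x M : R) : (forall e, 0 < e -> e <= 1 -> `|x| <= M * e) -> x = 0.
Proof.
move=> H; apply/eqP; rewrite -normr_le0; apply/ler_addgt0Pr => e e0; rewrite add0r.
pose d := Num.min 1 (e / (`|M| + 1)).
have M1 : 0 < `|M| + 1 by rewrite ltr_wpDl.
have d0 : 0 < d by rewrite lt_min ltr01 divr_gt0.
apply: le_trans (H d d0 _) _; first by rewrite ge_min lexx.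
apply: le_trans (_ : (`|M| + 1) * d <= _).
  by rewrite ler_wpM2r ?(ltW d0)//; have := ler_norm M; lra.
by rewrite mulrC -ler_pdivlMr// ge_min lexx orbT.
Qed.

(** True for test functions by integration by parts, and continuous in the norm of
   the gradient because the measure of the domain is finite. *)
Lemma integ_partial_H10 j v : H10 Om v -> integ Om (wp j v) = 0.
Proof.
move=> Hv; have Wv := H10_W1p Hv; have [_ Lj] := W1p_partial oO zero2 Wv j.
pose M := Lnrm Om 2 (cst 1 : sfield R).
have L1 := Lp_cst mO 1 fO zero2.
have L21 w : Lp Om 2 w -> Lp Om 1 w /\ `|integ Om w| <= Lnrm Om 2 w * M.
  move=> Lw; have [L N] := cauchy_schwarz_Lp mO Lw L1.
  rewrite (_ : (fun x => w x * _) = w) in L N; last by apply/funext => x; rewrite mulr1.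
  by split => //; apply: le_trans (integ_le_Lnrm mO L) N.
apply: (@eq0_le_eps _ M) => e e0 _.
have [phi [tp Wp _ Ge]] := H10_approx oO fO Hv e0.
have [Wphi wphi] := test_W1p oO fO zero2 tp.
have [_ Ljp] := W1p_partial oO zero2 Wphi j.
have I0 : integ Om (wp j phi) = 0.
  rewrite -(integ_partial_test j tp); apply: (ae_eq_integ mO) => //.
    exact: (Lp_mf mO Ljp).
  apply: measurable_funTS; apply: continuous_measurable_plane.
  exact: smooth_continuous (smooth_partial j (test_smooth tp)).
have Hphi := test_H10 oO fO tp.
have E : integ Om (wp j v) = integ Om (wp j (v \- phi)).
  have := integB mO (L21 _ Lj).1 (L21 _ Ljp).1; rewrite I0 subr0 => <-.
  apply/esym/(ae_eq_integ mO).
  - exact: (Lp_mf mO (W1p_partial oO zero2 Wp j).2).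
  - by apply: measurable_funB; [exact: (Lp_mf mO Lj)|exact: (Lp_mf mO Ljp)].
  - exact: (partialB oO j Hv Hphi).
rewrite E; apply: ler_chain_eps (L21 _ (W1p_partial oO zero2 Wp j).2).2 _ Ge _.
  exact: (Lnrm_partial_le oO).
exact: Lnrm_ge0.
Qed.

Lemma div_L2 u : vH10 Om u -> Lp Om 2 (div Om u).
Proof.
move=> Hu; apply: (Lp_sum mO _ (F := fun i => wp i (u i))) => // i.
exact: (W1p_partial oO zero2 (H10_W1p (Hu i)) i).2.
Qed.

Lemma L2_L1 w : Lp Om 2 w -> Lp Om 1 w.
Proof.
move=> Lw; have [L N] := cauchy_schwarz_Lp mO Lw (Lp_cst mO 1 fO zero2).
by rewrite (_ : (fun x => w x * _) = w) in L => //; apply/funext => x; rewrite mulr1.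
Qed.

Lemma integ_div u : vH10 Om u -> integ Om (div Om u) = 0.
Proof.
move=> Hu; rewrite (integ_sum mO _ (F := fun i => wp i (u i))) => [|i].
  by rewrite big1// => i _; exact: integ_partial_H10.
by apply: L2_L1; exact: (W1p_partial oO zero2 (H10_W1p (Hu i)) i).2.
Qed.

(** The zero mean of the test pressures is no restriction, because the
   divergence has zero mean. *)
Lemma integ_mul_div q u : vH10 Om u -> Om !=set0 ->
  (forall q, L20 Om q -> integ Om (fun x => q x * div Om u x) = 0) ->
  Lp Om 2 q -> integ Om (fun x => q x * div Om u x) = 0.
Proof.
move=> Hu [x0 Ox0] Hdiv Lq.
have mu0 : fine (mu Om) != 0.
  rewrite gt_eqF// fine_gt0// fO andbT; exact: open_measure_gt0 Ox0.
pose m := integ Om q / fine (mu Om).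
have Lm := Lp_cst mO m fO zero2.
have L0 : L20 Om (fun x => q x - m).
  split; first exact: (LpB mO one2 Lq Lm).1.
  rewrite (integB mO (L2_L1 Lq) (L2_L1 Lm)) [X in _ - X]Rintegral_cst//.
  by rewrite /m divfK// subrr.
have := Hdiv _ L0; have Ld := div_L2 Hu.
have -> : (fun x => (q x - m) * div Om u x) = (fun x => q x * div Om u x - m * div Om u x).
  by apply/funext => x; rewrite mulrBl.
rewrite (integB mO (cauchy_schwarz_Lp mO Lq Ld).1 (LpZ mO m ltr01 (L2_L1 Ld)).1).
by rewrite (integZ mO m (L2_L1 Ld)) (integ_div Hu) mulr0 subr0.
Qed.

(** The integrand is half the derivative of phi^2 along u. Integrating by parts
   moves the derivative to u, where the divergence appears; the product phi^2 is
   itself a test function. *)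
Lemma skew_test u phi : vH10 Om u -> Om !=set0 ->
  (forall q, L20 Om q -> integ Om (fun x => q x * div Om u x) = 0) ->
  test_function Om phi -> integ Om (fun x => adv Om u phi x * phi x) = 0.
Proof.
move=> Hu nO Hdiv tp; have sp := test_smooth tp.
have tpp := testM sp tp.
have Hphi := test_H10 oO fO tp.
have [Wphi wphi] := test_W1p oO fO zero2 tp.
have Du j : integ Om (fun x => u j x * 'D_(basis2 R j) (phi \* phi) x) =
    - integ Om (fun x => wp j (u j) x * (phi \* phi) x).
  have [[_ _ H] _] := W1p_partial oO zero2 (H10_W1p (Hu j)) j; exact: H.
have Lpp := test_Lp oO fO zero2 tpp.
have D0 : \sum_j integ Om (fun x => u j x * 'D_(basis2 R j) (phi \* phi) x) = 0.
  under eq_bigr do rewrite Du.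
  rewrite sumrN; apply/eqP; rewrite oppr_eq0; apply/eqP.
  rewrite -(integ_sum mO _ (F := fun j x => wp j (u j) x * (phi \* phi) x)) => [|j].
    rewrite -[RHS](integ_mul_div Hu nO Hdiv Lpp); congr integ.
    by apply/funext => x; rewrite /div mulr_sumr; apply: eq_bigr => j _; rewrite mulrC.
  by have [+ _] := cauchy_schwarz_Lp mO (W1p_partial oO zero2 (H10_W1p (Hu j)) j).2 Lpp.
have LD j : Lp Om 1 (fun x => u j x * 'D_(basis2 R j) (phi \* phi) x).
  by have [+ _] := cauchy_schwarz_Lp mO (H10_W1p (Hu j)).1
    (test_Lp oO fO zero2 (test_partial j tpp)).
have [La _] := adv_bound Hu Wphi Hphi.
apply: double_eq0.
rewrite -(integZ mO 2 La) -[RHS]D0 -(integ_sum mO _ LD).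
apply: (ae_eq_integ mO).
- exact: (Lp_mf mO (LpZ mO 2 ltr01 La).1).
- by apply: measurable_sum => j; exact: (Lp_mf mO (LD j)).
- move: (wphi 0) (wphi 1); apply: filterS2 => x w0 w1 Ox.
  rewrite /adv mulr_suml mulr_sumr; apply: eq_bigr => j _.
  rewrite (partialM _ _ sp sp).
  have -> : wp j phi x = 'D_(basis2 R j) phi x.
    by have [->|->] := ord2_cases j; rewrite ?w0 ?w1.
  by ring.
Qed.

(** Extends [skew_test] by density: replacing v by a test function changes the
   form by terms that contain the error at least once. *)
Lemma skew_adv u v : vH10 Om u -> Om !=set0 ->
  (forall q, L20 Om q -> integ Om (fun x => q x * div Om u x) = 0) ->
  H10 Om v -> integ Om (fun x => adv Om u v x * v x) = 0.
Proof.
move=> Hu nO Hdiv Hv; have Wv := H10_W1p Hv.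
pose K := C4 ^+ 2 * VG u; have K0 : 0 <= K by apply: mulr_ge0; [exact: sqr_ge0|exact: vgrad_norm_ge0].
apply: (@eq0_le_eps _ (K * (2 * G v + 1))) => e e0 e1.
have [phi [tp Wp _ Ge]] := H10_approx oO fO Hv e0.
have Hphi := test_H10 oO fO tp; have Wphi := H10_W1p Hphi.
have Hd := H10B oO fO Hv Hphi; set d := v \- phi in Wp Ge Hd.
have [L1 B1] := adv_bound Hu Wv Hd.
have [L2 B2] := adv_bound Hu Wp Hv.
have [L3 B3] := adv_bound Hu Wp Hd.
have [L4 _] := adv_bound Hu Wphi Hphi.
have [Lv _] := adv_bound Hu Wv Hv.
(* With phi = v - d, the form at (phi, phi) vanishes, and expanding it leaves the
   three terms in which d occurs. *)
have E : integ Om (fun x => adv Om u v x * v x) =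
    integ Om (fun x => adv Om u v x * d x) + integ Om (fun x => adv Om u d x * v x)
    - integ Om (fun x => adv Om u d x * d x).
  rewrite -(integD mO L1 L2) -(integB mO (LpD mO (lexx 1) L1 L2).1 L3).
  rewrite -[LHS]subr0 -(skew_test Hu nO Hdiv tp) -(integB mO Lv L4).
  have L12 := (LpB mO (lexx 1) (LpD mO (lexx 1) L1 L2).1 L3).1.
  apply: (ae_eq_integ mO).
  - exact: (Lp_mf mO (LpB mO (lexx 1) Lv L4).1).
  - exact: (Lp_mf mO L12).
  - move: (partialB oO 0 Hv Hphi) (partialB oO 1 Hv Hphi); apply: filterS2 => x p0 p1 Ox.
    rewrite /= /adv; have -> : \sum_j u j x * wp j d x =
        \sum_j u j x * wp j v x - \sum_j u j x * wp j phi x.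
      rewrite -sumrB; apply: eq_bigr => j _; rewrite -mulrBr.
      by have [->|->] := ord2_cases j; rewrite ?p0 ?p1.
    by rewrite /d /=; ring.
have Gd0 := grad_norm_ge0 Om 2 d; have Gv0 := grad_norm_ge0 Om 2 v.
rewrite E; exact: ler_norm_trilinear B1 B2 B3 K0 Gv0 Gd0 Ge e1.
Qed.

End Convection.

(** * Nonlinear coefficients and damping *)

Section Nonlinearities.
Variables (R : realType) (Om : set (R * R)).
Hypotheses (oO : open Om) (fO : (leb2 R Om < +oo)%E).
Let mO := measurable_open_plane oO.
Implicit Types (v w T D A B : sfield R) (u : vfield R).
Local Notation mu := (leb2 R).
Local Notation wp := (weak_partial Om).
Local Notation G := (grad_norm Om 2).
Local Notation VG := (vgrad_norm Om 2).
Local Notation mf v := (measurable_fun (Om : set (plane R)) v).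
Let one2 : (1 : R) <= 2. Proof. lra. Qed.
Let zero2 : (0 : R) < 2. Proof. lra. Qed.

Lemma lipschitz_le (k : R) (h : R -> R) x y : k.-lipschitz h ->
  `|h x - h y| <= k * `|x - y|.
Proof. by move=> H; have := H (x, y) (conj I I). Qed.

Lemma lipschitz_ge0 (k : R) (h : R -> R) : k.-lipschitz h -> 0 <= k.
Proof.
move=> /(lipschitz_le 1 0); rewrite subr0 normr1 mulr1; exact: le_trans.
Qed.

Lemma lipschitz_continuous (k : R) (h : R -> R) : k.-lipschitz h -> continuous h.
Proof.
move=> H x; have k0 := lipschitz_ge0 H.
apply/cvgrPdist_lt => e e0; near=> y.
apply: le_lt_trans (lipschitz_le x y H) _.
apply: le_lt_trans (_ : (k + 1) * `|x - y| < e); first by rewrite ler_wpM2r// lerDl.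
rewrite -ltr_pdivlMl ?ltr_wpDl//; near: y.
have d0 : 0 < (k + 1)^-1 * e by rewrite mulr_gt0// invr_gt0 ltr_wpDl.
exact: (@nbhsx_ballx _ R x _ d0).
Unshelve. all: by end_near. Qed.

Lemma coef_measurable (h : R -> R) T : continuous h -> mf T -> mf (fun x => h (T x)).
Proof.
move=> ch mT; apply: (measurableT_comp (continuous_measurable_fun ch)) => //.
Qed.

Lemma coef_Lp (h : R -> R) (C : R) T D : continuous h -> (forall r, `|h r| <= C) ->
  mf T -> Lp Om 1 D -> Lp Om 1 (fun x => h (T x) * D x).
Proof.
move=> ch hC mT LD.
have dom : {ae mu, forall x, Om x -> `|h (T x) * D x| <= `|C * D x|}.
  apply: aeW => x _; rewrite !normrM ler_wpM2r//.
  by apply: le_trans (hC _) (ler_norm _).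
have md : mf (fun x => h (T x) * D x).
  by apply: measurable_funM; [exact: coef_measurable|exact: (Lp_mf mO LD)].
exact: (le_Lp mO ltr01 md (LpZ mO C ltr01 LD).1 dom).1.
Qed.

(** Lipschitz continuity turns the difference of the coefficients into T1 - T2, and
   the three factors are distributed over the exponents q, r and 2. *)
Lemma coef_diff_bound (h : R -> R) (k q r : R) T1 T2 D A B :
  k.-lipschitz h -> 0 < q -> 0 < r -> q^-1 + r^-1 = 2^-1 ->
  mf T1 -> mf T2 -> mf D -> Lp Om q (T1 \- T2) -> Lp Om r A -> Lp Om 2 B ->
  (forall x, Om x -> `|D x| <= A x * B x) ->
  Lp Om 1 (fun x => (h (T1 x) - h (T2 x)) * D x) /\
  `|integ Om (fun x => (h (T1 x) - h (T2 x)) * D x)| <=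
    k * Lnrm Om q (T1 \- T2) * Lnrm Om r A * Lnrm Om 2 B.
Proof.
move=> Lh q0 r0 qr m1 m2 mD LS LA LB DAB; have ch := lipschitz_continuous Lh.
have k0 := lipschitz_ge0 Lh.
have [L1 N1] := hoelder_Lp mO q0 r0 zero2 qr LS LA.
have [L2 N2] := cauchy_schwarz_Lp mO L1 LB.
have [L3 N3] := LpZ mO k ltr01 L2.
have md : mf (fun x => (h (T1 x) - h (T2 x)) * D x).
  by apply: measurable_funM => //; apply: measurable_funB; exact: coef_measurable.
have dom : {ae mu, forall x, Om x -> `|(h (T1 x) - h (T2 x)) * D x| <=
    `|k * ((T1 \- T2) x * A x * B x)|}.
  apply: aeW => x Ox; have AB0 : 0 <= A x * B x by apply: le_trans (DAB x Ox).
  rewrite !normrM -(mulrA `|(T1 \- T2) x|) -(normrM (A x)) (ger0_norm AB0) (ger0_norm k0) mulrA.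
  by apply: ler_pM => //; [exact: lipschitz_le|exact: DAB].
have [L N] := le_Lp mO ltr01 md L3 dom.
split => //; apply: le_trans (integ_le_Lnrm mO L) _; apply: le_trans N _.
rewrite N3 (ger0_norm k0) -!mulrA ler_wpM2l// mulrA.
by apply: le_trans N2 _; rewrite ler_wpM2r// Lnrm_ge0.
Qed.

(** By Cauchy and Schwarz the mixed products are largest for parallel vectors, so
   only the monotonicity of t^(r+1) on the half line is left. *)
Lemma power_monotone (I : finType) (r : R) (a b : I -> R) : 0 < r ->
  0 <= \sum_i (enrm a `^ r * a i - enrm b `^ r * b i) * (a i - b i).
Proof.
move=> r0; have -> : \sum_i (enrm a `^ r * a i - enrm b `^ r * b i) * (a i - b i) =
   enrm a `^ r * enrm a ^+ 2 + enrm b `^ r * enrm b ^+ 2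
   - (enrm a `^ r + enrm b `^ r) * \sum_i a i * b i.
  rewrite !enrm_sqr !mulr_sumr -big_split/= -sumrB; apply: eq_bigr => i _; ring.
have := cauchy_schwarz_sum a b; have := enrm_ge0 a; have := enrm_ge0 b.
have mono (x y : R) : 0 <= x -> 0 <= y -> 0 <= (x `^ r * x - y `^ r * y) * (x - y).
  move=> x0 y0; have [xy|/ltW xy] := leP x y.
    rewrite mulr_le0// ?subr_le0//; apply: ler_pM => //; rewrite ?powR_ge0//.
    by apply: ge0_ler_powR; rewrite ?nnegrE// ltW.
  rewrite mulr_ge0// ?subr_ge0//; apply: ler_pM => //; rewrite ?powR_ge0//.
  by apply: ge0_ler_powR; rewrite ?nnegrE// ltW.
move: (\sum_i a i * b i) (enrm a) (enrm b) => C x y y0 x0 CS.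
have := mono x y x0 y0; have := ler_norm C.
have := powR_ge0 x r; have := powR_ge0 y r.
move: (x `^ r) (y `^ r) => X Y Y0 X0 C1 M.
have CXY : (X + Y) * C <= (X + Y) * (x * y).
  by apply: ler_wpM2l; [exact: addr_ge0|exact: le_trans CS].
have E : (X * x - Y * y) * (x - y) = X * x ^+ 2 + Y * y ^+ 2 - (X + Y) * (x * y) by ring.
by rewrite E in M; lra.
Qed.

(** The exponent s - 2 is at most 2, so the power is bounded by 1 + |u|^2, and four
   factors in L4 have an integrable product. *)
Lemma power_Lp (C4 s : R) (u v : vfield R) : embedding_constant Om 4 C4 -> 3 <= s <= 4 ->
  vH10 Om u -> vH10 Om v ->
  Lp Om 1 (fun x => vabs u x `^ (s - 2) * vdot u v x).
Proof.
move=> E4 /andP[s3 s4] Hu Hv.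
have Luv : Lp Om 1 (fun x => \sum_i `|u i x * v i x|).
  apply: (Lp_sum mO _ (F := fun i x => `|u i x * v i x|)) => // i.
  by apply: (Lp_norm mO ltr01); exact: (cauchy_schwarz_Lp mO (H10_W1p (Hu i)).1 (H10_W1p (Hv i)).1).1.
have LQ : Lp Om 1 (fun x => \sum_i \sum_k `|u k x * u i x * (u k x * v i x)|).
  apply: (Lp_sum mO _ (F := fun i x => \sum_k `|u k x * u i x * (u k x * v i x)|)) => // i.
  apply: (Lp_sum mO _ (F := fun k x => `|u k x * u i x * (u k x * v i x)|)) => // k.
  apply: (Lp_norm mO ltr01); apply: (cauchy_schwarz_Lp mO _ _).1.
    exact: (H10_mulL2 oO E4 (Hu k) (Hu i)).1.
  exact: (H10_mulL2 oO E4 (Hu k) (Hv i)).1.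
have [LS _] := LpD mO (lexx 1) Luv LQ.
have mu_ (w : vfield R) : vH10 Om w -> forall i, mf (w i).
  by move=> Hw i; exact: (Lp_mf mO (H10_W1p (Hw i)).1).
have md : mf (fun x => vabs u x `^ (s - 2) * vdot u v x).
  apply: measurable_funM; last by apply: measurable_sum => i; apply: measurable_funM; exact: mu_.
  apply: (measurableT_comp (measurable_powR _)) => //.
  by apply: (measurable_enrm (F := u)); exact: mu_.
have dom : {ae mu, forall x, Om x -> `|vabs u x `^ (s - 2) * vdot u v x| <=
    `|(\sum_i `|u i x * v i x|) + \sum_i \sum_k `|u k x * u i x * (u k x * v i x)| |}.
  apply: aeW => x _; rewrite [leRHS]ger0_norm; last first.
    by apply: addr_ge0; apply: sumr_ge0 => // i _; apply: sumr_ge0.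
  rewrite normrM (ger0_norm (powR_ge0 _ _)).
  have a0 : 0 <= vabs u x by exact: sqrtr_ge0.
  (* Below 1 the power is at most 1, above 1 it is at most the square. *)
  have le1 : vabs u x `^ (s - 2) <= 1 + \sum_k u k x ^+ 2.
    have -> : \sum_k u k x ^+ 2 = vabs u x ^+ 2 by rewrite -(enrm_sqr (u ^~ x)).
    move: (vabs u x) a0 => a a0.
    have [a1|a1] := leP a 1.
      apply: le_trans (_ : 1 <= _); last by rewrite lerDl sqr_ge0.
      apply: le_trans (_ : 1 `^ (s - 2) <= _); last by rewrite powR1.
      by apply: ge0_ler_powR; rewrite ?nnegrE//; lra.
    apply: le_trans (_ : a `^ 2 <= _).
      by apply: ler_powR; [exact: ltW|lra].
    by rewrite powR_mulrn// lerDr.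
  apply: le_trans (ler_wpM2r (normr_ge0 _) le1) _.
  rewrite mulrDl mul1r; have n1 := ler_norm_sum (index_enum 'I_2) (fun i => u i x * v i x) xpredT.
  apply: lerD; first exact: n1.
  apply: le_trans (ler_wpM2l (sum_sqr_ge0 _) n1) _.
  rewrite mulr_sumr; apply: ler_sum => i _; rewrite mulr_suml; apply: ler_sum => k _.
  rewrite (_ : u k x * u i x * _ = u k x ^+ 2 * (u i x * v i x)); last by ring.
  by rewrite [leRHS]normrM (ger0_norm (sqr_ge0 _)).
exact: (le_Lp mO ltr01 md LS dom).1.
Qed.

End Nonlinearities.

(** * Energy estimates *)

Section Balance.
Variable R : realType.

Lemma energy_balance (a c d X Y t : R) : a + 0 + c + d - 0 = t -> X <= a ->
  0 <= c -> 0 <= d -> t <= Y -> X <= Y.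
Proof. lra. Qed.

Lemma coef_balance (a b c d e : R) : d = a - e -> c = e - b -> a - b = c + d.
Proof. lra. Qed.

Lemma heat_balance (a1 a2 b1 b2 c d e X k n t : R) : a1 + b1 = t -> a2 + b2 = t ->
  a1 - a2 = c + d -> b1 - b2 = e -> X <= c -> - k <= d -> - n <= e -> X <= k + n.
Proof. lra. Qed.

(** The equations of two solutions, term by term: a is diffusion, b convection,
   c1 and c2 the linear term, d1 and d2 the damping. The variation of the
   coefficient is d, and e is the convection by the difference. *)
Lemma momentum_balance (a1 a2 b1 b2 c1 c2 d1 d2 d e X k n t : R) :
  a1 + b1 + c1 + d1 - 0 = t -> a2 + b2 + c2 + d2 - 0 = t ->
  X + d <= a1 - a2 -> b1 - b2 = e -> 0 <= c1 - c2 -> 0 <= d1 - d2 ->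
  - k <= d -> - n <= e -> X <= k + n.
Proof. lra. Qed.

End Balance.

Section Estimates.
Variables (R : realType) (Om : set (R * R)) (C4 : R).
Hypotheses (oO : open Om) (nO : Om !=set0) (fO : (leb2 R Om < +oo)%E)
  (E4 : embedding_constant Om 4 C4).
Let mO := measurable_open_plane oO.
Implicit Types (v w T q : sfield R) (u : vfield R) (h : R -> R).
Local Notation mu := (leb2 R).
Local Notation wp := (weak_partial Om).
Local Notation G := (grad_norm Om 2).
Local Notation VG := (vgrad_norm Om 2).
Local Notation mf v := (measurable_fun (Om : set (plane R)) v).
Let one2 : (1 : R) <= 2. Proof. lra. Qed.
Let zero2 : (0 : R) < 2. Proof. lra. Qed.

Definition vsub u1 u2 : vfield R := fun i => u1 i \- u2 i.

Lemma vH10B u1 u2 : vH10 Om u1 -> vH10 Om u2 -> vH10 Om (vsub u1 u2).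
Proof. by move=> H1 H2 i; exact: (H10B oO fO (H1 i) (H2 i)). Qed.

Lemma partial_mf j v : W1p Om 2 v -> mf (wp j v).
Proof. by move=> Wv; exact: (Lp_mf mO (W1p_partial oO zero2 Wv j).2). Qed.

Lemma grad_dot_mf v w : W1p Om 2 v -> W1p Om 2 w -> mf (grad_dot Om v w).
Proof.
by move=> Wv Ww; apply: measurable_sum => j; apply: measurable_funM; exact: partial_mf.
Qed.

Lemma vgrad_dot_mf u1 u2 : vH10 Om u1 -> vH10 Om u2 -> mf (vgrad_dot Om u1 u2).
Proof.
move=> H1 H2; apply: (measurable_sum _ (h := fun i x => grad_dot Om (u1 i) (u2 i) x)) => i.
exact: (grad_dot_mf (H10_W1p (H1 i)) (H10_W1p (H2 i))).
Qed.

Lemma grad_dot_le v w x : `|grad_dot Om v w x| <= grad_abs Om v x * grad_abs Om w x.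
Proof. exact: cauchy_schwarz_sum. Qed.

Lemma vgrad_dot_le u1 u2 x :
  `|vgrad_dot Om u1 u2 x| <= vgrad_abs Om u1 x * vgrad_abs Om u2 x.
Proof.
rewrite !vgrad_absE /vgrad_dot /grad_dot pair_big/=.
exact: (cauchy_schwarz_sum (fun ij : 'I_2 * 'I_2 => wp ij.2 (u1 ij.1) x)).
Qed.

Lemma grad_dot_Lp v w : W1p Om 2 v -> W1p Om 2 w -> Lp Om 1 (grad_dot Om v w).
Proof.
move=> Wv Ww; apply: (Lp_sum mO _ (F := fun j x => wp j v x * wp j w x)) => // j.
exact: (cauchy_schwarz_Lp mO (W1p_partial oO zero2 Wv j).2 (W1p_partial oO zero2 Ww j).2).1.
Qed.

Lemma integ_grad_dot v : W1p Om 2 v -> integ Om (grad_dot Om v v) = G v ^+ 2.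
Proof.
move=> Wv; rewrite (Lnrm2_sqr mO (grad_abs_Lp oO one2 Wv)); congr integ.
by apply/funext => x; rewrite /grad_abs sqr_sqrtr ?sum_sqr_ge0.
Qed.

Lemma div_partialB u1 u2 : vH10 Om u1 -> vH10 Om u2 ->
  {ae mu, forall x, Om x -> div Om (vsub u1 u2) x = div Om u1 x - div Om u2 x}.
Proof.
move=> H1 H2; move: (partialB oO 0 (H1 0) (H2 0)) (partialB oO 1 (H1 1) (H2 1)).
apply: filterS2 => x d0 d1 Ox; rewrite /div -sumrB; apply: eq_bigr => i _.
by have [->|->] := ord2_cases i; rewrite ?d0 ?d1.
Qed.

Lemma integ_pressure_sub q u1 u2 : Lp Om 2 q -> vH10 Om u1 -> vH10 Om u2 ->
  integ Om (fun x => q x * div Om u1 x) = 0 ->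
  integ Om (fun x => q x * div Om u2 x) = 0 ->
  integ Om (fun x => q x * div Om (vsub u1 u2) x) = 0.
Proof.
move=> Lq H1 H2 D1 D2.
have L u : vH10 Om u -> Lp Om 1 (fun x => q x * div Om u x).
  by move=> Hu; exact: (cauchy_schwarz_Lp mO Lq (div_L2 oO Hu)).1.
have <- : integ Om (fun x => q x * div Om u1 x) - integ Om (fun x => q x * div Om u2 x) = 0.
  by rewrite D1 D2 subrr.
rewrite -(integB mO (L _ H1) (L _ H2)); apply: (ae_eq_integ mO).
- exact: (Lp_mf mO (L _ (vH10B H1 H2))).
- exact: (Lp_mf mO (LpB mO (lexx 1) (L _ H1) (L _ H2)).1).
- by apply: filterS (div_partialB H1 H2) => x H /H ->; rewrite mulrBr.
Qed.

Section Coefficient.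
Variables (h : R -> R) (m M k : R).
Hypotheses (Lh : k.-lipschitz h) (m0 : 0 < m) (hb : forall r, m <= h r <= M).

Let ch := lipschitz_continuous Lh.
Let hM r : `|h r| <= M.
Proof. by have /andP[h1 h2] := hb r; rewrite ger0_norm// (le_trans (ltW m0)). Qed.

Lemma coef_grad_Lp T v w : mf T -> W1p Om 2 v -> W1p Om 2 w ->
  Lp Om 1 (fun x => h (T x) * grad_dot Om v w x).
Proof. by move=> mT Wv Ww; apply: (coef_Lp oO ch hM mT); exact: grad_dot_Lp. Qed.

Lemma coercive T v : mf T -> W1p Om 2 v ->
  m * G v ^+ 2 <= integ Om (fun x => h (T x) * grad_dot Om v v x).
Proof.
move=> mT Wv; have Lg := grad_dot_Lp Wv Wv.
rewrite -integ_grad_dot// -(integZ mO m Lg); apply: (le_integ mO).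
- exact: (LpZ mO m ltr01 Lg).1.
- exact: coef_grad_Lp.
- move=> x _; have /andP[h1 _] := hb (T x); apply: ler_wpM2r => //.
  by apply: sumr_ge0 => j _; rewrite -expr2 sqr_ge0.
Qed.

(** The mixed term h(T2) times the gradient of v1 is added and subtracted: one part
   is coercive, the other contains the difference of the coefficients and the
   gradient of v1, so that only v1 needs a gradient of higher integrability. *)
Lemma coef_split T1 T2 v1 v2 : mf T1 -> mf T2 -> H10 Om v1 -> H10 Om v2 ->
  integ Om (fun x => h (T1 x) * grad_dot Om v1 (v1 \- v2) x)
  - integ Om (fun x => h (T2 x) * grad_dot Om v2 (v1 \- v2) x) =
  integ Om (fun x => h (T2 x) * grad_dot Om (v1 \- v2) (v1 \- v2) x)
  + integ Om (fun x => (h (T1 x) - h (T2 x)) * grad_dot Om v1 (v1 \- v2) x).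
Proof.
move=> mT1 mT2 H1 H2; have Hw := H10B oO fO H1 H2.
set w := v1 \- v2 in Hw *.
have W1 := H10_W1p H1; have W2 := H10_W1p H2; have Ww := H10_W1p Hw.
have L1 := coef_grad_Lp mT1 W1 Ww; have L2 := coef_grad_Lp mT2 W2 Ww.
have L3 := coef_grad_Lp mT2 Ww Ww; have L4 := coef_grad_Lp mT2 W1 Ww.
have E1 : integ Om (fun x => (h (T1 x) - h (T2 x)) * grad_dot Om v1 w x) =
    integ Om (fun x => h (T1 x) * grad_dot Om v1 w x) -
    integ Om (fun x => h (T2 x) * grad_dot Om v1 w x).
  apply: etrans (integB mO L1 L4); congr (integ Om _).
  by apply/funext => x; exact: mulrBl.
have E2 : integ Om (fun x => h (T2 x) * grad_dot Om w w x) =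
    integ Om (fun x => h (T2 x) * grad_dot Om v1 w x) -
    integ Om (fun x => h (T2 x) * grad_dot Om v2 w x).
  apply: etrans (integB mO L4 L2); apply: (ae_eq_integ mO).
  - exact: (Lp_mf mO L3).
  - exact: (Lp_mf mO (LpB mO (lexx 1) L4 L2).1).
  - move: (partialB oO 0 H1 H2) (partialB oO 1 H1 H2); apply: filterS2 => x d0 d1 Ox.
    rewrite -mulrBr -sumrB; congr (_ * _); apply: eq_bigr => j _; rewrite -mulrBl.
    by have [->|->] := ord2_cases j; rewrite /w ?d0 ?d1.
exact: coef_balance E1 E2.
Qed.

End Coefficient.

(** Transport of v1 - v2 by u2 is lost to skew symmetry, so the difference of the
   velocities acts on v1 only. *)
Lemma conv_split u1 u2 v1 v2 : vH10 Om u1 -> vH10 Om u2 -> H10 Om v1 -> H10 Om v2 ->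
  (forall q, L20 Om q -> integ Om (fun x => q x * div Om u2 x) = 0) ->
  integ Om (fun x => adv Om u1 v1 x * (v1 \- v2) x)
  - integ Om (fun x => adv Om u2 v2 x * (v1 \- v2) x) =
  integ Om (fun x => adv Om (vsub u1 u2) v1 x * (v1 \- v2) x).
Proof.
move=> Hu1 Hu2 H1 H2 D2; have Hw := H10B oO fO H1 H2; set w := v1 \- v2 in Hw *.
have HU := vH10B Hu1 Hu2.
have W1 := H10_W1p H1; have W2 := H10_W1p H2; have Ww := H10_W1p Hw.
have [L1 _] := adv_bound oO E4 Hu1 W1 Hw.
have [L2 _] := adv_bound oO E4 Hu2 W2 Hw.
have [L3 _] := adv_bound oO E4 HU W1 Hw.
have [L4 _] := adv_bound oO E4 Hu2 Ww Hw.
rewrite -[RHS]addr0 -(skew_adv oO fO E4 Hu2 nO D2 Hw) -(integD mO L3 L4) -(integB mO L1 L2).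
apply: (ae_eq_integ mO).
- exact: (Lp_mf mO (LpB mO (lexx 1) L1 L2).1).
- exact: (Lp_mf mO (LpD mO (lexx 1) L3 L4).1).
- move: (partialB oO 0 H1 H2) (partialB oO 1 H1 H2); apply: filterS2 => x d0 d1 Ox.
  rewrite -mulrBl -mulrDl; congr (_ * _); rewrite /adv -sumrB -big_split/=.
  apply: eq_bigr => j _; rewrite /vsub/=.
  have -> : wp j w x = wp j v1 x - wp j v2 x.
    by have [->|->] := ord2_cases j; rewrite /w ?d0 ?d1.
  by ring.
Qed.

Section Heat.
Variables (kappa : R -> R) (km kp Lk : R) (g : sfield R -> R).
Hypotheses (LLk : Lk.-lipschitz kappa) (km0 : 0 < km)
  (kb : forall r, km <= kappa r <= kp) (Hg : Hm1 Om g).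

Definition heat_solution u T := [/\ vH10 Om u, H10 Om T,
  forall q, L20 Om q -> integ Om (fun x => q x * div Om u x) = 0 &
  forall S, H10 Om S -> integ Om (fun x => kappa (T x) * grad_dot Om T S x
     + adv Om u T x * S x) = g S].

Lemma heat_integ u T S : heat_solution u T -> H10 Om S ->
  integ Om (fun x => kappa (T x) * grad_dot Om T S x) +
  integ Om (fun x => adv Om u T x * S x) = g S.
Proof.
move=> [Hu HT _ W] HS; rewrite -(W S HS) -integD//.
  apply: (coef_grad_Lp LLk km0 kb); [exact: (Lp_mf mO (H10_W1p HT).1)|exact: H10_W1p..].
exact: (adv_bound oO E4 Hu (H10_W1p HT) HS).1.
Qed.

(** Testing with the temperature itself: transport drops out by skew symmetry. *)
Lemma heat_energy u T : heat_solution u T -> km * G T <= Hm1_norm Om g.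
Proof.
move=> sol; have [Hu HT D _] := sol; have E := heat_integ sol HT.
rewrite (skew_adv oO fO E4 Hu nO D HT) addr0 in E.
have mT : mf T := Lp_mf mO (H10_W1p HT).1.
have := coercive LLk km0 kb mT (H10_W1p HT); rewrite E => C.
have := le_trans C (le_trans (ler_norm _) (Hm1_bound oO fO Hg HT)).
have G0 := grad_norm_ge0 Om 2 T.
have [->|Gn0] := eqVneq (G T) 0; first by move=> _; rewrite mulr0; exact: (Hm1_norm_ge0 oO fO Hg).
by rewrite expr2 mulrA ler_pM2r// lt_neqAle eq_sym Gn0.
Qed.

Lemma heat_difference u1 u2 T1 T2 (q r : R) : heat_solution u1 T1 -> heat_solution u2 T2 ->
  0 < q -> 0 < r -> q^-1 + r^-1 = 2^-1 -> Lp Om q (T1 \- T2) -> Lp Om r (grad_abs Om T1) ->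
  km * G (T1 \- T2) ^+ 2 <=
    Lk * Lnrm Om q (T1 \- T2) * grad_norm Om r T1 * G (T1 \- T2)
    + C4 ^+ 2 * VG (vsub u1 u2) * G T1 * G (T1 \- T2).
Proof.
move=> s1 s2 q0 r0 qr Lq Lr; have [Hu1 HT1 D1 _] := s1; have [Hu2 HT2 D2 _] := s2.
have HS := H10B oO fO HT1 HT2.
have W1 := H10_W1p HT1; have W2 := H10_W1p HT2; have WS := H10_W1p HS.
have m1 : mf T1 := Lp_mf mO W1.1; have m2 : mf T2 := Lp_mf mO W2.1.
have E1 := heat_integ s1 HS; have E2 := heat_integ s2 HS.
have A := coef_split LLk km0 kb m1 m2 HT1 HT2.
have B := conv_split Hu1 Hu2 HT1 HT2 D2.
have C := coercive LLk km0 kb m2 WS.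
have [_ K] := coef_diff_bound oO LLk q0 r0 qr m1 m2 (grad_dot_mf W1 WS) Lq Lr
  (grad_abs_Lp oO one2 WS) (fun x _ => grad_dot_le _ _ x).
have [_ N] := adv_bound oO E4 (vH10B Hu1 Hu2) W1 HS.
rewrite -[Lnrm Om r _]/(grad_norm Om r T1) -[Lnrm Om 2 _]/(G (T1 \- T2)) in K.
move: K N; rewrite !ler_norml => /andP[K _] /andP[N _].
exact: heat_balance E1 E2 A B C K N.
Qed.

End Heat.

Section Momentum.
Variables (nu : R -> R) (num nup Ln s CN : R) (f : vfield R -> R).
Hypotheses (LLn : Ln.-lipschitz nu) (num0 : 0 < num) (s34 : 3 <= s <= 4)
  (nb : forall r, num <= nu r <= nup) (Hf : vHm1 Om f)
  (HCN : convection_constant Om CN).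

Let s2_gt0 : 0 < s - 2.
Proof. by have /andP[s3 _] := s34; rewrite subr_gt0; apply: lt_le_trans s3; rewrite ltr_nat. Qed.

Definition momentum_form u (p T : sfield R) (v : vfield R) (x : R * R) : R :=
  nu (T x) * vgrad_dot Om u v x + vdot (vadv Om u u) v x
    + vdot u v x + vabs u x `^ (s - 2) * vdot u v x - p x * div Om v x.

Definition momentum_solution u (p T : sfield R) := [/\ vH10 Om u, L20 Om p, H10 Om T,
  forall q, L20 Om q -> integ Om (fun x => q x * div Om u x) = 0 &
  forall v : vfield R, vH10 Om v -> integ Om (momentum_form u p T v) = f v].

Lemma vgrad_coef_Lp T u (v : vfield R) : mf T -> vH10 Om u -> vH10 Om v ->
  Lp Om 1 (fun x => nu (T x) * vgrad_dot Om u v x) /\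
  integ Om (fun x => nu (T x) * vgrad_dot Om u v x) =
  \sum_i integ Om (fun x => nu (T x) * grad_dot Om (u i) (v i) x).
Proof.
move=> mT Hu Hv.
have L i : Lp Om 1 (fun x => nu (T x) * grad_dot Om (u i) (v i) x).
  by apply: (coef_grad_Lp LLn num0 nb) => //; exact: H10_W1p.
have E : (fun x => nu (T x) * vgrad_dot Om u v x) =
   (fun x => \sum_i nu (T x) * grad_dot Om (u i) (v i) x).
  by apply/funext => x; rewrite mulr_sumr.
by rewrite E; split; [exact: Lp_sum|exact: integ_sum].
Qed.

Lemma vadv_Lp u (v w : vfield R) : vH10 Om u -> vH10 Om v -> vH10 Om w ->
  Lp Om 1 (vdot (vadv Om u v) w) /\
  integ Om (vdot (vadv Om u v) w) = \sum_i integ Om (fun x => adv Om u (v i) x * w i x).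
Proof.
move=> Hu Hv Hw.
have L i : Lp Om 1 (fun x => adv Om u (v i) x * w i x).
  exact: (adv_bound oO E4 Hu (H10_W1p (Hv i)) (Hw i)).1.
by split; [exact: (Lp_sum mO _ _ L)|exact: (integ_sum mO _ L)].
Qed.

Lemma vdot_Lp u (v : vfield R) : vH10 Om u -> vH10 Om v -> Lp Om 1 (vdot u v).
Proof.
move=> Hu Hv; apply: (Lp_sum mO _ (F := fun i x => u i x * v i x)) => // i.
exact: (cauchy_schwarz_Lp mO (H10_W1p (Hu i)).1 (H10_W1p (Hv i)).1).1.
Qed.

Lemma momentum_integ u p T (v : vfield R) : momentum_solution u p T -> vH10 Om v ->
  integ Om (fun x => nu (T x) * vgrad_dot Om u v x) + integ Om (vdot (vadv Om u u) v)
  + integ Om (vdot u v) + integ Om (fun x => vabs u x `^ (s - 2) * vdot u v x)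
  - integ Om (fun x => p x * div Om v x) = f v.
Proof.
move=> [Hu [Lp2 _] HT _ W] Hv; rewrite -(W v Hv).
have mT : mf T := Lp_mf mO (H10_W1p HT).1.
have L1 := (vgrad_coef_Lp mT Hu Hv).1; have L2 := (vadv_Lp Hu Hu Hv).1.
have L3 := vdot_Lp Hu Hv; have L4 := power_Lp oO E4 s34 Hu Hv.
have L5 := (cauchy_schwarz_Lp mO Lp2 (div_L2 oO Hv)).1.
have L12 := (LpD mO (lexx 1) L1 L2).1; have L123 := (LpD mO (lexx 1) L12 L3).1.
have L1234 := (LpD mO (lexx 1) L123 L4).1.
by rewrite -(integD mO L1 L2) -(integD mO L12 L3) -(integD mO L123 L4) -(integB mO L1234 L5).
Qed.

(** Testing with the velocity itself: convection and pressure drop out, and the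
   two lower order terms are nonnegative. *)
Lemma momentum_energy u p T : momentum_solution u p T -> num * VG u <= vHm1_norm Om f.
Proof.
move=> sol; have [Hu Lp0 HT D _] := sol; have := momentum_integ sol Hu.
have mT : mf T := Lp_mf mO (H10_W1p HT).1.
rewrite (D _ Lp0) (vgrad_coef_Lp mT Hu Hu).2 (vadv_Lp Hu Hu Hu).2.
rewrite [X in _ + X + _ + _ - _]big1 => [|i _]; last exact: (skew_adv oO fO E4 Hu nO D (Hu i)).
have vd x : 0 <= vdot u u x by apply: sumr_ge0 => i _; rewrite -expr2 sqr_ge0.
have I3 : 0 <= integ Om (vdot u u) by apply: Rintegral_ge0 => x _.
have I4 : 0 <= integ Om (fun x => vabs u x `^ (s - 2) * vdot u u x).
  by apply: Rintegral_ge0 => x _; rewrite mulr_ge0 ?powR_ge0.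
have C : num * VG u ^+ 2 <= \sum_i integ Om (fun x => nu (T x) * grad_dot Om (u i) (u i) x).
  rewrite (vgrad_norm_sqr oO (vH10_vW1p Hu)) mulr_sumr; apply: ler_sum => i _.
  exact: (coercive LLn num0 nb mT (H10_W1p (Hu i))).
move=> E; have B := le_trans (ler_norm _) (vHm1_bound oO fO Hf Hu).
have {C E} : num * VG u ^+ 2 <= vHm1_norm Om f * VG u.
  exact: energy_balance E C I3 I4 B.
have V0 := vgrad_norm_ge0 Om 2 u.
have [->|Vn0] := eqVneq (VG u) 0; last first.
  by rewrite expr2 mulrA ler_pM2r// lt_neqAle eq_sym Vn0.
by move=> _; rewrite mulr0; exact: (vHm1_norm_ge0 oO fO Hf).
Qed.

Lemma momentum_difference u1 u2 p1 p2 T1 T2 (q r : R) :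
  momentum_solution u1 p1 T1 -> momentum_solution u2 p2 T2 ->
  0 < q -> 0 < r -> q^-1 + r^-1 = 2^-1 -> Lp Om q (T1 \- T2) -> Lp Om r (vgrad_abs Om u1) ->
  num * VG (vsub u1 u2) ^+ 2 <=
    Ln * Lnrm Om q (T1 \- T2) * vgrad_norm Om r u1 * VG (vsub u1 u2)
    + CN * VG (vsub u1 u2) * VG u1 * VG (vsub u1 u2).
Proof.
move=> s1 s2 q0 r0 qr Lq Lr; set U := vsub u1 u2.
have [Hu1 Lp1 HT1 D1 _] := s1; have [Hu2 Lp2 HT2 D2 _] := s2.
have HU : vH10 Om U := vH10B Hu1 Hu2.
have m1 : mf T1 := Lp_mf mO (H10_W1p HT1).1; have m2 : mf T2 := Lp_mf mO (H10_W1p HT2).1.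
have E1 := momentum_integ s1 HU; have E2 := momentum_integ s2 HU.
rewrite (integ_pressure_sub Lp1.1 Hu1 Hu2 (D1 _ Lp1) (D2 _ Lp1)) in E1.
rewrite (integ_pressure_sub Lp2.1 Hu1 Hu2 (D1 _ Lp2) (D2 _ Lp2)) in E2.
have mD := vgrad_dot_mf Hu1 HU.
have LU := vgrad_abs_Lp oO one2 (vH10_vW1p HU).
have [LK K] := coef_diff_bound oO LLn q0 r0 qr m1 m2 mD Lq Lr LU (fun x _ => vgrad_dot_le _ _ x).
rewrite -[Lnrm Om r _]/(vgrad_norm Om r u1) -[Lnrm Om 2 _]/(VG U) in K.
have A : num * VG U ^+ 2 + integ Om (fun x => (nu (T1 x) - nu (T2 x)) * vgrad_dot Om u1 U x)
    <= integ Om (fun x => nu (T1 x) * vgrad_dot Om u1 U x)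
     - integ Om (fun x => nu (T2 x) * vgrad_dot Om u2 U x).
  have Ld i : Lp Om 1 (fun x => (nu (T1 x) - nu (T2 x)) * grad_dot Om (u1 i) (U i) x).
    have La := coef_grad_Lp LLn num0 nb m1 (H10_W1p (Hu1 i)) (H10_W1p (HU i)).
    have Lb := coef_grad_Lp LLn num0 nb m2 (H10_W1p (Hu1 i)) (H10_W1p (HU i)).
    have := (LpB mO (lexx 1) La Lb).1; congr (Lp _ _ _).
    by apply/funext => x /=; rewrite mulrBl.
  rewrite (vgrad_coef_Lp m1 Hu1 HU).2 (vgrad_coef_Lp m2 Hu2 HU).2 -sumrB.
  have -> : (fun x => (nu (T1 x) - nu (T2 x)) * vgrad_dot Om u1 U x) =
     (fun x => \sum_i (nu (T1 x) - nu (T2 x)) * grad_dot Om (u1 i) (U i) x).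
    by apply/funext => x; rewrite mulr_sumr.
  rewrite (integ_sum mO _ Ld) (vgrad_norm_sqr oO (vH10_vW1p HU)) mulr_sumr -big_split/=.
  apply: ler_sum => i _; rewrite (coef_split LLn num0 nb m1 m2 (Hu1 i) (Hu2 i)) lerD2r.
  exact: (coercive LLn num0 nb m2 (H10_W1p (HU i))).
have B : integ Om (vdot (vadv Om u1 u1) U) - integ Om (vdot (vadv Om u2 u2) U) =
    integ Om (vdot (vadv Om U u1) U).
  rewrite (vadv_Lp Hu1 Hu1 HU).2 (vadv_Lp Hu2 Hu2 HU).2 (vadv_Lp HU Hu1 HU).2 -sumrB.
  by apply: eq_bigr => i _; exact: (conv_split Hu1 Hu2 (Hu1 i) (Hu2 i) D2).
have C : 0 <= integ Om (vdot u1 U) - integ Om (vdot u2 U).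
  rewrite -(integB mO (vdot_Lp Hu1 HU) (vdot_Lp Hu2 HU)); apply: Rintegral_ge0 => x _.
  rewrite /vdot -sumrB; apply: sumr_ge0 => i _.
  by rewrite -mulrBl -[U i x]/(u1 i x - u2 i x) -expr2 sqr_ge0.
have D : 0 <= integ Om (fun x => vabs u1 x `^ (s - 2) * vdot u1 U x)
     - integ Om (fun x => vabs u2 x `^ (s - 2) * vdot u2 U x).
  rewrite -(integB mO (power_Lp oO E4 s34 Hu1 HU) (power_Lp oO E4 s34 Hu2 HU)).
  apply: Rintegral_ge0 => x _.
  have := power_monotone (u1 ^~ x) (u2 ^~ x) s2_gt0; congr (0 <= _).
  rewrite /vdot !mulr_sumr -sumrB; apply: eq_bigr => i _.
  by rewrite -[U i x]/(u1 i x - u2 i x) !mulrA -mulrBl.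
have N := HCN HU Hu1 HU.
move: K N; rewrite !ler_norml => /andP[K _] /andP[N _].
exact: momentum_balance E1 E2 A B C D K N.
Qed.

End Momentum.
End Estimates.

(** * Closing the estimates *)

Section Smallness.
Variable R : realType.

(** Here X and Y stand for the gradient norms of the velocity and temperature
   differences. The heat inequality gives km d Y <= C g X, where d is the
   coercivity left after the variation of kappa is absorbed. Inserted in the
   momentum inequality, this bounds X by itself times the left-hand side of the
   smallness condition. *)
Lemma small_data_zero (num km Ln Lk Ce C CN F g gT gu GT VU N X Y : R) :
  0 < num -> 0 < km -> 0 <= Ln -> 0 <= Lk -> 0 <= C -> 0 < CN -> 0 <= gT -> 0 <= gu ->
  0 <= X -> 0 <= Y -> 0 <= GT ->
  km * GT <= g -> num * VU <= F -> N <= Ce * Y -> (0 < X -> 0 <= Ce) ->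
  km * Y ^+ 2 <= Lk * N * gT * Y + C * X * GT * Y ->
  num * X ^+ 2 <= Ln * N * gu * X + CN * X * VU * X ->
  CN / num ^+ 2 * F + (Ln * Ce * C * g * gu) / (num * km * (km - Lk * Ce * gT)) < 1 ->
  Lk * Ce * gT < km -> X = 0 /\ Y = 0.
Proof.
move=> num0 km0 Ln0 Lk0 C0 CN0 gT0 gu0 X0 Y0 GT0 hT hU hN hCe hY hX small dpos.
set d := km - Lk * Ce * gT in small; have d0 : 0 < d by rewrite subr_gt0.
have dY : km * d * Y <= C * X * g.
  have [->|Yn0] := eqVneq Y 0.
    by rewrite mulr0 !mulr_ge0//; exact: le_trans (mulr_ge0 (ltW km0) GT0) hT.
  have Yp : 0 < Y by rewrite lt_neqAle eq_sym Yn0.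
  have h1 : km * Y <= Lk * (Ce * Y) * gT + C * X * GT.
    rewrite -(ler_pM2r Yp) mulrDl; apply: le_trans (_ : Lk * N * gT * Y + C * X * GT * Y <= _).
      by move: hY; rewrite expr2 mulrA.
    by rewrite lerD2r; do 2 apply: ler_wpM2r => //; exact: ler_wpM2l.
  have h2 : d * Y <= C * X * GT by rewrite /d; lra.
  have h3 : km * (d * Y) <= km * (C * X * GT) by exact: ler_wpM2l (ltW km0) _ _ h2.
  have h4 : C * X * (km * GT) <= C * X * g by apply: ler_wpM2l => //; exact: mulr_ge0.
  by move: h3 h4; rewrite -mulrA mulrCA -!mulrA; lra.
have [XE|Xn0] := eqVneq X 0.
  split => //; apply/eqP; rewrite eq_le Y0 andbT.
  by move: dY; rewrite XE mulr0 mul0r pmulr_rle0// mulr_gt0.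
exfalso; have Xp : 0 < X by rewrite lt_neqAle eq_sym Xn0.
have Ce0 := hCe Xp; pose K := Ln * Ce * gu.
have K0 : 0 <= K by rewrite /K !mulr_ge0.
have g1 : num * X <= K * Y + CN * X * VU.
  move: hX; rewrite expr2 mulrA => hX.
  rewrite -(ler_pM2r Xp) mulrDl; apply: le_trans hX _; rewrite lerD2r.
  apply: ler_wpM2r => //; rewrite /K.
  have := ler_wpM2r gu0 (ler_wpM2l Ln0 hN); lra.
have kd0 : 0 < km * d by exact: mulr_gt0.
have nkd0 : 0 < num * (km * d) by exact: mulr_gt0.
have g2 : num * (km * d) * (num * X) <= num * (km * d) * (K * Y + CN * X * VU).
  by rewrite ler_pM2l.
have g3 : num * K * (km * d * Y) <= num * K * (C * X * g).
  by apply: ler_wpM2l => //; rewrite mulr_ge0// ltW.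
have g4 : (km * d) * CN * X * (num * VU) <= (km * d) * CN * X * F.
  by apply: ler_wpM2l => //; rewrite !mulr_ge0// ltW.
have g5 : (num ^+ 2 * (km * d)) * X <= (num * K * C * g + (km * d) * CN * F) * X.
  have e1 : num ^+ 2 * (km * d) * X = num * (km * d) * (num * X) by ring.
  have e2 : (num * K * C * g + km * d * CN * F) * X =
    num * K * (C * X * g) + (km * d) * CN * X * F by ring.
  have e3 : num * (km * d) * (K * Y + CN * X * VU) =
    num * K * (km * d * Y) + (km * d) * CN * X * (num * VU) by ring.
  by rewrite e1 e2; apply: le_trans g2 _; rewrite e3 lerD.
rewrite ler_pM2r// in g5.
have n2kd0 : 0 < num ^+ 2 * (km * d) by rewrite mulr_gt0// exprn_gt0.
move: small; rewrite -(ltr_pM2r n2kd0) mul1r => /lt_le_trans/(_ g5).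
have -> : (CN / num ^+ 2 * F + Ln * Ce * C * g * gu / (num * km * d)) * (num ^+ 2 * (km * d)) =
    num * K * C * g + km * d * CN * F.
  by rewrite /K; field; rewrite !gt_eqF.
by rewrite ltxx.
Qed.

(** The reciprocals of the two exponents add up to 1/2, which leaves room for one
   more factor in L2. *)
Lemma exponents (eps : R) : 0 < eps ->
  [/\ 0 < 2 * (2 + eps) / eps, 1 <= 2 + eps &
      (2 * (2 + eps) / eps)^-1 + (2 + eps)^-1 = 2^-1].
Proof.
move=> e0; have e2 : 0 < 2 + eps by lra.
split; first by rewrite divr_gt0// mulr_gt0.
  by lra.
by field; rewrite !gt_eqF.
Qed.

Lemma ae_ord2 (P : 'I_2 -> R * R -> Prop) :
  (forall i, {ae leb2 R, forall x, P i x}) -> {ae leb2 R, forall x, forall i, P i x}.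
Proof.
move=> H; move: (H 0) (H 1); apply: filterS2 => x p0 p1 i.
by have [->|->] := ord2_cases i.
Qed.

End Smallness.

(** * The pressure *)

Section Pressure.
Variables (R : realType) (Om : set (R * R)) (C4 : R).
Hypotheses (oO : open Om) (cO : connected Om) (nO : Om !=set0)
  (fO : (leb2 R Om < +oo)%E) (E4 : embedding_constant Om 4 C4).
Let mO := measurable_open_plane oO.
Local Notation mu := (leb2 R).
Local Notation wp := (weak_partial Om).
Let zero2 : (0 : R) < 2. Proof. lra. Qed.

Lemma pressure_balance (a b c d p q t : R) :
  a + b + c + d - p = t -> a + b + c + d - q = t -> p = q.
Proof. lra. Qed.

(** A test field with a single nonzero component isolates one partial derivative
   of the pressure. *)
Lemma integ_pressure_test (p : sfield R) (phi : sfield R) (j : 'I_2) :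
  Lp Om 2 p -> test_function Om phi ->
  let v : vfield R := fun i => if i == j then phi else cst 0 in
  vH10 Om v /\
  integ Om (fun x => p x * div Om v x) = integ Om (fun x => p x * 'D_(basis2 R j) phi x).
Proof.
move=> Lp tp v.
have tv i : test_function Om (v i).
  by rewrite /v; case: (i == j) => //; exact: test0.
have Hv : vH10 Om v by move=> i; exact: test_H10.
split => //; apply: (ae_eq_integ mO).
- exact: (Lp_mf mO (cauchy_schwarz_Lp mO Lp (div_L2 oO Hv)).1).
- apply: (Lp_mf mO (cauchy_schwarz_Lp mO Lp _).1).
  exact: (test_Lp oO fO zero2 (test_partial j tp)).
have D i := (test_W1p oO fO zero2 (tv i)).2 i.
have := ae_ord2 D; apply: filterS => x Dx Ox; congr (_ * _).
rewrite /div (bigD1 j)//= big1 => [|i ij].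
  by rewrite addr0 Dx// /v eqxx.
by rewrite Dx// /v (negbTE ij) derive_cst.
Qed.

Section TwoSolutions.
Variables (nu : R -> R) (num nup Ln s : R) (f : vfield R -> R).
Hypotheses (LLn : Ln.-lipschitz nu) (num0 : 0 < num) (s34 : 3 <= s <= 4)
  (nb : forall r, num <= nu r <= nup).
Variables (u1 u2 : vfield R) (p1 p2 T1 T2 : sfield R).
Hypotheses (sol1 : momentum_solution Om nu s f u1 p1 T1)
  (sol2 : momentum_solution Om nu s f u2 p2 T2).
Hypothesis same : {ae mu, forall x, Om x -> T1 x = T2 x /\
  forall i, u1 i x = u2 i x /\ forall j, wp j (u1 i) x = wp j (u2 i) x}.

Lemma integ_pressure_eq (v : vfield R) : vH10 Om v ->
  integ Om (fun x => p1 x * div Om v x) = integ Om (fun x => p2 x * div Om v x).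
Proof.
move=> Hv; have E1 := momentum_integ oO E4 LLn num0 s34 nb sol1 Hv.
have E2 := momentum_integ oO E4 LLn num0 s34 nb sol2 Hv.
have [Hu1 _ HT1 _ _] := sol1; have [Hu2 _ HT2 _ _] := sol2.
have m1 := Lp_mf mO (H10_W1p HT1).1; have m2 := Lp_mf mO (H10_W1p HT2).1.
have A : integ Om (fun x => nu (T1 x) * vgrad_dot Om u1 v x) =
    integ Om (fun x => nu (T2 x) * vgrad_dot Om u2 v x).
  apply: (ae_eq_integ mO).
  - exact: (Lp_mf mO (vgrad_coef_Lp oO LLn num0 nb m1 Hu1 Hv).1).
  - exact: (Lp_mf mO (vgrad_coef_Lp oO LLn num0 nb m2 Hu2 Hv).1).
  - move: same; apply: filterS => x H /H [-> U]; congr (_ * _).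
    apply: eq_bigr => i _; apply: eq_bigr => j _; congr (_ * _).
    exact: (U i).2.
have B : integ Om (vdot (vadv Om u1 u1) v) = integ Om (vdot (vadv Om u2 u2) v).
  apply: (ae_eq_integ mO).
  - exact: (Lp_mf mO (vadv_Lp oO E4 Hu1 Hu1 Hv).1).
  - exact: (Lp_mf mO (vadv_Lp oO E4 Hu2 Hu2 Hv).1).
  - move: same; apply: filterS => x H /H [_ U].
    apply: eq_bigr => i _; congr (_ * _); apply: eq_bigr => j _.
    by rewrite (U j).1 (U i).2.
have C : integ Om (vdot u1 v) = integ Om (vdot u2 v).
  apply: (ae_eq_integ mO).
  - exact: (Lp_mf mO (vdot_Lp oO Hu1 Hv)).
  - exact: (Lp_mf mO (vdot_Lp oO Hu2 Hv)).
  - move: same; apply: filterS => x H /H [_ U].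
    by apply: eq_bigr => i _; rewrite (U i).1.
have D : integ Om (fun x => vabs u1 x `^ (s - 2) * vdot u1 v x) =
    integ Om (fun x => vabs u2 x `^ (s - 2) * vdot u2 v x).
  apply: (ae_eq_integ mO).
  - exact: (Lp_mf mO (power_Lp oO E4 s34 Hu1 Hv)).
  - exact: (Lp_mf mO (power_Lp oO E4 s34 Hu2 Hv)).
  - move: same; apply: filterS => x H /H [_ U].
    have -> : vabs u1 x = vabs u2 x.
      by congr Num.sqrt; apply: eq_bigr => i _; rewrite (U i).1.
    by congr (_ * _); apply: eq_bigr => i _; rewrite (U i).1.
rewrite A B C D in E1.
exact: pressure_balance E1 E2.
Qed.

(** The two pressures have the same distributional gradient, hence differ by a
   constant on the connected domain, and both have zero mean. *)
Lemma pressure_unique : {ae mu, forall x, Om x -> p2 x = p1 x}.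
Proof.
have [_ L1 _ _ _] := sol1; have [_ L2 _ _ _] := sol2.
have Lq := LpB mO (ler1n R 2) L1.1 L2.1.
have iq := (Lp1_integrable mO _).1 (L2_L1 oO fO Lq.1).
have lq : locally_integrable2 Om (p1 \- p2).
  move=> K KO cK; apply: integrableS iq => //; exact: measurable_compact_plane.
have [j phi tp|C HC] := zero_gradient_connected oO cO nO lq.
  have [Hv E1] := integ_pressure_test j L1.1 tp.
  have [_ E2] := integ_pressure_test j L2.1 tp.
  have Ld := test_Lp oO fO zero2 (test_partial j tp).
  have := integB mO (cauchy_schwarz_Lp mO L1.1 Ld).1 (cauchy_schwarz_Lp mO L2.1 Ld).1.
  rewrite -E1 -E2 (integ_pressure_eq Hv) subrr => E.
  by apply: etrans E; congr (integ Om _); apply/funext => x; exact: mulrBl.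
have C0 : C = 0.
  have : integ Om (p1 \- p2) = integ Om (cst C).
    apply: (ae_eq_integ mO) HC; [exact: (Lp_mf mO Lq.1)|exact: measurable_cst].
  rewrite (integB mO (L2_L1 oO fO L1.1) (L2_L1 oO fO L2.1)) L1.2 L2.2 subrr.
  have [x0 Ox0] := nO; have m0 := open_measure_gt0 oO Ox0.
  have fm0 : fine (mu Om) != 0 by rewrite gt_eqF// fine_gt0// m0.
  move=> /esym E; have {E} : C * fine (mu Om) = 0 := etrans (esym (Rintegral_cst mu mO C)) E.
  by move=> /eqP; rewrite mulf_eq0 (negbTE fm0) orbF => /eqP.
apply: filterS HC => x H /H; rewrite C0 => /eqP; rewrite subr_eq0 => /eqP ->.
by [].
Qed.

End TwoSolutions.
End Pressure.

(** * Uniqueness *)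

Unset Implicit Arguments.

Theorem theorem3p4 (R : realType) (Om : set (R * R)) (s : R)
    (nu kappa : R -> R) (Lnu Lkappa num nup kappam kappap : R)
    (f : vfield R -> R) (g : sfield R -> R) (CN C4 eps Ceps : R)
    (u1 : vfield R) (p1 T1 : sfield R) :
  bounded_lipschitz_domain Om ->
  3 <= s <= 4 ->
  Lnu.-lipschitz nu -> Lkappa.-lipschitz kappa ->
  0 < num -> 0 < nup -> 0 < kappam -> 0 < kappap ->
  (forall r, num <= nu r <= nup) -> (forall r, kappam <= kappa r <= kappap) ->
  vHm1 Om f -> Hm1 Om g ->
  0 < CN -> convection_constant Om CN ->
  best_embedding_constant Om 4 C4 ->
  0 < eps ->
  best_embedding_constant Om (2 * (2 + eps) / eps) Ceps ->
  vW1p Om (2 + eps) u1 -> W1p Om (2 + eps) T1 ->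
  weak_solution Om s nu kappa f g u1 p1 T1 ->
  CN / num ^+ 2 * vHm1_norm Om f
    + (Lnu * Ceps * C4 ^+ 2 * Hm1_norm Om g * vgrad_norm Om (2 + eps) u1)
      / (num * kappam * (kappam - Lkappa * Ceps * grad_norm Om (2 + eps) T1))
    < 1 ->
  Lkappa * Ceps * grad_norm Om (2 + eps) T1 < kappam ->
  forall (u2 : vfield R) (p2 T2 : sfield R),
    weak_solution Om s nu kappa f g u2 p2 T2 ->
    {ae leb2 R, forall x, Om x ->
       (forall i, u2 i x = u1 i x) /\ p2 x = p1 x /\ T2 x = T1 x}.
Proof.
move=> [oO cO nO bO _] s34 LLn LLk num0 _ km0 _ nb kb Hf Hg CN0 HCN [E4 _] eps0 [Ee _]
  Wu1 WT1 ws1 small dpos u2 p2 T2 ws2.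
have mO := measurable_open_plane oO; have fO := bounded_measure_lty mO bO.
have [q0 r1 qr] := exponents eps0; have r0 := lt_le_trans ltr01 r1.
have [[Hu1 Lp1 HT1] [M1 D1 Q1]] := ws1; have [[Hu2 Lp2 HT2] [M2 D2 Q2]] := ws2.
have h1 : heat_solution Om kappa g u1 T1 := And4 Hu1 HT1 D1 Q1.
have h2 : heat_solution Om kappa g u2 T2 := And4 Hu2 HT2 D2 Q2.
have m1 : momentum_solution Om nu s f u1 p1 T1 :=
  And5 Hu1 Lp1 HT1 D1 M1.
have m2 : momentum_solution Om nu s f u2 p2 T2 :=
  And5 Hu2 Lp2 HT2 D2 M2.
have HS := H10B oO fO HT1 HT2; have HU := vH10B oO fO Hu1 Hu2.
have [LS NS] := embedding_Lp oO Ee HS.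
have Lg := grad_abs_Lp oO r1 WT1; have Lgu := vgrad_abs_Lp oO r1 Wu1.
(* A negative constant in the embedding would force all gradients in H10 to
   vanish, in particular that of the velocity difference. *)
have Ce0 : 0 < vgrad_norm Om 2 (vsub u1 u2) -> 0 <= Ceps.
  move=> X0; rewrite leNgt; apply/negP => C0; move: X0; apply/negP; rewrite -leNgt.
  suff G0 i : grad_norm Om 2 (vsub u1 u2 i) = 0.
    have := vgrad_norm_sqr oO (vH10_vW1p HU); rewrite big1 => [/eqP|i _].
      by rewrite sqrf_eq0 => /eqP ->.
    by rewrite G0 expr0n.
  have [_ N] := embedding_Lp oO Ee (HU i).
  apply/eqP; rewrite eq_le grad_norm_ge0 andbT -(nmulr_rge0 _ C0).
  exact: le_trans (Lnrm_ge0 _ _ _) N.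
have [X0 Y0] := small_data_zero num0 km0 (lipschitz_ge0 LLn) (lipschitz_ge0 LLk)
  (sqr_ge0 C4) CN0 (grad_norm_ge0 Om (2 + eps) T1) (vgrad_norm_ge0 Om (2 + eps) u1)
  (vgrad_norm_ge0 Om 2 (vsub u1 u2)) (grad_norm_ge0 Om 2 (T1 \- T2))
  (grad_norm_ge0 Om 2 T1)
  (heat_energy oO nO fO E4 LLk km0 kb Hg h1)
  (momentum_energy oO nO fO E4 LLn num0 s34 nb Hf m1) NS Ce0
  (heat_difference oO nO fO E4 LLk km0 kb h1 h2 q0 r0 qr LS Lg)
  (momentum_difference oO nO fO E4 LLn num0 s34 nb HCN m1 m2 q0 r0 qr LS Lgu) small dpos.
have Gi i : grad_norm Om 2 (vsub u1 u2 i) = 0.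
  have := vgrad_norm_sqr oO (vH10_vW1p HU); rewrite X0 expr0n/= => /esym/eqP.
  rewrite psumr_eq0 => [/allP/(_ i (mem_index_enum i))|j _]; last exact: sqr_ge0.
  by rewrite /= sqrf_eq0 => /eqP.
have zero4 : (0 : R) < 4 by rewrite ltr0n.
have zero2 : (0 : R) < 2 by rewrite ltr0n.
have T0 := grad_norm_eq0 oO zero4 E4 HS Y0.
have U0 := ae_ord2 (fun i => grad_norm_eq0 oO zero4 E4 (HU i) (Gi i)).
have P0 i j : {ae leb2 R, forall x, Om x ->
    weak_partial Om j (u1 i) x = weak_partial Om j (u2 i) x}.
  have WU := H10_W1p (HU i); have [_ L] := W1p_partial oO zero2 WU j.
  have N0 : Lnrm Om 2 (weak_partial Om j (vsub u1 u2 i)) = 0.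
    apply/eqP; rewrite eq_le Lnrm_ge0 andbT -(Gi i); exact: Lnrm_partial_le.
  move: (Lnrm_eq0 mO zero2 L N0) (partialB oO j (Hu1 i) (Hu2 i)).
  apply: filterS2 => x + + Ox => /(_ Ox) z /(_ Ox) e.
  by apply/eqP; rewrite -subr_eq0 -e; apply/eqP.
have same : {ae leb2 R, forall x, Om x -> T1 x = T2 x /\
    forall i, u1 i x = u2 i x /\
      forall j, weak_partial Om j (u1 i) x = weak_partial Om j (u2 i) x}.
  have P0' := ae_ord2 (fun i => ae_ord2 (P0 i)).
  move: T0 U0 P0'; apply: filterS3 => x t u w Ox; split.
    by apply/eqP; rewrite -subr_eq0; apply/eqP; exact: t.
  move=> i; split; last by move=> j; exact: w.
  by apply/eqP; rewrite -subr_eq0; apply/eqP; exact: u.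
have pE := pressure_unique oO cO nO fO E4 LLn num0 s34 nb m1 m2 same.
move: same pE; apply: filterS2 => x e p Ox; have [t u] := e Ox.
by split; [move=> i; rewrite (u i).1|split; [exact: p|rewrite t]].
Qed.
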